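(* Let $\mathcal{G}$ be a second countable locally compact abelian group, $\pi$ a dual integrable representation of $\mathcal{G}$ on a separable Hilbert space $\mathcal{H}$, and $(\theta_i)_{i\in I}$ a family of orthogonal generators for $\pi$, with $T\colon\mathcal{H}\to L^2(\hat{\mathcal{G}};l^2(I))$ and $J_0$ as defined in the context. The $\pi$-invariant subspaces of $\mathcal{H}$ are indexed by equivalence classes of measurable range functions $J\colon\hat{\mathcal{G}}\to\{\text{closed subspaces of }l^2(I)\}$ satisfying $$J(\alpha)\subseteq J_0(\alpha)\quad\text{for a.e. }\alpha\in\hat{\mathcal{G}}:$$ the map $J\mapsto V_J$, where $V_J=\{\varphi\in\mathcal{H}:(T\varphi)(\alpha)\in J(\alpha)\text{ for a.e. }\alpha\in\hat{\mathcal{G}}\}$, is a bijection. If $\mathscr{A}\subseteq\mathcal{H}$ has a countable dense subset $\mathscr{A}_0\subseteq\mathscr{A}$, then the range function $J\colon\hat{\mathcal{G}}\to\{\text{closed subspaces of }l^2(I)\}$ given by $$J(\alpha)=\overline{\operatorname{span}}\{(T\varphi)(\alpha):\varphi\in\mathscr{A}_0\}$$ satisfies $V_J=S(\mathscr{A}_0)=S(\mathscr{A})$.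
   Context: $\hat{\mathcal{G}}$ is the dual group with Haar measure $\mu_{\hat{\mathcal{G}}}$ dual to a fixed Haar measure $\mu_{\mathcal{G}}$. A representation $\pi$ of $\mathcal{G}$ on $\mathcal{H}$ is a strongly continuous homomorphism into the unitary group of $\mathcal{H}$. It is dual integrable if there is a (necessarily unique) function $[\cdot,\cdot]\colon\mathcal{H}\times\mathcal{H}\to L^1(\hat{\mathcal{G}})$, the bracket, with $\langle\varphi,\pi(x)\psi\rangle=\int_{\hat{\mathcal{G}}}[\varphi,\psi](\alpha)\overline{\alpha(x)}\,d\mu_{\hat{\mathcal{G}}}(\alpha)$ for all $\varphi,\psi\in\mathcal{H}$, $x\in\mathcal{G}$. Put $\langle\psi\rangle=\overline{\operatorname{span}}\{\pi(x)\psi:x\in\mathcal{G}\}$. Orthogonal generators for $\pi$ are vectors $(\theta_i)_{i\in I}$, $I$ countable, with $\mathcal{H}=\bigoplus_{i\in I}\langle\theta_i\rangle$ (orthogonal direct sum). Let $\Omega_i=\{\alpha\in\hat{\mathcal{G}}:[\theta_i,\theta_i](\alpha)\ne0\}$, let $\delta_i$ be the standard basis of $l^2(I)$, and define $$T(\varphi)(\alpha)=\left(\mathbf{1}_{\Omega_i}(\alpha)\frac{[\varphi,\theta_i](\alpha)}{([\theta_i,\theta_i](\alpha))^{1/2}}\right)_{i\in I},\qquad J_0(\alpha)=\overline{\operatorname{span}}\{\mathbf{1}_{\Omega_i}(\alpha)\delta_i:i\in I\}.$$ A closed subspace $M\subseteq\mathcal{H}$ is $\pi$-invariant if $\pi(x)\varphi\in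 M$ for all $\varphi\in M$, $x\in\mathcal{G}$. $S(\mathscr{A})=\overline{\operatorname{span}}\{\pi(x)\varphi:x\in\mathcal{G},\varphi\in\mathscr{A}\}$. A range function $J\colon\hat{\mathcal{G}}\to\{\text{closed subspaces of }l^2(I)\}$ is measurable if $\alpha\mapsto\langle P_J(\alpha)u,v\rangle$ is measurable for all $u,v\in l^2(I)$, $P_J(\alpha)$ being orthogonal projection onto $J(\alpha)$; two range functions are equivalent if they agree a.e. *)

(* Defs.v *)
From HB Require Import structures.
From mathcomp Require Import all_boot all_order all_algebra.
From mathcomp Require Import all_classical all_reals all_analysis.
From mathcomp Require Import complex.
From mathcomp Require Import ring lra.

Set Implicit Arguments.
Unset Strict Implicit.
Unset Printing Implicit Defensive.

Import Order.TTheory GRing.Theory Num.Theory.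
Import numFieldNormedType.Exports.

Local Open Scope classical_set_scope.
Local Open Scope ring_scope.

(* [inner] is linear in its first argument and conjugate-linear in the second
   one. *)
HB.mixin Record NormedModule_isInnerProduct (R : realType) V
    & NormedModule R[i] V := {
  inner : {dot V for @Num.conj R[i]} ;
  sqr_norm_inner : forall u : V, `|u| ^+ 2 = inner u u
}.

#[short(type="innerProductType")]
HB.structure Definition InnerProduct (R : realType) :=
  {V of NormedModule R[i] V & NormedModule_isInnerProduct R V}.

#[short(type="hilbertType")]
HB.structure Definition Hilbert (R : realType) :=
  {V of InnerProduct R V & CompleteNormedModule R[i] V}.

Notation "''[' u , v ]" := (inner u v) : ring_scope.

Section dot_norm.
Variables (C : numClosedFieldType) (U : lmodType C) (form : {dot U for @Num.conj C}).

Lemma dot_cauchy_schwarz (u v : U) :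
  `|form u v| ^+ 2 <= form u u * form v v.
Proof.
have [->|v0] := eqVneq v 0; first by rewrite linear0r normr0 expr0n/= mulr_ge0 ?dnorm_ge0.
have vgt0 : 0 < form v v by rewrite dnorm_gt0.
pose a := form u v / form v v.
have ov : form (u - a *: v) v = 0.
  by rewrite linearBl/= linearZl_LR/= divfK ?gt_eqF// subrr.
have -> : form u u = form (u - a *: v) (u - a *: v) + `|a| ^+ 2 * form v v.
  rewrite -dnormZ -hnormDd ?subrK//.
  by rewrite linearZr_LR/= ov mulr0.
rewrite mulrDl -[leLHS]add0r lerD ?mulr_ge0 ?dnorm_ge0//.
rewrite normf_div (ger0_norm (ltW vgt0)) expr_div_n -mulrA -expr2.
by rewrite divfK// sqrf_eq0 gt_eqF.
Qed.

Lemma dot_norm_triangle (u v : U) :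
  sqrtC (form (u + v) (u + v)) <= sqrtC (form u u) + sqrtC (form v v).
Proof.
rewrite -ler_sqr ?nnegrE ?addr_ge0 ?sqrtC_ge0 ?dnorm_ge0//.
rewrite sqrrD !sqrtCK dnormD [leRHS]addrAC lerD2l.
have : `|form u v| <= sqrtC (form u u) * sqrtC (form v v).
  rewrite -ler_sqr ?nnegrE ?mulr_ge0 ?sqrtC_ge0 ?dnorm_ge0//.
  by rewrite exprMn !sqrtCK dot_cauchy_schwarz.
move=> h; have {h} := lerD h h; rewrite -mulr2n => h.
apply: le_trans h.
rewrite (le_trans (real_ler_norm _)) ?(le_trans (ler_normD _ _))//.
  by rewrite CrealE rmorphD/= conjCK addrC.
by rewrite norm_conjC.
Qed.

End dot_norm.

Section sums.
Variables (R : realType) (I : choiceType).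
Implicit Types f g : I -> R.

(* The sum of an absolutely summable family; meaningless for other families. *)
Definition rsum f : R :=
  fine (\esum_(i in [set: I]) ((EFin \o f)^\+)%E i) -
  fine (\esum_(i in [set: I]) ((EFin \o f)^\-)%E i).

Definition csum (f : I -> R[i]) : R[i] :=
  (rsum (fun i => complex.Re (f i)) +i* rsum (fun i => complex.Im (f i)))%C.

Local Notation summ f := (summable [set: I] (EFin \o f)).

Lemma summ_fin f : summ f -> (forall i, 0 <= f i) ->
  \esum_(i in [set: I]) (f i)%:E \is a fin_num.
Proof.
rewrite summableE => h f0; rewrite (_ : esum _ _ = \esum_(i in [set: I]) `|(EFin \o f) i|%E)//.
by apply: eq_esum => i _; rewrite /= ger0_norm.
Qed.

Lemma le_summ f g : (forall i, `|f i| <= g i) -> summ g -> summ f.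
Proof.
move=> fg; apply: le_lt_trans; apply: le_esum => i _ /=.
by rewrite lee_fin (le_trans (fg i)) ?ler_norm.
Qed.

Lemma summD f g : summ f -> summ g -> summ (fun i => f i + g i).
Proof. by move=> sf sg; have := summableD sf sg. Qed.

Lemma esumZ f (c : R) : 0 <= c -> summ f -> (forall i, 0 <= f i) ->
  \esum_(i in [set: I]) (c * f i)%:E = (c%:E * \esum_(i in [set: I]) (f i)%:E)%E.
Proof.
have H d g : 0 <= d -> (forall i, 0 <= g i) ->
  (\esum_(i in [set: I]) (d * g i)%:E <= d%:E * \esum_(i in [set: I]) (g i)%:E)%E.
  move=> d0 g0; apply: ge_ereal_sup => _ [A Afs <-].
  under eq_fsbigr do rewrite EFinM.
  rewrite -ge0_mule_fsumr; last by move=> i; rewrite lee_fin.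
  by rewrite lee_wpmul2l ?lee_fin//; apply: ereal_sup_ubound; exists A.
move=> c0 sf f0; have [->|cn0] := eqVneq c 0.
  by rewrite mul0e esum1// => i _; rewrite mul0r.
apply/le_anti; rewrite H//=.
have ci : 0 <= c^-1 by rewrite invr_ge0.
have cf0 i : 0 <= c * f i by rewrite mulr_ge0.
have := H _ _ ci cf0.
under eq_esum do rewrite mulKf//.
move=> h; have c0E : (0 <= c%:E)%E by rewrite lee_fin.
apply: le_trans (lee_wpmul2l c0E h) _.
by rewrite muleA -EFinM mulfV// mul1e.
Qed.

Lemma summZ f c : summ f -> summ (fun i => c * f i).
Proof.
move=> sf; have := sf; rewrite /summable.
rewrite (_ : esum _ _ = \esum_(i in [set: I]) (`|f i|)%:E)//.
move=> fo; rewrite (_ : esum _ _ = \esum_(i in [set: I]) (`|c| * `|f i|)%:E); last first.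
  by apply: eq_esum => i _ /=; rewrite normrM.
rewrite esumZ//; last by rewrite /summable /=; under eq_esum do rewrite /= normr_id.
rewrite lte_mul_pinfty//.
Qed.

Lemma rsumBE f g : summ f -> summ g -> (forall i, 0 <= f i) ->
  (forall i, 0 <= g i) ->
  rsum (fun i => f i - g i) = fine (\esum_(i in [set: I]) (f i)%:E) -
    fine (\esum_(i in [set: I]) (g i)%:E).
Proof.
move=> sf sg f0 g0.
have sB : summ (fun i => f i - g i) by have := summableB sf sg.
have sp : esum [set: I] ((EFin \o (fun i => f i - g i)%R)^\+)%E \is a fin_num.
  rewrite (eq_esum (b := abse \o ((EFin \o (fun i => f i - g i)%R)^\+)%E)).
    by rewrite -summableE; exact: summable_funepos.
  by move=> i _; rewrite /= gee0_abs.
have sn : esum [set: I] ((EFin \o (fun i => f i - g i)%R)^\-)%E \is a fin_num.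
  rewrite (eq_esum (b := abse \o ((EFin \o (fun i => f i - g i)%R)^\-)%E)).
    by rewrite -summableE; exact: summable_funeneg.
  by move=> i _; rewrite /= gee0_abs.
have h := esumB sf sg (fun i _ => f0 i) (fun i _ => g0 i).
by rewrite /rsum -!fineB ?summ_fin// -h.
Qed.

Lemma ge0_rsumE f : summ f -> (forall i, 0 <= f i) ->
  rsum f = fine (\esum_(i in [set: I]) (f i)%:E).
Proof.
move=> sf f0; rewrite -[LHS]/(rsum (fun i => f i)).
have s0 : summ (fun=> 0 : R).
  by apply: le_summ sf => i; rewrite normr0.
rewrite (_ : (fun i => f i) = (fun i => f i - 0)); last first.
  by apply/funext => i; rewrite subr0.
rewrite rsumBE// [X in _ - fine X]esum1 ?subr0//.
Qed.

Let pos f i := Num.max (f i) 0.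
Let neg f i := Num.max (- f i) 0.
Let pos_neg f i : f i = pos f i - neg f i.
Proof. by rewrite /pos /neg; have [?|?] := leP 0 (f i); have [?|?] := leP 0 (- f i); lra. Qed.
Let pos_ge0 f i : 0 <= pos f i. Proof. by rewrite /pos le_max lexx orbT. Qed.
Let neg_ge0 f i : 0 <= neg f i. Proof. by rewrite /neg le_max lexx orbT. Qed.
Let spos f : summ f -> summ (pos f).
Proof.
move=> sf; apply: (@le_summ _ (fun i => `|f i|)); last first.
  by rewrite /summable /=; under eq_esum do rewrite /= normr_id.
by move=> i; rewrite ger0_norm// /pos ge_max ler_norm normr_ge0.
Qed.
Let sneg f : summ f -> summ (neg f).
Proof.
move=> sf; apply: (@le_summ _ (fun i => `|f i|)); last first.
  by rewrite /summable /=; under eq_esum do rewrite /= normr_id.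
by move=> i; rewrite ger0_norm// /neg ge_max -normrN ler_norm normr_ge0.
Qed.

Let rsum_pn f : summ f -> rsum f =
  fine (\esum_(i in [set: I]) (pos f i)%:E) - fine (\esum_(i in [set: I]) (neg f i)%:E).
Proof.
move=> sf; have sp := spos sf; have sn := sneg sf.
rewrite -rsumBE//; congr (rsum _).
by apply/funext => i; exact: pos_neg.
Qed.

Lemma rsumD f g : summ f -> summ g ->
  rsum (fun i => f i + g i) = rsum f + rsum g.
Proof.
move=> sf sg.
have spf := spos sf; have snf := sneg sf; have spg := spos sg; have sng := sneg sg.
rewrite (_ : (fun i => _) = (fun i => (pos f i + pos g i) - (neg f i + neg g i))); last first.
  by apply/funext => i; rewrite {1}(pos_neg f) {1}(pos_neg g); ring.
rewrite rsumBE => [||||]; last 1 first.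
- by move=> i; rewrite addr_ge0.
- rewrite (rsum_pn sf) (rsum_pn sg).
  rewrite (_ : esum _ _ = (\esum_(i in [set: I]) (pos f i)%:E + \esum_(i in [set: I]) (pos g i)%:E)%E); last first.
    by rewrite -esumD => [|i _|i _]; rewrite ?lee_fin.
  rewrite (_ : (\esum_(i in _) (neg f i + neg g i)%:E)%E = (\esum_(i in [set: I]) (neg f i)%:E + \esum_(i in [set: I]) (neg g i)%:E)%E); last first.
    by rewrite -esumD => [|i _|i _]; rewrite ?lee_fin.
  rewrite !fineD ?summ_fin//; lra.
- exact: summD (spos sf) (spos sg).
- exact: summD (sneg sf) (sneg sg).
- by move=> i; rewrite addr_ge0.
Qed.

Lemma rsumZ f c : summ f -> rsum (fun i => c * f i) = c * rsum f.
Proof.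
move=> sf; have sp := spos sf; have sn := sneg sf.
have [c0|c0] := leP 0 c.
  rewrite (_ : (fun i => _) = (fun i => c * pos f i - c * neg f i)); last first.
    by apply/funext => i; rewrite {1}(pos_neg f) mulrBr.
  rewrite rsumBE; first last.
  - by move=> i; rewrite mulr_ge0.
  - by move=> i; rewrite mulr_ge0.
  - exact: summZ (sneg sf).
  - exact: summZ (spos sf).
  rewrite !esumZ// !fineM ?summ_fin//=.
  by rewrite (rsum_pn sf) mulrBr.
have c0' : 0 <= - c by rewrite oppr_ge0 ltW.
rewrite (_ : (fun i => _) = (fun i => - c * neg f i - (- c) * pos f i)); last first.
  by apply/funext => i; rewrite {1}(pos_neg f); ring.
rewrite rsumBE; first last.
- by move=> i; rewrite mulr_ge0.
- by move=> i; rewrite mulr_ge0.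
- exact: summZ (spos sf).
- exact: summZ (sneg sf).
rewrite !esumZ// !fineM ?summ_fin//=.
by rewrite (rsum_pn sf); ring.
Qed.

End sums.

Section l2.
Variables (R : realType) (I : choiceType).

Definition square_summable : {pred I -> R[i]^o} :=
  fun u => (\esum_(i in [set: I]) (Normc.normc (u i) ^+ 2)%:E < +oo)%E.

Let sqsumP (u : I -> R[i]^o) : u \in square_summable <->
  summable [set: I] (EFin \o (fun i => Normc.normc (u i) ^+ 2)).
Proof.
rewrite /summable [u \in _]/(_ < _)%E.
rewrite (@eq_esum R I [set: I] (fun i => (`| (Normc.normc (u i) ^+ 2)%:E|)%E) (fun i => (Normc.normc (u i) ^+ 2)%:E))//.
by move=> i _; rewrite gee0_abs// lee_fin sqr_ge0.
Qed.

Let normc_sq (z : R[i]) : Normc.normc z ^+ 2 = complex.Re z ^+ 2 + complex.Im z ^+ 2.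
Proof. by case: z => a b /=; rewrite sqr_sqrtr// addr_ge0 ?sqr_ge0. Qed.

Let square_summable_closed : submod_closed square_summable.
Proof.
split.
  apply/sqsumP; rewrite /summable esum1// => i _.
  rewrite [(EFin \o _) i](_ : _ = (Normc.normc (0 : R[i]) ^+ 2)%:E)//.
  by rewrite Normc.normc0 expr0n/= normr0.
move=> a u v /sqsumP su /sqsumP sv; apply/sqsumP.
apply: (@le_summ _ _ _ (fun i => (2 * Normc.normc a ^+ 2) * Normc.normc (u i) ^+ 2 + 2 * Normc.normc (v i) ^+ 2)).
  move=> i; rewrite ger0_norm ?sqr_ge0// !normc_sq.
  rewrite -[(a *: u + v) i]/(a * u i + v i).
  case: a (u i) (v i) => a1 a2 [u1 u2] [v1 v2] /=.
  rewrite -subr_ge0.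
  set e := (X in 0 <= X).
  suff -> : e = (a1 * u1 - a2 * u2 - v1) ^+ 2 + (a1 * u2 + a2 * u1 - v2) ^+ 2.
    by rewrite addr_ge0 ?sqr_ge0.
  by rewrite /e; ring.
by apply: summD; apply: summZ.
Qed.

HB.instance Definition _ :=
  GRing.isSubmodClosed.Build R[i] (I -> R[i]^o) square_summable
    square_summable_closed.

Record l2 := L2 { l2val :> I -> R[i]^o ; l2valP : square_summable l2val }.

HB.instance Definition _ := [isSub for l2val].
HB.instance Definition _ := [Choice of l2 by <:].
HB.instance Definition _ := [SubChoice_isSubLmodule of l2 by <:].

Definition l2dot (u v : l2) : R[i] := csum (fun i => u i * (v i)^*).

Let summ (f : I -> R[i]) :=
  summable [set: I] (EFin \o (fun i => complex.Re (f i))) /\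
  summable [set: I] (EFin \o (fun i => complex.Im (f i))).

Let sqsum_l2 (u : l2) : summable [set: I] (EFin \o (fun i => Normc.normc (u i) ^+ 2)).
Proof. exact: ((sqsumP (l2val u)).1 (l2valP u)). Qed.

Let summM (u v : l2) : summ (fun i => u i * (v i)^*).
Proof.
have su := sqsum_l2 u.
have sv := sqsum_l2 v.
split; apply: le_summ (summD su sv) => i;
  rewrite !normc_sq; case: (u i) (v i) => a b [c d] /=;
  rewrite ler_norml; apply/andP; split; rewrite -subr_ge0.
- rewrite (_ : _ - _ = (2^-1 * (a ^+ 2 + b ^+ 2 + c ^+2 + d ^+ 2) + 2^-1 * ((a + c) ^+ 2 + (b + d) ^+ 2))); last by field.
  by rewrite addr_ge0// mulr_ge0// ?invr_ge0 ?addr_ge0 ?sqr_ge0.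
- rewrite (_ : _ - _ = (2^-1 * (a ^+ 2 + b ^+ 2 + c ^+2 + d ^+ 2) + 2^-1 * ((a - c) ^+ 2 + (b - d) ^+ 2))); last by field.
  by rewrite addr_ge0// mulr_ge0// ?invr_ge0 ?addr_ge0 ?sqr_ge0.
- rewrite (_ : _ - _ = (2^-1 * (a ^+ 2 + b ^+ 2 + c ^+2 + d ^+ 2) + 2^-1 * ((a - d) ^+ 2 + (b + c) ^+ 2))); last by field.
  by rewrite addr_ge0// mulr_ge0// ?invr_ge0 ?addr_ge0 ?sqr_ge0.
- rewrite (_ : _ - _ = (2^-1 * (a ^+ 2 + b ^+ 2 + c ^+2 + d ^+ 2) + 2^-1 * ((a + d) ^+ 2 + (b - c) ^+ 2))); last by field.
  by rewrite addr_ge0// mulr_ge0// ?invr_ge0 ?addr_ge0 ?sqr_ge0.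
Qed.

Let csumP (a : R[i]) f g : summ f -> summ g ->
  csum (fun i => a * f i + g i) = a * csum f + csum g.
Proof.
case: a => a b [f1 f2] [g1 g2]; rewrite /csum.
have Z c h : summable [set: I] (EFin \o h) -> summable [set: I] (EFin \o (fun i => c * h i : R)).
  exact: summZ.
have -> : (fun i => complex.Re ((a +i* b)%C * f i + g i)) =
    (fun i => (a * complex.Re (f i) + - b * complex.Im (f i)) + complex.Re (g i)).
  by apply/funext => i; case: (f i) (g i) => ? ? [? ?] /=; ring.
have -> : (fun i => complex.Im ((a +i* b)%C * f i + g i)) =
    (fun i => (a * complex.Im (f i) + b * complex.Re (f i)) + complex.Im (g i)).
  by apply/funext => i; case: (f i) (g i) => ? ? [? ?] /=; ring.
have sRe := summD (Z a _ f1) (Z (- b) _ f2).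
have sIm := summD (Z a _ f2) (Z b _ f1).
rewrite (rsumD sRe g1) (rsumD sIm g2).
rewrite (rsumD (Z a _ f1) (Z (- b) _ f2)) (rsumD (Z a _ f2) (Z b _ f1)).
rewrite (rsumZ a f1) (rsumZ (- b) f2) (rsumZ a f2) (rsumZ b f1).
by apply/eqP; rewrite eq_complex /=; apply/andP; split; apply/eqP; ring.
Qed.

Let csum_conj f : summ f -> csum (fun i => (f i)^*) = (csum f)^*.
Proof.
move=> [f1 f2]; rewrite /csum.
have -> : (fun i => complex.Re ((f i)^*)) = (fun i => complex.Re (f i)).
  by apply/funext => i; case: (f i).
have -> : (fun i => complex.Im ((f i)^*)) = (fun i => -1 * complex.Im (f i)).
  by apply/funext => i; case: (f i) => ? ? /=; rewrite mulN1r.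
by rewrite rsumZ// mulN1r.
Qed.

Let l2dotC (u v : l2) : l2dot u v = (-1) ^+ false * (l2dot v u)^*.
Proof.
rewrite expr0 mul1r /l2dot -(csum_conj (summM v u)); congr (csum _).
by apply/funext => i; rewrite rmorphM/= conjCK mulrC.
Qed.

Let l2dot_linear (v : l2) : linear_for *%R (l2dot^~ v).
Proof.
move=> a u w; rewrite /l2dot -(csumP a (summM u v) (summM w v)); congr (csum _); apply/funext => i.
by rewrite mulrA -mulrDl.
Qed.

Let l2dot_semilinear (u : l2) : linear_for (Num.conj \; *%R) (l2dot u).
Proof.
move=> a v w; rewrite l2dotC l2dot_linear expr0 mul1r rmorphD rmorphM/=.
by rewrite [l2dot u v]l2dotC [l2dot u w]l2dotC !expr0 !mul1r.
Qed.

Let l2dot_gt0 (u : l2) : u != 0 -> 0 < l2dot u u.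
Proof.
move=> u0.
have su := sqsum_l2 u.
have -> : l2dot u u = (fine (\esum_(i in [set: I]) (Normc.normc (u i) ^+ 2)%:E))%:C%C.
  rewrite /l2dot /csum -ge0_rsumE// => [|i]; last exact: sqr_ge0.
  congr (_ +i* _)%C.
    by congr (rsum _); apply/funext => i; rewrite normc_sq; case: (u i) => a b /=; ring.
  rewrite -[RHS](mul0r (rsum (fun i => Normc.normc (u i) ^+ 2))) -rsumZ//.
  by congr (rsum _); apply/funext => i; case: (u i) => a b /=; ring.
rewrite ltcR fine_gt0//; apply/andP; split; last exact: (l2valP u).
have [i ui] : exists i, u i != 0.
  apply/not_existsP => H; move/eqP: u0; apply; apply/val_inj/funext => i /=.
  by have /negP := H i; rewrite negbK => /eqP.
apply: (@lt_le_trans _ _ (Normc.normc (u i) ^+ 2)%:E).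
  rewrite lte_fin lt_def sqr_ge0 andbT sqrf_eq0.
  by apply: contra ui => /eqP/Normc.eq0_normc ->.
rewrite -(@esum_set1 R I i (fun i => (Normc.normc (u i) ^+ 2)%:E)); last by rewrite lee_fin sqr_ge0.
rewrite -[leLHS]adde0 [leRHS](esumID [set i])//.
  by rewrite setTI leeD2l// esum_ge0// => j _; rewrite lee_fin sqr_ge0.
by move=> j _; rewrite lee_fin sqr_ge0.
Qed.

HB.instance Definition _ := bilinear_isBilinear.Build R[i] l2 l2 R[i] *%R
  (Num.conj \; *%R) l2dot
  (fun v => l2dot_linear v, fun u => l2dot_semilinear u).
HB.instance Definition _ := isHermitianSesquilinear.Build R[i] l2 false Num.conj
  l2dot l2dotC.
HB.instance Definition _ := isDotProduct.Build R[i] l2 l2dot l2dot_gt0.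

Let l2norm (u : l2) : R[i] := sqrtC (l2dot u u).

Let l2norm_triangle u v : l2norm (u + v) <= l2norm u + l2norm v.
Proof. exact: (dot_norm_triangle l2dot). Qed.

Let l2normZ a u : l2norm (a *: u) = `|a| * l2norm u.
Proof.
rewrite /l2norm (dnormZ l2dot) sqrtCM ?nnegrE ?exprn_ge0 ?(dnorm_ge0 l2dot)//.
by rewrite sqrCK.
Qed.

Let l2norm_eq0 u : l2norm u = 0 -> u = 0.
Proof. by move/eqP; rewrite sqrtC_eq0 (dnorm_eq0 l2dot) => /eqP. Qed.

HB.instance Definition _ :=
  Lmodule_isNormed.Build R[i] l2 l2norm_triangle l2normZ l2norm_eq0.

Let l2_inner (u : l2) : `|u| ^+ 2 = l2dot u u.
Proof. exact: sqrtCK. Qed.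

HB.instance Definition _ :=
  NormedModule_isInnerProduct.Build R l2 l2_inner.

End l2.

Section dual.
Variables (R : realType) (G : topologicalZmodType).

(* [R[i]^o] is [R[i]] with the topology given by its modulus. *)
Definition is_character (chi : G -> R[i]^o) : Prop :=
  [/\ forall x y, chi (x + y) = chi x * chi y,
      forall x, `|chi x| = 1
    & continuous chi].

Record dual := Dual {
  dualfun :> G -> R[i]^o ;
  dualfunP : `[< is_character dualfun >] }.

HB.instance Definition _ := [isSub for dualfun].
HB.instance Definition _ := [Choice of dual by <:].

Let charP (chi : dual) : is_character chi. Proof. exact/asboolP/dualfunP. Qed.

Let charD (chi : dual) x y : chi (x + y) = chi x * chi y.
Proof. by have [-> _ _] := charP chi. Qed.

Let norm_char (chi : dual) x : `|chi x| = 1.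
Proof. by have [_ -> _] := charP chi. Qed.

Let char_cont (chi : dual) : continuous chi.
Proof. by have [_ _] := charP chi. Qed.

Let dist_mulconj (a b c d : R[i]) : `|a| = 1 -> `|d| = 1 ->
  `|a * b^* - c * d^*| <= `|b - d| + `|a - c|.
Proof.
move=> a1 d1.
rewrite (_ : _ - _ = a * (b - d)^* + (a - c) * d^*); last first.
  by rewrite rmorphB/=; ring.
apply: (le_trans (ler_normD _ _)).
by rewrite !normrM !norm_conjC a1 d1 mul1r mulr1.
Qed.

Let mulconj_cvg T (F : set_system T) (FF : Filter F) (f g : T -> R[i]^o) a b :
  `|a| = 1 -> (forall t, `|g t| = 1) ->
  f @ F --> a -> g @ F --> b -> (fun t => f t * (g t)^* : R[i]^o) @ F --> (a * b^* : R[i]^o).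
Proof.
move=> a1 g1 fa gb; apply/cvgrPdist_lt => e e0.
near=> t.
apply: (le_lt_trans (dist_mulconj _ _ a1 (g1 t))).
rewrite (splitr e) ltrD//; near: t.
  by apply: (cvgrPdist_lt _ _).1 gb _ _; rewrite divr_gt0.
by apply: (cvgrPdist_lt _ _).1 fa _ _; rewrite divr_gt0.
Unshelve. all: by end_near. Qed.

Let is_character_one : `[< is_character (fun=> 1) >].
Proof.
apply/asboolP; split=> [x y|x|]; first by rewrite mulr1.
  by rewrite normr1.
by move=> x; exact: cvg_cst.
Qed.

Let is_character_inv (chi : dual) : `[< is_character (fun x => (chi x)^*) >].
Proof.
apply/asboolP; split=> [x y|x|x].
- by rewrite charD rmorphM.
- by rewrite norm_conjC norm_char.
- have -> : (fun x => (chi x)^* : R[i]^o) = (fun x => 1 * (chi x)^* : R[i]^o).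
    by apply/funext => y; rewrite mul1r.
  apply: mulconj_cvg; [exact: normr1|exact: norm_char| |exact: char_cont].
  exact: cvg_cst.
Qed.

(* a character is unimodular, so that conjugation is the pointwise inverse *)
Definition dual_inv (chi : dual) : dual := Dual (is_character_inv chi).

Let is_character_mul (chi psi : dual) :
  `[< is_character (fun x => chi x * psi x) >].
Proof.
apply/asboolP; split=> [x y|x|x].
- by rewrite !charD mulrACA.
- by rewrite normrM !norm_char mulr1.
- have -> : (fun x => chi x * psi x : R[i]^o) =
      (fun x => chi x * (dual_inv psi x)^* : R[i]^o).
    by apply/funext => y; rewrite /= conjCK.
  by apply: mulconj_cvg;
    [exact: norm_char|exact: norm_char|exact: char_cont|exact: char_cont].
Qed.

Definition dual_one : dual := Dual is_character_one.

Definition dual_mul (chi psi : dual) : dual := Dual (is_character_mul chi psi).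

Let dual_mulA : associative dual_mul.
Proof. by move=> a b c; apply/val_inj/funext => x /=; rewrite mulrA. Qed.

Let dual_mulC : commutative dual_mul.
Proof. by move=> a b; apply/val_inj/funext => x /=; rewrite mulrC. Qed.

Let dual_mul1 : left_id dual_one dual_mul.
Proof. by move=> a; apply/val_inj/funext => x /=; rewrite mul1r. Qed.

Let dual_mulV : left_inverse dual_one dual_inv dual_mul.
Proof.
move=> a; apply/val_inj/funext => x /=.
by rewrite mulrC -normCK norm_char expr1n.
Qed.

(* The pointwise product of characters is written additively, as is [G]. *)
HB.instance Definition _ := GRing.isZmodule.Build dual
  dual_mulA dual_mulC dual_mul1 dual_mulV.

HB.instance Definition _ := Topological.copy dual
  (initial_topology (dualfun : dual -> {compact-open, G -> R[i]^o})).

Let dual_nbhs (chi : dual) (K : set G) (e : R[i]) : compact K -> 0 < e ->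
  nbhs chi [set psi : dual | forall x, K x -> `|chi x - psi x| < e].
Proof.
move=> cK e0.
have h : (dualfun : dual -> {compact-open, G -> R[i]^o}) @ nbhs chi -->
    (dualfun chi : {compact-open, G -> R[i]^o}).
  exact: (@initial_continuous dual {compact-open, G -> R[i]^o} dualfun).
have hF : Filter (fmap (dualfun : dual -> G -> R[i]^o) (nbhs chi)).
  exact: (@fmap_filter dual (G -> R[i]^o) dualfun (nbhs chi) (nbhs_filter chi)).
have {}h := (compact_open_fam_compactP (@char_cont chi) hF).1 h.
have := @fam_nbhs G R[i]^o compact K [set p | ball p.1 e p.2] (dualfun chi)
  (entourage_ball _ (PosNum e0)) cK.
by move=> /h; rewrite -ball_normE.
Qed.

Let dual_sub_continuous : continuous (fun p : dual * dual => p.1 - p.2).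
Proof.
apply: (@continuous_comp_initial _ _ {compact-open, G -> R[i]^o} dualfun).
move=> [chi psi].
pose F := fmap (dualfun \o (fun p : dual * dual => p.1 - p.2)) (nbhs (chi, psi)).
have FF : Filter F by exact: (@fmap_filter (dual * dual)%type (G -> R[i]^o) (dualfun \o (fun p : dual * dual => p.1 - p.2)) (nbhs (chi, psi)) (@nbhs_filter (dual * dual)%type (chi, psi))).
apply: (compact_open_fam_compactP (@char_cont (chi - psi)) FF).2.
apply/fam_cvgP => K cK A /uniform_nbhs[E [entE EA]].
move: entE; rewrite -entourage_ballE => -[_/posnumP[e] eE].
suff : \forall p \near (chi, psi), A (dualfun (p.1 - p.2)) by [].
near=> p; apply: EA => /= x Kx; apply: eE; rewrite /= -ball_normE /=.
suff : `|chi x * (psi x)^* - p.1 x * (p.2 x)^*| < e%:num by [].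
apply: (le_lt_trans (dist_mulconj _ _ (norm_char _ _) (norm_char _ _))).
rewrite (splitr e%:num) ltrD//; move: x Kx; near: p.
  by exists (setT, [set q : dual | forall x, K x -> `|psi x - q x| < e%:num / 2]);
    [split; [exact: filterT|exact: dual_nbhs]|case=> ? ? []].
by exists ([set q : dual | forall x, K x -> `|chi x - q x| < e%:num / 2], setT);
  [split; [exact: dual_nbhs|exact: filterT]|case=> ? ? []].
Unshelve. all: by end_near. Qed.

HB.instance Definition _ :=
  PreTopologicalNmodule_isTopologicalZmodule.Build dual dual_sub_continuous.

End dual.

Definition borel (X : topologicalZmodType) : Type :=
  @g_sigma_algebraType (GRing.Zmodule.sort X) (@open X).

Section complex_integration.
Context {R : realType} {d : measure_display} {T : measurableType d}.

Definition cmeasurable (f : T -> R[i]) : Prop :=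
  measurable_fun [set: T] (fun x => complex.Re (f x)) /\
  measurable_fun [set: T] (fun x => complex.Im (f x)).

Variable mu : {measure set T -> \bar R}.

Definition cintegrable (f : T -> R[i]) : Prop :=
  mu.-integrable [set: T] (EFin \o (fun x => complex.Re (f x))) /\
  mu.-integrable [set: T] (EFin \o (fun x => complex.Im (f x))).

Definition cintegral (f : T -> R[i]) : R[i] :=
  ((\int[mu]_x complex.Re (f x)) +i* (\int[mu]_x complex.Im (f x)))%C.

End complex_integration.

(* Hausdorff, second countable, locally compact abelian group *)
Definition lca_group (G : topologicalZmodType) : Prop :=
  [/\ hausdorff_space G, locally_compact [set: G] & @second_countable G].

(* A nonzero translation invariant Radon measure *)
Definition haar_measure (R : realType) (X : topologicalZmodType)
    (mu : {measure set (borel X) -> \bar R}) : Prop :=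
  [/\ forall K : set X, compact K -> (mu K < +oo)%E,
      forall A : set (borel X), measurable A ->
        mu A = ereal_inf [set mu U | U in [set U : set X | open U /\ A `<=` U]],
      forall U : set X, open U ->
        mu U = ereal_sup [set mu K | K in [set K : set X | compact K /\ K `<=` U]],
      forall (x : X) (A : set (borel X)), measurable A ->
        mu [set x + y | y in A] = mu A
    & mu setT != 0%E].

Section dual_measure.
Variables (R : realType) (G : topologicalZmodType).
Variables (mu : {measure set (borel G) -> \bar R}).
Variables (nu : {measure set (borel (dual R G)) -> \bar R}).

Definition fourier (f : G -> R[i]) (alpha : dual R G) : R[i] :=
  cintegral mu (fun x : G => f x * (alpha x)^*).

(* The Haar measure of the dual group for which the Fourier inversion formula
   holds *)
Definition dual_haar_measure : Prop :=
  haar_measure nu /\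
  forall f : G -> R[i], cintegrable mu f -> cintegrable nu (fourier f) ->
    {ae mu, forall x : G,
      f x = cintegral nu (fun alpha : dual R G => fourier f alpha * alpha x)}.

End dual_measure.

Section subspaces.
Context {R : realType}.

Definition separable (T : topologicalType) : Prop :=
  exists2 D : set T, countable D & dense D.

Definition linspan (V : lmodType R[i]) (A : set V) : set V :=
  [set u | exists n (a : 'I_n -> R[i]) (v : 'I_n -> V),
     (forall k, A (v k)) /\ u = \sum_(k < n) a k *: v k].

Definition closed_span (V : normedModType R[i]) (A : set V) : set V :=
  closure (linspan A).

Definition closed_subspace (V : normedModType R[i]) (M : set V) : Prop :=
  [/\ closed M, M 0 & forall a u v, M u -> M v -> M (a *: u + v)].

(* Orthogonal projection onto M; it exists and is unique when M is a closed
   subspace of a complete space. *)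
Definition orth_proj (V : innerProductType R) (M : set V) (u : V) : V :=
  get [set p | M p /\ forall m, M m -> '[u - p, m] = 0].

End subspaces.

Section l2_basis.
Variables (R : realType) (I : choiceType).

Let delta_summable (i : I) :
  (fun j => (j == i)%:R) \in @square_summable R I.
Proof.
rewrite [_ \in _]/(_ < _)%E (esumID [set i]); last first.
  by move=> j _; rewrite lee_fin sqr_ge0.
rewrite setTI esum_set1 ?lee_fin ?sqr_ge0// esum1 ?adde0; first exact: ltry.
move=> j [_ /= /eqP/negbTE ->].
by rewrite [X in X ^+ 2]Normc.normc0 expr0n.
Qed.

Definition l2delta (i : I) : l2 R I := L2 (delta_summable i).

End l2_basis.

Section representations.
Variables (R : realType) (G : topologicalZmodType) (H : hilbertType R).
Variable rep : G -> {linear H -> H}.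

Definition is_unitary_map (U : {linear H -> H}) : Prop :=
  bijective U /\ forall u v, '[U u, U v] = '[u, v].

Definition unitary_rep : Prop :=
  [/\ forall x, is_unitary_map (rep x),
      forall x y u, rep (x + y) u = rep x (rep y u)
    & forall u, continuous (fun x => rep x u)].

Definition orbit_span (A : set H) : set H :=
  closed_span [set v | exists x, exists2 u, A u & v = rep x u].

Definition cyclic_span (psi : H) : set H := orbit_span [set psi].

Definition invariant_subspace (M : set H) : Prop :=
  closed_subspace M /\ forall x u, M u -> M (rep x u).

Definition orthogonal_generators (I : Type) (theta : I -> H) : Prop :=
  (forall i j, i <> j -> forall u v,
     cyclic_span (theta i) u -> cyclic_span (theta j) v -> '[u, v] = 0) /\
  closed_span (\bigcup_i cyclic_span (theta i)) = [set: H].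

(* [br u v] is any function representing the class of the bracket in L^1 *)
Definition is_bracket (nu : {measure set (borel (dual R G)) -> \bar R})
    (br : H -> H -> dual R G -> R[i]) : Prop :=
  forall u v, cintegrable nu (br u v) /\
    forall x, '[u, rep x v] =
      cintegral nu (fun alpha : dual R G => br u v alpha * (alpha x)^*).

End representations.

Section range_functions.
Variables (R : realType) (G : topologicalZmodType) (I : choiceType).
Implicit Types J K : dual R G -> set (l2 R I).

Definition range_function J : Prop := forall alpha, closed_subspace (J alpha).

Definition measurable_range J : Prop :=
  forall u v : l2 R I,
    cmeasurable (fun alpha : borel (dual R G) => '[orth_proj (J alpha) u, v]).

End range_functions.

Section fiberization.
Variables (R : realType) (G : topologicalZmodType) (H : hilbertType R).
Variables (nu : {measure set (borel (dual R G)) -> \bar R}).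
Variables (br : H -> H -> dual R G -> R[i]) (I : choiceType) (theta : I -> H).

Definition Omega (i : I) : set (dual R G) :=
  [set alpha | br (theta i) (theta i) alpha != 0].

(* The coordinates of (T phi)(alpha); they are square summable for almost every
   alpha only, so that membership of (T phi)(alpha) in a subset of l^2(I) is
   expressed through the coercion [l2val]. *)
Definition fiber (phi : H) (alpha : dual R G) : I -> R[i]^o :=
  fun i => \1_(Omega i) alpha *
    (br phi (theta i) alpha / sqrtC (br (theta i) (theta i) alpha)).

Definition J0 (alpha : dual R G) : set (l2 R I) :=
  closed_span [set \1_(Omega i) alpha *: l2delta R i | i in [set: I]].

Definition V_ (J : dual R G -> set (l2 R I)) : set H :=
  [set phi | {ae nu, forall alpha, exists2 w, J alpha w & l2val w = fiber phi alpha}].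

Definition fiber_span (A : set H) (alpha : dual R G) : set (l2 R I) :=
  closed_span [set w | exists2 phi, A phi & l2val w = fiber phi alpha].

Definition admissible (J : dual R G -> set (l2 R I)) : Prop :=
  [/\ range_function J, measurable_range J
    & {ae nu, forall alpha, J alpha `<=` J0 alpha}].

End fiberization.

(* Main.v *)
Require Import Defs.
From HB Require Import structures.
From mathcomp Require Import all_boot all_order all_algebra.
From mathcomp Require Import all_classical all_reals all_analysis.
From mathcomp Require Import measurable_realfun complex.
From mathcomp Require Import ring lra.

Set Implicit Arguments.
Unset Strict Implicit.
Unset Printing Implicit Defensive.

Import Order.TTheory GRing.Theory Num.Theory.
Import numFieldNormedType.Exports.

Local Open Scope classical_set_scope.
Local Open Scope ring_scope.

(** The transform T is an isometry of H into L^2 of the dual group that turns the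
    representation into multiplication by characters; an invariant subspace of H
    is then a space closed under multiplication by all bounded measurable
    functions, and such spaces are given by their fibers.

    Everything rests on uniqueness of the Fourier transform on the dual group
    ([fourier_uniqueness]): an integrable h with \int h(alpha) conj(alpha(x)) = 0
    for all x vanishes almost everywhere. Such an h annihilates the algebra of
    trigonometric polynomials, hence by dominated convergence all its bounded
    pointwise limits. Iterating a polynomial shows that these limits include the
    indicators of sublevel sets ([bc_sublevel]), and second countability of the
    group makes every Borel set of the dual generated by countably many
    conditions on values at points ([bounded_closure_borel]).

    Uniqueness makes the bracket sesquilinear and hermitian almost everywhere,
    and makes it transform by characters under the representation. Positive
    definiteness makes [u, u] nonnegative. On the span of the translates of the
    generators a direct computation gives <T u (alpha), T v (alpha)> =
    [u, v](alpha); Bessel's inequality extends to H by density, and the parallelogram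
    law applied to the defect [u, u](alpha) - |T u (alpha)|^2 gives equality
    ([fib_inner]).

    Four consequences make up the theorem. V_J is a closed invariant subspace,
    because T is a pointwise isometry and J(alpha) is closed
    ([fibers_in_subspace], [fibers_in_rep]). If J is the fiberwise span of a
    countable set A0, a vector q of V_J orthogonal to all translates of A0 has
    [q, u] = 0 for u in A0, so T q (alpha) lies in J(alpha) and is orthogonal to
    it: V_J is the invariant subspace generated by A0 ([fibers_in_span]). A
    separable invariant subspace is generated by a countable set, and the
    projections on its fiberwise span are measurable because distances to the
    span are infima over rational combinations ([measurable_span_projection]).
    Finally V_J determines J: a square-integrable field supported where the
    generators do not vanish is a field T psi, with psi obtained from the Riesz
    representation ([fib_surjective]); this applies to the projections on
    J(alpha) of suitably weighted basis vectors, which are total in J(alpha)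
    ([fibers_in_mono]). *)

(** * Complex numbers and real squared norms *)

Section complex_numbers.
Variable R : realType.
Implicit Types (z w : R[i]) (r : R).

(** The squared modulus as an element of R rather than of R[i]: all estimates
    below are between real squared norms. *)
Definition csq z : R := complex.Re z ^+ 2 + complex.Im z ^+ 2.

Lemma complex_ext z w :
  complex.Re z = complex.Re w -> complex.Im z = complex.Im w -> z = w.
Proof. by case: z w => a b [c d] /= -> ->. Qed.

Lemma ReD z w : complex.Re (z + w) = complex.Re z + complex.Re w.
Proof. by case: z w => ? ? []. Qed.
Lemma ImD z w : complex.Im (z + w) = complex.Im z + complex.Im w.
Proof. by case: z w => ? ? []. Qed.
Lemma ReN z : complex.Re (- z) = - complex.Re z.
Proof. by case: z. Qed.
Lemma ImN z : complex.Im (- z) = - complex.Im z.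
Proof. by case: z. Qed.
Lemma ReM z w : complex.Re (z * w) =
  complex.Re z * complex.Re w - complex.Im z * complex.Im w.
Proof. by case: z w => ? ? []. Qed.
Lemma ImM z w : complex.Im (z * w) =
  complex.Re z * complex.Im w + complex.Im z * complex.Re w.
Proof. by case: z w => ? ? []. Qed.
Lemma Re_conj z : complex.Re z^* = complex.Re z.
Proof. by case: z. Qed.
Lemma Im_conj z : complex.Im z^* = - complex.Im z.
Proof. by case: z. Qed.

Lemma conj_real r : (r%:C%C : R[i])^* = r%:C%C.
Proof. by apply: complex_ext; rewrite ?Re_conj ?Im_conj //= oppr0. Qed.

Definition cE := (ReD, ImD, ReN, ImN, ReM, ImM, Re_conj, Im_conj).

Lemma conjM z w : (z * w)^* = z^* * w^*.
Proof. by apply: complex_ext; rewrite !cE; ring. Qed.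

Lemma conjD z w : (z + w)^* = z^* + w^*.
Proof. by apply: complex_ext; rewrite !cE; ring. Qed.

Lemma csq_ge0 z : 0 <= csq z.
Proof. by rewrite addr_ge0 ?sqr_ge0. Qed.

Lemma csq_eq0 z : csq z = 0 -> z = 0.
Proof.
case: z => a b; rewrite /csq /= => /eqP.
by rewrite paddr_eq0 ?sqr_ge0// !sqrf_eq0 => /andP[/eqP-> /eqP->].
Qed.

Lemma csqM z w : csq (z * w) = csq z * csq w.
Proof. by rewrite /csq !cE; ring. Qed.

Lemma csqE z : (csq z)%:C%C = z * z^*.
Proof. by apply: complex_ext; rewrite !cE /csq /=; ring. Qed.

Lemma csq_norm z : (csq z)%:C%C = `|z| ^+ 2.
Proof. by rewrite -add_Re2_Im2. Qed.

Lemma csq_real r : csq r%:C%C = r ^+ 2.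
Proof. by rewrite /csq /= expr0n /= addr0. Qed.

Lemma csq_normc z : Normc.normc z ^+ 2 = csq z.
Proof. by case: z => a b /=; rewrite sqr_sqrtr// addr_ge0 ?sqr_ge0. Qed.

Lemma csqD_le z w : csq (z + w) <= 2 * csq z + 2 * csq w.
Proof.
rewrite /csq !cE -subr_ge0.
set e := (X in 0 <= X).
have -> : e = (complex.Re z - complex.Re w) ^+ 2 +
  (complex.Im z - complex.Im w) ^+ 2 by rewrite /e; ring.
by rewrite addr_ge0 ?sqr_ge0.
Qed.

Lemma ge0_complex z : 0 <= z -> z = (complex.Re z)%:C%C /\ 0 <= complex.Re z.
Proof. by case: z => a b; rewrite lecE /= => /andP[/eqP-> ->]. Qed.

End complex_numbers.

Section inner_products.
Variables (R : realType) (V : innerProductType R).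
Implicit Types (u v w : V) (a : R[i]) (M : set V).

Definition nsq u : R := complex.Re '[u, u].

Lemma innerDl u v w : '[u + v, w] = '[u, w] + '[v, w].
Proof. by rewrite linearDl. Qed.
Lemma innerDr u v w : '[u, v + w] = '[u, v] + '[u, w].
Proof. by rewrite linearD. Qed.
Lemma innerZl a u v : '[a *: u, v] = a * '[u, v].
Proof. by rewrite linearZl_LR. Qed.
Lemma innerZr a u v : '[u, a *: v] = a^* * '[u, v].
Proof. by rewrite linearZr_LR. Qed.
Lemma innerC u v : '[u, v] = '[v, u]^*.
Proof. by rewrite hermC expr0 mul1r. Qed.
Lemma innerNl u v : '[- u, v] = - '[u, v].
Proof. by rewrite -scaleN1r innerZl mulN1r. Qed.
Lemma innerNr u v : '[u, - v] = - '[u, v].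
Proof. by rewrite innerC innerNl rmorphN/= -innerC. Qed.
Lemma inner0l u : '[0, u] = 0.
Proof. by rewrite -(scale0r 0) innerZl mul0r. Qed.
Lemma inner0r u : '[u, 0] = 0.
Proof. by rewrite innerC inner0l conjC0. Qed.

Lemma innerE u : '[u, u] = (nsq u)%:C%C.
Proof. by apply: (ge0_complex _).1; rewrite -sqr_norm_inner exprn_ge0. Qed.

Lemma norm_nsq u : `|u| ^+ 2 = (nsq u)%:C%C.
Proof. by rewrite sqr_norm_inner innerE. Qed.

Lemma nsq_ge0 u : 0 <= nsq u.
Proof. by apply: (ge0_complex _).2; rewrite -sqr_norm_inner exprn_ge0. Qed.

Lemma nsq0 : nsq 0 = 0.
Proof. by rewrite /nsq inner0l. Qed.

Lemma nsq_eq0 u : nsq u = 0 -> u = 0.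
Proof.
move=> u0; apply/eqP; rewrite -normr_eq0 -sqrf_eq0 norm_nsq u0.
by [].
Qed.

Lemma nsqD u v : nsq (u + v) = nsq u + nsq v + 2 * complex.Re '[u, v].
Proof.
rewrite /nsq innerDl !innerDr !cE (innerC v u) Re_conj; ring.
Qed.

Lemma nsqZ a u : nsq (a *: u) = csq a * nsq u.
Proof.
by rewrite /nsq innerZl innerZr mulrA -csqE innerE !cE /= !mul0r !subr0.
Qed.

Lemma nsqN u : nsq (- u) = nsq u.
Proof. by rewrite /nsq innerNl innerNr opprK. Qed.

Lemma nsqB u v : nsq (u - v) = nsq u + nsq v - 2 * complex.Re '[u, v].
Proof. by rewrite nsqD nsqN innerNr ReN mulrN. Qed.

Lemma nsq_subC u v : nsq (u - v) = nsq (v - u).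
Proof. by rewrite -nsqN opprB. Qed.

Lemma parallelogram u v :
  nsq (u + v) + nsq (u - v) = 2 * nsq u + 2 * nsq v.
Proof. by rewrite nsqD nsqB; ring. Qed.

Lemma nsqD_le u v : nsq (u + v) <= 2 * nsq u + 2 * nsq v.
Proof. by rewrite -parallelogram lerDl nsq_ge0. Qed.

Lemma nsq_lt_norm u (e : R) : 0 < e -> (`|u| < e%:C%C) = (nsq u < e ^+ 2).
Proof.
move=> e0; rewrite -(@ltr_pXn2r _ 2)// ?nnegrE//; last by rewrite ltW// ltcR.
by rewrite norm_nsq -rmorphXn/= ltcR.
Qed.

Lemma pos_complex (e : R[i]) : 0 < e -> exists2 r : R, 0 < r & e = r%:C%C.
Proof.
by case: e => a b; rewrite ltcE /= => /andP[/eqP-> a0]; exists a.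
Qed.

Lemma nbhs_nsqP u (B : set V) : nbhs u B <->
  exists2 e : R, 0 < e & forall v, nsq (u - v) < e -> B v.
Proof.
split.
  move=> /nbhs_ballP[_ /= /pos_complex[r r0 ->] h].
  exists (r ^+ 2); first by rewrite exprn_gt0.
  by move=> v uv; apply: h; rewrite -ball_normE /= nsq_lt_norm.
move=> [e e0 h]; apply/nbhs_ballP; exists (Num.sqrt e)%:C%C => /=.
  by rewrite ltcR sqrtr_gt0.
move=> v; rewrite -ball_normE /= nsq_lt_norm ?sqrtr_gt0//.
by rewrite sqr_sqrtr ?ltW// => /h.
Qed.

Lemma closure_nsqP (A : set V) u : closure A u <->
  forall e : R, 0 < e -> exists2 v, A v & nsq (u - v) < e.
Proof.
split=> [cu e e0|h B /nbhs_nsqP[e e0 eB]].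
  have /cu[v [Av uv]] : nbhs u [set v | nsq (u - v) < e].
    by apply/nbhs_nsqP; exists e.
  by exists v.
by have [v Av /eB Bv] := h e e0; exists v.
Qed.

Lemma closed_nsqP (A : set V) u : closed A ->
  (forall e : R, 0 < e -> exists2 v, A v & nsq (u - v) < e) -> A u.
Proof. by move=> cA h; apply: cA; apply/closure_nsqP. Qed.

Lemma closed_nsq (A : set V) :
  (forall u, (forall e : R, 0 < e -> exists2 v, A v & nsq (u - v) < e) -> A u) ->
  closed A.
Proof. by move=> h u cu; apply: h; apply/closure_nsqP. Qed.

(** Sequential completeness in terms of real squared norms, a form shared by
    Hilbert spaces and l2. *)
Definition nsq_complete : Prop := forall u_ : nat -> V,
  (forall e : R, 0 < e -> exists N, forall m n, (N <= m)%N -> (N <= n)%N ->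
     nsq (u_ m - u_ n) < e) ->
  exists v, forall e : R, 0 < e -> exists N, forall n, (N <= n)%N ->
     nsq (v - u_ n) < e.

(** It suffices that combinations of elements of A are approximable by A: this
    covers linear spans, and also spans with rational coefficients only. *)
Lemma subspace_closure (A : set V) :
  A 0 -> (forall a u v, A u -> A v -> closure A (a *: u + v)) ->
  closed_subspace (closure A).
Proof.
move=> A0 AL; split; first exact: closed_closure.
  exact: subset_closure.
move=> a u v /closure_nsqP cu /closure_nsqP cv.
have -> : closure A = closure (closure A).
  by apply/closure_id; exact: closed_closure.
apply/closure_nsqP => e e0.
have a1 : 0 < 1 + csq a by rewrite (lt_le_trans ltr01)// lerDl csq_ge0.
have [u' Au' uu'] := cu (e / (4 * (1 + csq a))) ltac:(by rewrite divr_gt0// mulr_gt0).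
have [v' Av' vv'] := cv (e / 4) ltac:(by rewrite divr_gt0).
exists (a *: u' + v'); first exact: AL.
have -> : a *: u + v - (a *: u' + v') = a *: (u - u') + (v - v').
  by rewrite scalerBr opprD addrACA.
apply: le_lt_trans (nsqD_le _ _) _; rewrite nsqZ.
have : csq a * nsq (u - u') <= e / 4.
  have := ltW uu'; rewrite invfM mulrA => h.
  apply: (@le_trans _ _ ((1 + csq a) * nsq (u - u'))).
    by rewrite ler_wpM2r ?nsq_ge0// lerDr.
  by rewrite mulrC -ler_pdivlMr.
lra.
Qed.

End inner_products.

(** * Orthogonal projections, the Riesz representation, spans *)

Section projections.
Variables (R : realType) (V : innerProductType R).
Implicit Types (u v w : V) (a : R[i]) (M : set V).

Lemma subspaceZ M a u : closed_subspace M -> M u -> M (a *: u).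
Proof. by move=> [_ M0 ML] Mu; rewrite -[a *: u]addr0; exact: ML. Qed.
Lemma subspaceD M u v : closed_subspace M -> M u -> M v -> M (u + v).
Proof. by move=> [_ M0 ML] Mu Mv; rewrite -[u]scale1r; exact: ML. Qed.
Lemma subspaceB M u v : closed_subspace M -> M u -> M v -> M (u - v).
Proof. by move=> [_ M0 ML] Mu Mv; rewrite -scaleN1r addrC; exact: ML. Qed.

(** Positivity of the squared norm of u + t v. *)
Lemma inner_bound (t : R) u v :
  - (2 * t * complex.Re '[u, v]) <= nsq u + t ^+ 2 * nsq v.
Proof.
have := nsq_ge0 (u + t%:C%C *: v).
by rewrite nsqD nsqZ innerZr csq_real !cE /=; lra.
Qed.

Lemma quadratic_zero (b c : R) : 0 <= c ->
  (forall t : R, - (2 * t * b) <= 2 * t ^+ 2 * c) -> b = 0.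
Proof.
move=> c0 h; have d0 : 0 < 2 * c + 1 by lra.
have := h (- b / (2 * c + 1)).
rewrite -subr_ge0.
have -> : 2 * (- b / (2 * c + 1)) ^+ 2 * c - - (2 * (- b / (2 * c + 1)) * b) =
  - (2 * (b / (2 * c + 1)) ^+ 2 * (c + 1)) by field; rewrite gt_eqF.
set x := b / _ => hx.
have : x ^+ 2 * (c + 1) <= 0 by lra.
rewrite pmulr_lle0; last by lra.
move=> x0; have : x ^+ 2 == 0 by rewrite eq_le x0 sqr_ge0.
by rewrite sqrf_eq0 mulf_eq0 invr_eq0 (gt_eqF d0) orbF => /eqP.
Qed.

Lemma inv_small (e : R) : 0 < e -> exists N, forall n, (N <= n)%N ->
  n.+1%:R^-1 < e.
Proof.
move=> e0; have /ltW/archi_boundP : 0 < e^-1 by rewrite invr_gt0.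
set N := Num.bound _ => eN; exists N => n Nn.
rewrite invf_plt ?posrE// (lt_le_trans eN)// ler_nat.
exact: leqW.
Qed.

(** The minimising sequence is Cauchy by the parallelogram law. *)
Lemma projection_exists M u : nsq_complete V -> closed_subspace M ->
  exists p, M p /\ forall m, M m -> '[u - p, m] = 0.
Proof.
move=> cV sM; have [cM M0 ML] := sM.
pose D := [set nsq (u - m) | m in M].
have hD : has_inf D.
  split; first by exists (nsq (u - 0)), 0.
  by exists 0 => _ [m _ <-]; exact: nsq_ge0.
have dle m : M m -> inf D <= nsq (u - m).
  by move=> Mm; apply: ge_inf; [exact: hD.2|exists m].
have /choice[m_ mP] n : exists m, M m /\ nsq (u - m) < inf D + n.+1%:R^-1.
  have [] := @inf_adherent _ D n.+1%:R^-1 _ hD; first by rewrite invr_gt0.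
  by move=> _ [m Mm <-] h; exists m.
have cau i j : nsq (m_ i - m_ j) <= 2 * i.+1%:R^-1 + 2 * j.+1%:R^-1.
  have [[Mi hi] [Mj hj]] := (mP i, mP j).
  have := parallelogram (u - m_ i) (u - m_ j).
  have -> : u - m_ i - (u - m_ j) = m_ j - m_ i.
    by rewrite opprB addrC addrA subrK.
  have -> : u - m_ i + (u - m_ j) = 2%:R *: (u - 2%:R^-1 *: (m_ i + m_ j)).
    rewrite scalerBr scalerA divff ?pnatr_eq0// scale1r scaler_nat mulr2n.
    by rewrite addrACA opprD.
  rewrite nsqZ (nsq_subC (m_ j)).
  have -> : csq (2%:R : R[i]) = 4.
    by rewrite (_ : 2%:R = (2%:R : R)%:C%C) ?csq_real ?rmorph_nat//; ring.
  have := dle (2%:R^-1 *: (m_ i + m_ j)) (subspaceZ _ sM (subspaceD sM Mi Mj)).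
  move: hi hj; move: (i.+1%:R^-1) (j.+1%:R^-1) => x y; lra.
have [p hp] : exists p, forall e : R, 0 < e -> exists N, forall n, (N <= n)%N ->
    nsq (p - m_ n) < e.
  apply: cV => e e0; have [N hN] := inv_small (ltac:(by rewrite divr_gt0) : 0 < e / 4).
  exists N => i j Ni Nj; apply: le_lt_trans (cau i j) _.
  have := hN _ Ni; have := hN _ Nj.
  by move: (i.+1%:R^-1) (j.+1%:R^-1) => x y; lra.
exists p.
have Mp : M p.
  apply: closed_nsqP => // e e0; have [N /(_ N (leqnn _)) hN] := hp e e0.
  by exists (m_ N) => //; exact: (mP N).1.
split=> // m Mm.
have Re0 m' : M m' -> complex.Re '[u - p, m'] = 0.
  (* comparing u - p with u - p - t m' through a term of the minimising sequence
     costs a factor 2, which the quadratic bound absorbs *)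
  move=> Mm'; apply: (@quadratic_zero _ (nsq m') (nsq_ge0 _)) => t.
  apply/ler_addgt0Pr => e e0.
  have [N1 h1] := inv_small (ltac:(by rewrite divr_gt0) : 0 < e / 2).
  have [N2 h2] := hp (e / 2) ltac:(by rewrite divr_gt0).
  pose n := maxn N1 N2.
  have {}h1 := h1 n (leq_maxl _ _); have {}h2 := h2 n (leq_maxr _ _).
  have [Mn hn] := mP n.
  have := dle (m_ n - t%:C%C *: m') (subspaceB sM Mn (subspaceZ _ sM Mm')).
  rewrite opprB addrCA addrC.
  rewrite nsqD nsqZ innerZr csq_real !cE /= oppr0 mul0r subr0.
  have := inner_bound t (m_ n - p) m'.
  have -> : nsq (m_ n - p) = nsq (p - m_ n) by rewrite nsq_subC.
  have -> : u - p = (u - m_ n) + (m_ n - p) by rewrite addrA subrK.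
  rewrite (innerDl (u - m_ n)) (ReD '[u - m_ n, m']).
  move: h1 hn; move: (n.+1%:R^-1) => x; lra.
apply: complex_ext; first exact: Re0.
have := Re0 _ (subspaceZ 'i%C sM Mm).
rewrite innerZr !cE /=; lra.
Qed.

Lemma orth_projP M u : nsq_complete V -> closed_subspace M ->
  M (orth_proj M u) /\ forall m, M m -> '[u - orth_proj M u, m] = 0.
Proof.
move=> cV sM; have [p hp] := projection_exists u cV sM.
exact: (@getPex _ [set p | M p /\ forall m, M m -> '[u - p, m] = 0] (ex_intro _ p hp)).
Qed.

Section facts.
Variables (M : set V) (cV : nsq_complete V) (sM : closed_subspace M).
Local Notation P := (orth_proj M).

Lemma proj_in u : M (P u). Proof. exact: (orth_projP u cV sM).1. Qed.

Lemma proj_orth u m : M m -> '[u - P u, m] = 0.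
Proof. exact: (orth_projP u cV sM).2. Qed.

Lemma proj_inner u m : M m -> '[P u, m] = '[u, m].
Proof.
by move=> Mm; apply/esym/eqP; rewrite -subr_eq0 -innerNl -innerDl proj_orth.
Qed.

Lemma proj_adj u v : '[P u, v] = '[u, P v].
Proof.
rewrite -(proj_inner u (proj_in v)) innerC -(proj_inner v (proj_in u)).
by rewrite -innerC.
Qed.

Lemma proj_id u : M u -> P u = u.
Proof.
move=> Mu; apply/esym/eqP; rewrite -subr_eq0; apply/eqP/nsq_eq0.
by rewrite /nsq proj_orth//; apply: subspaceB => //; exact: proj_in.
Qed.

Lemma proj_linear a u v : P (a *: u + v) = a *: P u + P v.
Proof.
have Ma : M (a *: P u + P v) by have [_ _] := sM; apply; exact: proj_in.
apply/eqP; rewrite -subr_eq0; apply/eqP/nsq_eq0.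
set d := _ - _; have Md : M d by apply: subspaceB => //; exact: proj_in.
rewrite /nsq {1}/d innerDl innerNl innerDl innerZl !proj_inner//.
by rewrite -innerZl -innerDl subrr.
Qed.

Lemma nsq_proj u : nsq u = nsq (P u) + nsq (u - P u).
Proof.
have {1}-> : u = (u - P u) + P u by rewrite subrK.
rewrite nsqD proj_orth; last exact: proj_in.
by rewrite mulr0 addr0 addrC.
Qed.

Lemma nsq_proj_le u : nsq (P u) <= nsq u.
Proof. by rewrite (nsq_proj u) lerDl nsq_ge0. Qed.

Lemma nsq_dist_le u m : M m -> nsq (u - P u) <= nsq (u - m).
Proof.
move=> Mm; have -> : u - m = (u - P u) + (P u - m) by rewrite addrA subrK.
rewrite (nsqD (u - P u))  (proj_orth _ (_ : M _)); last by apply: subspaceB => //; exact: proj_in.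
by rewrite mulr0 addr0 lerDl nsq_ge0.
Qed.

End facts.

(** The vector representing the functional spans the orthogonal complement of
    its kernel; the affine bound only serves to make the kernel closed. *)
Lemma riesz (L : V -> R[i]) (B : R) : nsq_complete V ->
  (forall a u v, L (a *: u + v) = a * L u + L v) ->
  (forall u, `|complex.Re (L u)| <= nsq u + B) ->
  exists w, forall u, L u = '[u, w].
Proof.
move=> cV LL LB.
have L0 : L 0 = 0 by have := LL (-1) 0 0; rewrite scaler0 addr0 mulN1r addNr.
have LZ a u : L (a *: u) = a * L u by rewrite -[a *: u]addr0 LL L0 addr0.
have LBt u (t : R) : 0 < t -> t * `|complex.Re (L u)| <= t ^+ 2 * nsq u + B.
  move=> t0; have := LB (t%:C%C *: u).
  by rewrite LZ nsqZ csq_real !cE /= mul0r subr0 normrM (gtr0_norm t0).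
have sK : closed_subspace [set u | L u = 0].
  split=> //=; last by move=> a u v; rewrite LL => -> ->; rewrite mulr0 addr0.
  apply: closed_nsq => u hu /=.
  have Re0 b : complex.Re (L (b *: u)) = 0.
    apply/eqP; rewrite -normr_le0 leNgt; apply/negP => c0.
    (* scaling by t makes the left side of the bound exceed its right side *)
    pose c := `|complex.Re (L (b *: u))|.
    pose t := (2 + `|B|) / c.
    have t0 : 0 < t by rewrite divr_gt0// ltr_wpDr.
    have b1 : 0 < csq b + 1 by rewrite ltr_wpDl ?csq_ge0.
    have [k Lk uk] := hu (t ^+ 2 * (csq b + 1))^-1
      ltac:(by rewrite invr_gt0 mulr_gt0// exprn_gt0).
    have := LBt (b *: (u - k)) t t0.
    have -> : L (b *: (u - k)) = L (b *: u).
      by rewrite scalerBr -scaleNr addrC LL Lk mulr0 add0r.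
    rewrite -/c nsqZ /t divfK ?gt_eqF// -/t => h.
    have : t ^+ 2 * (csq b * nsq (u - k)) <= 1.
      rewrite mulrA; apply: (@le_trans _ _ (t ^+ 2 * (csq b + 1) * nsq (u - k))).
        by rewrite ler_wpM2r ?nsq_ge0// ler_wpM2l ?sqr_ge0// lerDl.
      have z0 : 0 < t ^+ 2 * (csq b + 1) by rewrite mulr_gt0// exprn_gt0.
      by have := ltW uk; rewrite -(ler_pM2l z0) divff ?gt_eqF.
    have := ler_norm B; lra.
  apply: complex_ext; first by rewrite -[u]scale1r.
  have := Re0 'i%C; rewrite LZ !cE /=; lra.
have [allz|] := pselect (forall u, L u = 0).
  by exists 0 => u; rewrite inner0r.
move=> /existsNP[u0 Lu0].
pose q := u0 - orth_proj [set u | L u = 0] u0.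
have Lq : L q = L u0.
  have := proj_in cV sK u0; rewrite /q addrC -scaleN1r LL /= => ->.
  by rewrite mulr0 add0r.
have q0 : nsq q != 0.
  apply/eqP => /nsq_eq0 q0; apply: Lu0.
  by rewrite -Lq q0 L0.
exists ((L q)^* * ((nsq q)^-1)%:C%C *: q) => u.
have : '[q, u - (L u / L q) *: q] = 0.
  apply: (proj_orth cV sK) => /=.
  rewrite addrC -scaleNr LL mulNr divfK ?addNr// Lq.
  exact/eqP.
rewrite innerDr innerNr innerZr => /eqP; rewrite subr_eq0 => /eqP h.
rewrite innerZr innerC h innerE !(rmorphM Num.conj) /=.
rewrite !conjCK !conj_real.
have LqC : L q != 0 by rewrite Lq; exact/eqP.
rewrite mulrACA -[_ * (nsq q)%:C%C]mulrC.
rewrite -rmorphM/= divff// mulr1 mulrC divfK//.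
Qed.

End projections.

Lemma hilbert_nsq_complete (R : realType) (H : hilbertType R) : nsq_complete H.
Proof.
move=> u cu.
have : cvg (u @ \oo).
  apply: cauchy_cvg; apply: cauchy_exP => _ /pos_complex[r r0 ->].
  have [N hN] := cu (r ^+ 2) (exprn_gt0 _ r0).
  exists (u N); exists N => // n /= Nn.
  by rewrite -ball_normE /= nsq_lt_norm// hN.
move=> /cvg_ex[v uv]; exists v => e e0.
have /uv[N _ hN] : nbhs v [set w | nsq (v - w) < e] by apply/nbhs_nsqP; exists e.
by exists N.
Qed.

Section spans.
Variables (R : realType) (V : innerProductType R).
Implicit Types (A M : set V).

Lemma linspan_sub A : A `<=` linspan A.
Proof.
move=> u Au; exists 1%N, (fun=> 1), (fun=> u); split=> //.
by rewrite big_ord1 scale1r.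
Qed.

Lemma linspan0 A : linspan A 0.
Proof.
exists 0%N, (fun=> 0), (fun=> 0); split=> [[]//|].
by rewrite big_ord0.
Qed.

Lemma linspanL A a u v : linspan A u -> linspan A v -> linspan A (a *: u + v).
Proof.
move=> [n [b [w [Aw ->]]]] [m [c [x [Ax ->]]]].
exists (n + m)%N, (fun k => match fintype.split k with inl i => a * b i | inr j => c j end),
  (fun k => match fintype.split k with inl i => w i | inr j => x j end); split.
  by move=> k; case: fintype.split.
rewrite big_split_ord /= scaler_sumr; congr (_ + _); apply: eq_bigr => k _.
  by rewrite (unsplitK (inl k)) scalerA.
by rewrite (unsplitK (inr k)).
Qed.

Lemma linspan_min A (M : set V) : A `<=` M -> M 0 ->
  (forall a u v, M u -> M v -> M (a *: u + v)) -> linspan A `<=` M.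
Proof.
move=> AM M0 ML _ [n [a [v [Av ->]]]].
elim: n a v Av => [|n IH] a v Av; first by rewrite big_ord0.
by rewrite big_ord_recl; apply: ML; [exact/AM/Av|exact: IH].
Qed.

Lemma closed_span_subspace A : closed_subspace (closed_span A).
Proof.
apply: subspace_closure; first exact: linspan0.
by move=> a u v Au Av; apply: subset_closure; exact: linspanL.
Qed.

Lemma closed_span_sub A : A `<=` closed_span A.
Proof. by move=> u /linspan_sub; exact: subset_closure. Qed.

Lemma closed_span_min A M : closed_subspace M -> A `<=` M -> closed_span A `<=` M.
Proof.
move=> [cM M0 ML] AM u su; apply: cM; apply: closure_subset u su.
exact: linspan_min.
Qed.

Lemma closed_span_mono A B : A `<=` B -> closed_span A `<=` closed_span B.
Proof.
move=> AB; apply: closed_span_min; first exact: closed_span_subspace.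
by move=> u /AB; exact: closed_span_sub.
Qed.

End spans.

(** * Square-summable families *)

Section square_summable.
Variables (R : realType) (I : choiceType).
Implicit Types (u v : l2 R I) (f : I -> R[i]) (c : R).

(** Bounds on finite sums over duplicate-free lists replace suprema over finite
    sets; the lists form a countable type when I does. *)
Lemma esum_leP (g : I -> R) c : (forall i, 0 <= g i) ->
  (\esum_(i in [set: I]) (g i)%:E <= c%:E)%E <->
  forall s, uniq s -> \sum_(i <- s) g i <= c.
Proof.
move=> g0; split=> [h s us|h].
  rewrite -lee_fin; apply: le_trans h; apply: ereal_sup_ubound.
  exists [set` s]; first by split => //; exact: finite_seq.
  rewrite -fsbig_seq//.
  by rewrite sumEFin.
apply: ge_ereal_sup => _ [A [fA _] <-].
by rewrite fsbig_finite//= sumEFin lee_fin; exact: h.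
Qed.

Lemma square_summableP f : f \in @square_summable R I <->
  exists c, forall s, uniq s -> \sum_(i <- s) csq (f i) <= c.
Proof.
have -> : (f \in @square_summable R I) =
  (\esum_(i in [set: I]) (csq (f i))%:E < +oo)%E.
  rewrite [LHS](_ : _ = (\esum_(i in [set: I]) (Normc.normc (f i) ^+ 2)%:E < +oo)%E)//.
  by congr (_ < _)%E; apply: eq_esum => i _; rewrite csq_normc.
split=> [h|[c hc]].
  have h0 : (0 <= \esum_(i in [set: I]) (csq (f i))%:E)%E.
    by apply: esum_ge0 => i _; rewrite lee_fin csq_ge0.
  exists (fine (\esum_(i in [set: I]) (csq (f i))%:E)).
  apply/(esum_leP _ (fun i => csq_ge0 (f i))).
  by rewrite fineK// ge0_fin_numE.
apply: le_lt_trans (ltry c); exact/(esum_leP _ (fun i => csq_ge0 (f i))).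
Qed.

Lemma nsq_l2 u : nsq u = fine (\esum_(i in [set: I]) (csq (u i))%:E).
Proof.
have hs : summable [set: I] (EFin \o (fun i => csq (u i))).
  rewrite /summable (_ : esum _ _ =
    (\esum_(i in [set: I]) (Normc.normc (u i) ^+ 2)%:E)%E); first exact: l2valP.
  by apply: eq_esum => i _ /=; rewrite csq_normc ger0_norm ?csq_ge0.
rewrite -(ge0_rsumE hs) => [|i]; last exact: csq_ge0.
congr (rsum _); apply/funext => i.
by rewrite -csqE.
Qed.

Lemma nsq_leP u c : nsq u <= c <->
  forall s, uniq s -> \sum_(i <- s) csq (u i) <= c.
Proof.
rewrite nsq_l2 -esum_leP; last by move=> i; exact: csq_ge0.
have fu : \esum_(i in [set: I]) (csq (u i))%:E \is a fin_num.
  have h : (\esum_(i in [set: I]) (Normc.normc (u i) ^+ 2)%:E < +oo)%E.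
    exact: l2valP.
  rewrite ge0_fin_numE; last by apply: esum_ge0 => i _; rewrite lee_fin csq_ge0.
  by under eq_esum do rewrite -csq_normc.
by rewrite -{2}(fineK fu) lee_fin.
Qed.

Lemma sum_csq_le u s : uniq s -> \sum_(i <- s) csq (u i) <= nsq u.
Proof. by move=> us; exact: (nsq_leP u _).1. Qed.

Lemma csq_le_nsq u i : csq (u i) <= nsq u.
Proof. by have := @sum_csq_le u [:: i] isT; rewrite big_seq1. Qed.

Lemma l2_ext u v : (forall i, u i = v i) -> u = v.
Proof. by move=> h; apply/val_inj/funext. Qed.

Lemma l2L (a : R[i]) u v i : (a *: u + v) i = a * u i + v i.
Proof. by []. Qed.

Lemma l2B u v i : (u - v) i = u i - v i. Proof. by []. Qed.
Lemma l2Z (a : R[i]) u i : (a *: u) i = a * u i. Proof. by []. Qed.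

Lemma l2deltaE (i j : I) : l2delta R i j = (j == i)%:R. Proof. by []. Qed.

Lemma inner_delta u i : '[u, l2delta R i] = u i.
Proof.
have S (g : I -> R) : (forall j, j != i -> g j = 0) ->
    rsum g = g i.
  move=> gi; rewrite /rsum.
  have E (h : I -> \bar R) : (forall j, (0 <= h j)%E) -> (forall j, j != i -> h j = 0%E) ->
      \esum_(j in [set: I]) h j = h i.
    move=> h0 hi; rewrite (esumID [set i])// setTI esum_set1//.
    rewrite esum1 ?adde0// => j [_ /= /eqP]; exact: hi.
  rewrite E; [|by move=> j; rewrite funeposE le_max lexx orbT|
    by move=> j /gi; rewrite funeposE /= => ->; rewrite maxxx].
  rewrite E; [|by move=> j; rewrite funenegE le_max lexx orbT|
    by move=> j /gi; rewrite funenegE /= => ->; rewrite oppr0 maxxx].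
  rewrite funeposE funenegE /= -!EFin_max /=.
  by have [?|?] := leP 0 (g i); have [?|?] := leP 0 (- g i); lra.
rewrite [LHS](_ : _ = csum (fun j => u j * (l2delta R i j)^*))// /csum !S.
- by rewrite l2deltaE eqxx conjC1 mulr1; case: (u i).
- by move=> j ji; rewrite l2deltaE (negbTE ji) conjC0 mulr0.
- by move=> j ji; rewrite l2deltaE (negbTE ji) conjC0 mulr0.
Qed.

End square_summable.

Section l2_complete.
Variables (R : realType) (I : choiceType).
Implicit Types (u v : l2 R I).

Lemma real_cauchy (a : nat -> R) :
  (forall e : R, 0 < e -> exists N, forall m n, (N <= m)%N -> (N <= n)%N ->
     (a m - a n) ^+ 2 < e) ->
  exists l, forall e : R, 0 < e -> exists N, forall n, (N <= n)%N ->
     (l - a n) ^+ 2 < e.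
Proof.
have sq (x e : R) : 0 < e -> (x ^+ 2 < e ^+ 2) = (`|x| < e).
  by move=> e0; rewrite -(real_normK (num_real x)) ltr_pXn2r// nnegrE// ltW.
move=> ca.
have : cvg (a @ \oo).
  apply: cauchy_cvg; apply: cauchy_exP => r r0.
  have [N hN] := ca (r ^+ 2) (exprn_gt0 _ r0).
  exists (a N); exists N => // n /= Nn.
  by rewrite -ball_normE /= -sq// hN.
move=> /cvg_ex[l al]; exists l => e e0.
have [N _ hN] := (cvgrPdist_lt _ _).1 al (Num.sqrt e) ltac:(by rewrite sqrtr_gt0).
exists N => n /hN /=; rewrite -sq ?sqrtr_gt0//.
by rewrite sqr_sqrtr// ltW.
Qed.

Lemma complex_cauchy (a : nat -> R[i]) :
  (forall e : R, 0 < e -> exists N, forall m n, (N <= m)%N -> (N <= n)%N ->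
     csq (a m - a n) < e) ->
  exists l, forall e : R, 0 < e -> exists N, forall n, (N <= n)%N ->
     csq (l - a n) < e.
Proof.
move=> ca.
have [e e0|l1 h1] := @real_cauchy (fun n => complex.Re (a n)).
  have [N hN] := ca e e0; exists N => m n Nm Nn.
  by apply: le_lt_trans (hN m n Nm Nn); rewrite /csq !cE lerDl sqr_ge0.
have [e e0|l2 h2] := @real_cauchy (fun n => complex.Im (a n)).
  have [N hN] := ca e e0; exists N => m n Nm Nn.
  by apply: le_lt_trans (hN m n Nm Nn); rewrite /csq !cE lerDr sqr_ge0.
exists (l1 +i* l2)%C => e e0.
have [N1 hN1] := h1 (e / 2) ltac:(by rewrite divr_gt0).
have [N2 hN2] := h2 (e / 2) ltac:(by rewrite divr_gt0).
exists (maxn N1 N2) => n; rewrite geq_max => /andP[/hN1 ? /hN2 ?].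
by rewrite /csq !cE /= (splitr e) ltrD.
Qed.

(** The limit is taken coordinatewise; the Cauchy bound survives on every finite
    list of coordinates, hence for the whole norm. *)
Lemma l2_nsq_complete : nsq_complete (l2 R I).
Proof.
move=> u cu.
have /choice[v hv] (i : I) : exists l, forall e : R, 0 < e ->
    exists N, forall n, (N <= n)%N -> csq (l - u n i) < e.
  apply: complex_cauchy => e e0; have [N hN] := cu e e0.
  exists N => m n Nm Nn; apply: le_lt_trans (hN m n Nm Nn).
  by rewrite -l2B csq_le_nsq.
have hs (s : seq I) (e : R) : 0 < e -> exists N, forall n, (N <= n)%N ->
    \sum_(i <- s) csq (v i - u n i) < e.
  elim: s e => [|i s IH] e e0; first by exists 0%N => n _; rewrite big_nil.
  have [N1 h1] := IH (e / 2) ltac:(by rewrite divr_gt0).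
  have [N2 h2] := hv i (e / 2) ltac:(by rewrite divr_gt0).
  exists (maxn N1 N2) => n; rewrite geq_max => /andP[/h1 ? /h2 ?].
  by rewrite big_cons (splitr e) ltrD.
have sumD (s : seq I) (f g : I -> R[i]) : \sum_(i <- s) csq (f i + g i) <=
    2 * \sum_(i <- s) csq (f i) + 2 * \sum_(i <- s) csq (g i).
  rewrite !mulr_sumr -big_split /=.
  by apply: ler_sum => i _; exact: csqD_le.
have near (e : R) : 0 < e -> exists N, forall n, (N <= n)%N -> forall s, uniq s ->
    \sum_(i <- s) csq (v i - u n i) <= e.
  move=> e0; have [N hN] := cu (e / 4) ltac:(by rewrite divr_gt0).
  exists N => n Nn s us.
  have [M hM] := hs s (e / 4) ltac:(by rewrite divr_gt0).
  (* pass through a far term of the sequence, chosen after the finite list s *)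
  have h1 := hM (maxn M N) (leq_maxl _ _).
  have h2 := hN (maxn M N) n (leq_maxr _ _) Nn.
  have h3 := sum_csq_le (u (maxn M N) - u n) us.
  have := sumD s (fun i => v i - u (maxn M N) i) (fun i => (u (maxn M N) - u n) i).
  rewrite (eq_bigr (fun i => csq (v i - u n i))) => [|i _]; last first.
    by rewrite l2B addrA subrK.
  lra.
have [N0 hN0] := near 1 ltr01.
have vs : v \in @square_summable R I.
  apply/square_summableP; exists (2 + 2 * nsq (u N0)) => s us.
  have := sumD s (fun i => v i - u N0 i) (fun i => u N0 i).
  rewrite (eq_bigr (fun i => csq (v i))) => [|i _]; last by rewrite subrK.
  have := hN0 N0 (leqnn _) s us; have := sum_csq_le (u N0) us; lra.
exists (L2 vs) => e e0.
have [N hN] := near (e / 2) ltac:(by rewrite divr_gt0).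
exists N => n /hN h; apply: (@le_lt_trans _ _ (e / 2)); last by lra.
by apply/nsq_leP => s /h.
Qed.

End l2_complete.

(** * Measurable functions and fields of vectors *)

Section measurability.
Context {R : realType} {d : measure_display} {T : measurableType d}.
Implicit Types (f g : T -> R[i]) (h : T -> R).

Lemma measurable_gtP h : (forall r, measurable [set x | r < h x]) ->
  measurable_fun [set: T] h.
Proof.
move=> mh; apply: (measurability _ (RGenOInfty.measurableE R)).
move=> _ [_ [r ->] <-]; rewrite setTI.
by rewrite (_ : _ @^-1` _ = [set x | r < h x])//; apply/seteqP;
  split=> x /=; rewrite in_itv /= andbT.
Qed.

Lemma measurable_leP h : (forall r, measurable [set x | h x <= r]) ->
  measurable_fun [set: T] h.
Proof.
move=> mh; apply: measurable_gtP => r.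
rewrite (_ : [set x | r < h x] = ~` [set x | h x <= r]); first exact: measurableC.
by apply/seteqP; split=> x /=; rewrite ltNge => /negP.
Qed.

Lemma measurable_le_set h h' : measurable_fun [set: T] h ->
  measurable_fun [set: T] h' -> measurable [set x | h x <= h' x].
Proof.
move=> mh mh'; have := measurable_fun_le measurableT mh mh'.
by rewrite setTI.
Qed.

Lemma measurable_lt_set h h' : measurable_fun [set: T] h ->
  measurable_fun [set: T] h' -> measurable [set x | h x < h' x].
Proof.
move=> mh mh'; rewrite (_ : [set x | _] = ~` [set x | h' x <= h x]).
  by apply: measurableC; exact: measurable_le_set.
by apply/seteqP; split=> x /=; rewrite ltNge => /negP.
Qed.

Lemma cmeasurable_cst (c : R[i]) : cmeasurable (fun _ : T => c).
Proof. by split; exact: measurable_cst. Qed.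

Lemma cmeasurableD f g : cmeasurable f -> cmeasurable g ->
  cmeasurable (fun x => f x + g x).
Proof.
move=> [f1 f2] [g1 g2]; split.
  by under eq_fun do rewrite ReD; exact: measurable_funD.
by under eq_fun do rewrite ImD; exact: measurable_funD.
Qed.

Lemma cmeasurableM f g : cmeasurable f -> cmeasurable g ->
  cmeasurable (fun x => f x * g x).
Proof.
move=> [f1 f2] [g1 g2]; split.
  by under eq_fun do rewrite ReM; apply: measurable_funB; exact: measurable_funM.
by under eq_fun do rewrite ImM; apply: measurable_funD; exact: measurable_funM.
Qed.

Lemma cmeasurable_conj f : cmeasurable f -> cmeasurable (fun x => (f x)^*).
Proof.
move=> [f1 f2]; split; first by under eq_fun do rewrite Re_conj.
by under eq_fun do rewrite Im_conj; exact: measurableT_comp.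
Qed.

Lemma cmeasurable_real h : measurable_fun [set: T] h ->
  cmeasurable (fun x => (h x)%:C%C).
Proof. by move=> mh; split => //; exact: measurable_cst. Qed.

Lemma measurable_csq f : cmeasurable f -> measurable_fun [set: T] (fun x => csq (f x)).
Proof. by move=> [f1 f2]; apply: measurable_funD; exact: measurable_funX. Qed.

(** For w <= 0 the convention 0^-1 = 0 makes the value 0. *)
Definition rsqrt (w : R) : R := (Num.sqrt w)^-1.

Lemma measurable_rsqrt h : measurable_fun [set: T] h ->
  measurable_fun [set: T] (fun x => rsqrt (h x)).
Proof.
move=> mh; apply: measurable_gtP => r.
have rs0 x : 0 <= rsqrt (h x) by rewrite invr_ge0 sqrtr_ge0.
have [r0|r0] := ltP r 0.
  rewrite (_ : [set x | _] = setT); first exact: measurableT.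
  by apply/seteqP; split => // x _; rewrite /= (lt_le_trans r0).
rewrite (_ : [set x | _] = [set x | 0 < h x] `&` [set x | h x * r ^+ 2 < 1]).
  apply: measurableI; apply: measurable_lt_set => //.
  by apply: measurable_funM => //; exact: measurable_cst.
apply/seteqP; split=> x /=.
  move=> rx; have h0 : 0 < h x.
    rewrite ltNge; apply/negP => hx; move: rx.
    by rewrite /rsqrt ler0_sqrtr// invr0 ltNge r0.
  split=> //; have s0 : 0 < Num.sqrt (h x) by rewrite sqrtr_gt0.
  rewrite -{1}(sqr_sqrtr (ltW h0)) -exprMn expr_lt1 ?mulr_ge0 ?sqrtr_ge0//.
  by rewrite -(divff (lt0r_neq0 s0)) ltr_pM2l.
move=> [h0]; have s0 : 0 < Num.sqrt (h x) by rewrite sqrtr_gt0.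
rewrite -{1}(sqr_sqrtr (ltW h0)) -exprMn expr_lt1 ?mulr_ge0 ?sqrtr_ge0//.
by rewrite -(divff (lt0r_neq0 s0)) ltr_pM2l.
Qed.

End measurability.

Section measurable_fields.
Context {R : realType} {d : measure_display} {T : measurableType d} {I : countType}.
Implicit Types (F G : T -> l2 R I).

Lemma measurable_countable_cap (S : countType) (P : S -> set T) (D : set S) :
  (forall s, D s -> measurable (P s)) ->
  measurable [set x | forall s, D s -> P s x].
Proof.
move=> mP; rewrite (_ : [set x | _] = ~` \bigcup_(s in [set: S])
    (if `[< D s >] then ~` P s else set0)).
  apply: measurableC; apply: countable_bigcupT_measurable => [|s].
    exact: countableP.
  by case: asboolP => // Ds; apply: measurableC; exact: mP.
apply/seteqP; split=> x /=.
  by move=> h [s _]; case: asboolP => // Ds; apply; exact: h.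
move=> h s Ds; apply: contrapT => Px; apply: h; exists s => //.
by rewrite asboolT.
Qed.

Lemma measurable_sum_le (f : T -> I -> R[i]) (c : R) :
  (forall i, cmeasurable (fun x => f x i)) ->
  measurable [set x | forall s, uniq s -> \sum_(i <- s) csq (f x i) <= c].
Proof.
move=> mf; apply: (@measurable_countable_cap (seq I)
  (fun s => [set x | \sum_(i <- s) csq (f x i) <= c]) [set s | uniq s]) => s us.
apply: measurable_le_set; last exact: measurable_cst.
by apply: measurable_sum => i; exact: measurable_csq.
Qed.

Lemma measurable_nsq F : (forall i, cmeasurable (fun x => F x i)) ->
  measurable_fun [set: T] (fun x => nsq (F x)).
Proof.
move=> mF; apply: measurable_leP => r.
rewrite (_ : [set x | _] =
  [set x | forall s, uniq s -> \sum_(i <- s) csq (F x i) <= r]).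
  exact: (measurable_sum_le _ mF).
by apply/seteqP; split=> x /=; rewrite nsq_leP.
Qed.

(** By polarization from measurability of norms. *)
Lemma measurable_inner F G : (forall i, cmeasurable (fun x => F x i)) ->
  (forall i, cmeasurable (fun x => G x i)) ->
  cmeasurable (fun x => '[F x, G x]).
Proof.
move=> mF mG.
have Re_inner (H : T -> l2 R I) : (forall i, cmeasurable (fun x => H x i)) ->
    measurable_fun [set: T] (fun x => complex.Re '[F x, H x]).
  move=> mH; rewrite (_ : (fun x => _) = (fun x => 2^-1 * (nsq (F x + H x) -
      nsq (F x) - nsq (H x)))).
    apply: measurable_funM; first exact: measurable_cst.
    apply: measurable_funB; last exact: measurable_nsq.
    apply: measurable_funB; last exact: measurable_nsq.
    by apply: measurable_nsq => i; exact: (cmeasurableD (mF i) (mH i)).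
  apply/funext => x; rewrite nsqD.
  lra.
split; first exact: Re_inner.
rewrite (_ : (fun x => _) = (fun x => complex.Re '[F x, 'i%C *: G x])).
  apply: Re_inner => i; exact: (cmeasurableM (cmeasurable_cst _) (mG i)).
by apply/funext => x; rewrite innerZr !cE /=; ring.
Qed.

End measurable_fields.

(** * Bounded pointwise limits of an algebra of functions *)

Section bounded_limits.
Context {R : realType} {T : Type}.
Implicit Types (A : set (T -> R)) (f g : T -> R).

(** Bounded pointwise limits are the ones that pass under an integral against
    an integrable function, by dominated convergence. *)
Inductive bounded_closure A : (T -> R) -> Prop :=
| bc_base f : A f -> bounded_closure A f
| bc_lim (f_ : nat -> T -> R) f (M : R) :
    (forall n, bounded_closure A (f_ n)) -> (forall n x, `|f_ n x| <= M) ->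
    (forall x, f_ n x @[n --> \oo] --> f x) -> bounded_closure A f.

Definition bounded_algebra A : Prop :=
  [/\ forall c : R, A (fun=> c),
      forall f g, A f -> A g -> A (fun x => f x + g x),
      forall f g, A f -> A g -> A (fun x => f x * g x)
    & forall f, A f -> exists M, forall x, `|f x| <= M].

Lemma lim_bounded (a : nat -> R) (l M : R) : (forall n, `|a n| <= M) ->
  a n @[n --> \oo] --> l -> `|l| <= M.
Proof.
move=> aM al; have al' : `|a n| @[n --> \oo] --> `|l| by exact: cvg_norm.
rewrite -(cvg_lim (@Rhausdorff R) al'); apply: limr_le; first exact: cvgP al'.
by near=> n.
Unshelve. all: by end_near. Qed.

Section algebra.
Variables (A : set (T -> R)) (hA : bounded_algebra A).
Local Notation bc := (bounded_closure A).

Lemma bc_bounded f : bc f -> exists2 M, 0 <= M & forall x, `|f x| <= M.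
Proof.
elim=> {f} [f Af|f_ f M _ _ fM fl].
  have [_ _ _ /(_ f Af)[M fM]] := hA.
  exists `|M| => // x; exact: le_trans (fM x) (ler_norm M).
exists `|M| => // x; apply: le_trans (ler_norm M).
exact: lim_bounded (fl x).
Qed.

(** Two successive inductions: the second operand is first kept in A. *)
Lemma bc_op (op : R -> R -> R) :
  (forall f g, A f -> A g -> A (fun x => op (f x) (g x))) ->
  (forall M N, exists K, forall a b, `|a| <= M -> `|b| <= N -> `|op a b| <= K) ->
  (forall (a_ : nat -> R) a b, a_ n @[n --> \oo] --> a ->
     op (a_ n) b @[n --> \oo] --> op a b) ->
  (forall (b_ : nat -> R) a b, b_ n @[n --> \oo] --> b ->
     op a (b_ n) @[n --> \oo] --> op a b) ->
  forall f g, bc f -> bc g -> bc (fun x => op (f x) (g x)).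
Proof.
move=> opA opB opl opr f g bf; elim=> {g} [g Ag|g_ g N bg IH gN gl]; last first.
  have [M _ fM] := bc_bounded bf; have [K hK] := opB M N.
  apply: (@bc_lim _ (fun n x => op (f x) (g_ n x)) _ K) => // [n x|x].
    exact: hK.
  exact: opr.
elim: bf => {f} [f Af|f_ f M bf IH fM fl]; first by apply: bc_base; exact: opA.
have [N _ gN] := bc_bounded (bc_base Ag); have [K hK] := opB M N.
apply: (@bc_lim _ (fun n x => op (f_ n x) (g x)) _ K) => // [n x|x].
  exact: hK.
exact: opl.
Qed.

Lemma bcD f g : bc f -> bc g -> bc (fun x => f x + g x).
Proof.
apply: (@bc_op (fun a b => a + b)).
- by have [] := hA.
- by move=> M N; exists (M + N) => a b aM bN; rewrite (le_trans (ler_normD _ _))// lerD.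
- by move=> a_ a b al; apply: cvgD => //; exact: cvg_cst.
- by move=> b_ a b bl; apply: cvgD => //; exact: cvg_cst.
Qed.

Lemma bcM f g : bc f -> bc g -> bc (fun x => f x * g x).
Proof.
apply: (@bc_op (fun a b => a * b)).
- by have [] := hA.
- by move=> M N; exists (M * N) => a b aM bN; rewrite normrM ler_pM.
- by move=> a_ a b al; apply: cvgM => //; exact: cvg_cst.
- by move=> b_ a b bl; apply: cvgM => //; exact: cvg_cst.
Qed.

Lemma bc_cst c : bc (fun=> c).
Proof. by apply: bc_base; have [] := hA. Qed.

Lemma bc_affine c d f : bc f -> bc (fun x => c + d * f x).
Proof. by move=> bf; apply: (bcD (bc_cst c)); exact: bcM (bc_cst d) bf. Qed.

(* on [0, 1] the iterates of this map move every point away from 1/2 *)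
Let step (t : R) := t ^+ 2 * (3 - 2 * t).

Let step01 (t : R) : 0 <= t <= 1 -> 0 <= step t <= 1.
Proof.
move=> /andP[t0 t1]; have h : 0 <= 3 - 2 * t by lra.
apply/andP; split; first by rewrite mulr_ge0 ?sqr_ge0.
rewrite -subr_ge0 (_ : _ - _ = (1 - t) ^+ 2 * (1 + 2 * t)); last first.
  by rewrite /step; ring.
by rewrite mulr_ge0 ?sqr_ge0//; lra.
Qed.

Let iter01 n (t : R) : 0 <= t <= 1 -> 0 <= iter n step t <= 1.
Proof. by move=> t01; elim: n => //= n IH; exact: step01. Qed.

Let iter_lt (t : R) : 0 <= t -> t < 2^-1 -> iter n step t @[n --> \oo] --> (0 : R).
Proof.
move=> t0 th; pose q := t * (3 - 2 * t).
have q0 : 0 <= q by rewrite mulr_ge0//; lra.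
have q1 : q < 1.
  rewrite -subr_gt0 (_ : _ - _ = (1 - t) * (1 - 2 * t)); last by rewrite /q; ring.
  by rewrite mulr_gt0; lra.
have h n : 0 <= iter n step t /\ iter n step t <= q ^+ n * t.
  elim: n => [|n [IH0 IH1]]; first by rewrite expr0 mul1r.
  have IH2 : iter n step t <= t.
    by apply: le_trans IH1 _; rewrite ler_piMl//; apply: exprn_ile1 => //; exact: ltW.
  rewrite /= /step; set a := iter n step t in IH0 IH1 IH2 *.
  have a3 : 0 <= 3 - 2 * a by lra.
  split; first by rewrite mulr_ge0 ?sqr_ge0.
  have -> : a ^+ 2 * (3 - 2 * a) = (a * (3 - 2 * a)) * a by ring.
  rewrite exprS -[leRHS]mulrA; apply: ler_pM => //; first by rewrite mulr_ge0.
  rewrite -subr_ge0 (_ : _ - _ = (t - a) * (3 - 2 * t - 2 * a)); last first.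
    by rewrite /q; ring.
  by rewrite mulr_ge0; lra.
apply: (@squeeze_cvgr _ _ _ _ (fun=> 0) (fun n => q ^+ n * t)).
- by near=> n; have [h0 h1] := h n; rewrite h0 h1.
- exact: cvg_cst.
- rewrite -[X in _ --> X](mul0r t); apply: cvgMl.
  by apply: cvg_expr; rewrite ger0_norm.
Unshelve. all: by end_near. Qed.

Let stepC (t : R) : step (1 - t) = 1 - step t.
Proof. by rewrite /step; ring. Qed.

Let iter_gt (t : R) : t <= 1 -> 2^-1 < t -> iter n step t @[n --> \oo] --> (1 : R).
Proof.
move=> t1 th; have -> : (fun n => iter n step t) = (fun n => 1 - iter n step (1 - t)).
  apply/funext; elim=> [|n /= ->]; first by rewrite /= subKr.
  by rewrite stepC.
rewrite -[X in _ --> X](subr0 1); apply: cvgB; first exact: cvg_cst.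
by apply: iter_lt; lra.
Qed.

Let iter_half n : iter n step 2^-1 = 2^-1.
Proof. by elim: n => //= n ->; rewrite /step; field. Qed.

(** With t affine in f and equal to 1/2 on the level c, the iterates of the
    polynomial step at t converge to 1, 1/2 or 0 according to the sign of c - f. *)
Lemma bc_sublevel f c : bc f -> bc (\1_[set x | f x <= c]).
Proof.
move=> bf; have [M M0 fM] := bc_bounded bf.
pose D := 2 * (M + `|c| + 1).
have D0 : 0 < D by rewrite /D; have := normr_ge0 c; lra.
pose t x := (2^-1 + c / D) + - D^-1 * f x.
have tE x : t x = 2^-1 + (c - f x) / D by rewrite /t; ring.
have t01 x : 0 <= t x <= 1.
  have : `|(c - f x) / D| <= 2^-1.
    rewrite normrM normfV (gtr0_norm D0) ler_pdivrMr//.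
    have := fM x; have := ler_normB c (f x); rewrite /D; lra.
  by rewrite ler_norml tE => /andP[? ?]; apply/andP; split; lra.
have bt n : bc (fun x => iter n step (t x)).
  elim: n => [|n IH]; first exact: bc_affine.
  rewrite (_ : (fun x => _) = (fun x => iter n step (t x) * iter n step (t x) *
      (3 + (- 2) * iter n step (t x)))).
    exact: bcM (bcM IH IH) (bc_affine _ _ IH).
  by apply/funext => x; rewrite /= /step mulNr -expr2.
pose g x : R := if f x < c then 1 else if f x == c then 2^-1 else 0.
have bg : bc g.
  apply: (@bc_lim _ (fun n x => iter n step (t x)) _ 1) => // [n x|x].
    by have /andP[? ?] := iter01 n (t01 x); rewrite ger0_norm.
  have [/andP[tx0 tx1]] := t01 x; rewrite /g; have [fc|fc|fc] := ltgtP (f x) c.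
  - by apply: iter_gt => //; rewrite tE ltrDl divr_gt0// subr_gt0.
  - by apply: iter_lt => //; rewrite tE gtrDl pmulr_llt0 ?invr_gt0// subr_lt0.
  - rewrite tE fc subrr mul0r addr0 (_ : (fun n => _) = (fun=> 2^-1)).
      exact: cvg_cst.
    by apply/funext => n; exact: iter_half.
(* this polynomial sends 0, 1/2, 1 to 0, 1, 1 *)
have -> : \1_[set x | f x <= c] = (fun x => g x * (3 + (-2) * g x)) :> (T -> R).
  apply/funext => x; rewrite indicE /g; case: (ltgtP (f x) c) => fc.
  - by rewrite mem_set ?mulrN1/=; [ring|exact: ltW].
  - rewrite memNset ?mul0r//=; apply/negP; rewrite -ltNge//.
  - by rewrite mem_set/= ?fc//; field.
by apply: bcM => //; exact: bc_affine.
Qed.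

Lemma bc_indic_sigma : sigma_algebra [set: T] [set S | bc (\1_S)].
Proof.
have bcC S : bc (\1_S) -> bc (\1_(~` S)).
  move=> bS; rewrite (_ : \1_(~` S) = (fun x => 1 + (- 1) * \1_S x)).
    exact: bc_affine.
  apply/funext => x; rewrite !indicE; have [xS|xS] := pselect (S x).
    by rewrite [x \in S]mem_set// memNset//=; ring.
  by rewrite [x \in S]memNset// mem_set//=; ring.
have bcI S S' : bc (\1_S) -> bc (\1_S') -> bc (\1_(S `&` S')).
  move=> bS bS'; rewrite indicI; exact: bcM.
split=> /=.
- by rewrite indic0; exact: bc_cst.
- by move=> S bS; rewrite setTD; exact: bcC.
- move=> F bF.
  rewrite -[X in \1_X]setCK; apply: (bcC _); rewrite setC_bigcup.
  have bn n : bc (\1_(\bigcap_(k in [set k | (k < n)%N]) ~` F k)).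
    elim: n => [|n IH].
      rewrite (_ : \bigcap_(k in _) _ = setT); last by apply/seteqP; split.
      by rewrite indicT; exact: bc_cst.
    rewrite (_ : \bigcap_(k in _) _ =
      (\bigcap_(k in [set k | (k < n)%N]) ~` F k) `&` ~` F n).
      by apply: (bcI _ _) => //; exact: (bcC _).
    apply/seteqP; split=> x /= h.
      by split=> [k kn|]; apply: h => /=; rewrite ltnS// ltnW.
    by move=> k; rewrite /= ltnS leq_eqVlt => /predU1P[->|kn]; [exact: h.2|exact: h.1].
  apply: (bc_lim (M := 1) bn) => [n x|x].
    by rewrite indicE normr_nat lern1 leq_b1.
  have [xF|] := pselect ((\bigcap_i ~` F i) x).
    rewrite (_ : (fun n => _) = (fun=> \1_(\bigcap_i ~` F i) x)); first exact: cvg_cst.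
    apply/funext => n; rewrite !indicE !mem_set// => k _; exact: xF.
  move=> xF; have [k kF] : exists k, F k x.
    apply: contrapT => h; apply: xF => k _ Fk; apply: h; by exists k.
  apply: cvg_near_cst; exists k.+1 => // n /= kn.
  by rewrite !indicE !memNset//= => /(_ k); apply.
Qed.

End algebra.
End bounded_limits.

(** * Integration against bounded limits *)

Section integration.
Context {R : realType} {d : measure_display} {T : measurableType d}.
Variable mu : {measure set T -> \bar R}.
Implicit Types (f g h : T -> R) (F : T -> R[i]).

Local Notation intg f := (mu.-integrable [set: T] (EFin \o f)).

Lemma integrable_meas f : intg f -> measurable_fun [set: T] f.
Proof. by move=> /measurable_int mf; exact/measurable_EFinP. Qed.

Lemma integrable_bound f g : measurable_fun [set: T] f -> intg g ->
  (forall x, `|f x| <= g x) -> intg f.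
Proof.
move=> mf ig fg; apply: le_integrable ig => //.
- exact/measurable_EFinP.
- by move=> x _; rewrite /= lee_fin (le_trans (fg x))// ler_norm.
Qed.

Lemma intg_ext f g : f =1 g -> intg f -> intg g.
Proof. by move=> /funext ->. Qed.

Lemma intgD f g : intg f -> intg g -> intg (fun x => f x + g x).
Proof. by move=> ih ig; have := integrableD measurableT ih ig. Qed.

Lemma intgZ c f : intg f -> intg (fun x => c * f x).
Proof. by move=> ih; have := integrableZl measurableT c ih. Qed.

Lemma intgN f : intg f -> intg (fun x => - f x).
Proof.
move=> /(intgZ (-1)); congr (mu.-integrable _ _).
by apply/funext => x /=; rewrite mulN1r.
Qed.

Lemma intgB f g : intg f -> intg g -> intg (fun x => f x - g x).
Proof. by move=> ih /intgN ig; exact: intgD. Qed.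

Lemma intg_norm f : intg f -> intg (fun x => `|f x|).
Proof. by move=> /integrable_abse. Qed.

Lemma intg_bounded_mul h f (M : R) : intg h -> measurable_fun [set: T] f ->
  (forall x, `|f x| <= M) -> intg (fun x => h x * f x).
Proof.
move=> ih mf fM; apply: (@integrable_bound _ (fun x => M * `|h x|)).
- by apply: measurable_funM => //; exact: integrable_meas.
- by apply: intgZ; exact: intg_norm.
- by move=> x; rewrite normrM mulrC ler_wpM2r.
Qed.

Lemma indic_le1 (S : set T) x : `|\1_S x| <= 1 :> R.
Proof. by rewrite indicE normr_nat lern1 leq_b1. Qed.

Lemma intg_indic h S : intg h -> measurable S -> intg (fun x => h x * \1_S x).
Proof.
move=> ih mS; apply: (intg_bounded_mul ih _ (indic_le1 S)).
exact: measurable_indic.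
Qed.

Lemma Rintegral_bounded_cvg h (f_ : nat -> T -> R) f (M : R) : intg h ->
  (forall n, measurable_fun [set: T] (f_ n)) -> (forall n x, `|f_ n x| <= M) ->
  (forall x, f_ n x @[n --> \oo] --> f x) ->
  \int[mu]_x (h x * f_ n x) @[n --> \oo] --> \int[mu]_x (h x * f x).
Proof.
move=> ih mf fM fl; have mh := integrable_meas ih.
have mfl : measurable_fun [set: T] f.
  by apply: measurable_fun_cvg mf _ => x _; exact: fl.
have fM' x : `|f x| <= M by exact: (@lim_bounded _ (fun n => f_ n x)).
have c1 n : measurable_fun [set: T] (fun x => (h x * f_ n x)%:E).
  by apply/measurable_EFinP; exact: measurable_funM.
have c2 : measurable_fun [set: T] (fun x => (h x * f x)%:E).
  by apply/measurable_EFinP; exact: measurable_funM.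
have c3 : {ae mu, forall x, [set: T] x ->
    (h x * f_ n x)%:E @[n --> \oo] --> (h x * f x)%:E}.
  apply: aeW => x _; apply: cvg_EFin; first by near=> n.
  by apply: cvgM; [exact: cvg_cst|exact: fl].
have c4 : mu.-integrable [set: T] (fun x => (M * `|h x|)%:E).
  by apply: intgZ; exact: intg_norm.
have c5 : {ae mu, forall x n, [set: T] x ->
    (`|(h x * f_ n x)%:E| <= (M * `|h x|)%:E)%E}.
  by apply: aeW => x n _; rewrite lee_fin normrM mulrC ler_wpM2r.
have [i1 _ i3] := dominated_convergence measurableT c1 c2 c3 c4 c5.
rewrite /Rintegral; apply: fine_cvg.
rewrite fineK; first exact: i3.
exact: integrable_fin_num.
Unshelve. all: by end_near. Qed.

Lemma bc_measurable A f : A `<=` [set f | measurable_fun [set: T] f] ->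
  bounded_closure A f -> measurable_fun [set: T] f.
Proof.
move=> mA; elim=> {f} [f /mA//|f_ f M _ IH _ fl].
by apply: measurable_fun_cvg IH _ => x _; exact: fl.
Qed.

Section against.
Variable A : set (T -> R).
Hypothesis mA : A `<=` [set f | measurable_fun [set: T] f].

Lemma bc_annihilated h f : intg h -> (forall f, A f -> \int[mu]_x (h x * f x) = 0) ->
  bounded_closure A f -> \int[mu]_x (h x * f x) = 0.
Proof.
move=> ih hf; elim=> {f} [f /hf//|f_ f M bf IH fM fl].
have := Rintegral_bounded_cvg ih (fun n => bc_measurable mA (bf n)) fM fl.
under eq_fun do rewrite IH.
move=> h0; apply/esym; apply: (cvg_unique (@Rhausdorff R) _ h0); exact: cvg_cst.
Qed.

Lemma bc_square_ge0 h f : intg h ->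
  (forall f, A f -> 0 <= \int[mu]_x (h x * (f x) ^+ 2)) ->
  bounded_closure A f -> 0 <= \int[mu]_x (h x * (f x) ^+ 2).
Proof.
move=> ih hf; elim=> {f} [f /hf//|f_ f M bf IH fM fl].
have mf n := bc_measurable mA (bf n).
have cv := @Rintegral_bounded_cvg h (fun n x => f_ n x ^+ 2) (fun x => f x ^+ 2)
  (M ^+ 2) ih.
have {}cv : \int[mu]_x (h x * f_ n x ^+ 2) @[n --> \oo] --> \int[mu]_x (h x * f x ^+ 2).
  apply: cv => [n|n x|x].
  - exact: measurable_funX.
  - have M0 : 0 <= M by exact: le_trans (fM n x).
    by rewrite normrX lerXn2r// nnegrE.
  - by rewrite expr2; under eq_fun do rewrite expr2; apply: cvgM; exact: fl.
rewrite -(cvg_lim (@Rhausdorff R) cv); apply: limr_ge; first exact: cvgP cv.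
by near=> n; exact: IH.
Unshelve. all: by end_near. Qed.

Hypothesis bc_indic : forall S, measurable S -> bounded_closure A (\1_S).

Lemma Rintegral_indic h S : intg h -> measurable S ->
  (\int[mu]_(x in S) (h x)%:E)%E = (\int[mu]_x (h x * \1_S x))%:E.
Proof.
move=> ih mS; rewrite /Rintegral fineK.
  rewrite integral_mkcond; apply: eq_integral => x _.
  by rewrite patchE indicE; case: ifP => _; rewrite ?mulr1 ?mulr0.
by apply: integrable_fin_num => //; exact: intg_indic.
Qed.

Lemma ae_eq0_of_annihilated h : intg h ->
  (forall f, A f -> \int[mu]_x (h x * f x) = 0) -> {ae mu, forall x, h x = 0}.
Proof.
move=> ih hf.
have := @integral_ae_eq _ _ _ mu setT measurableT (cst 0%E) (EFin \o h) ih
  (measurable_cst _).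
case.
  move=> E _ mE; rewrite integral0 /=.
  by rewrite Rintegral_indic// (bc_annihilated ih hf)//; exact: bc_indic.
move=> N [mN N0 sN]; exists N; split=> // x /= hx; apply: sN => /= /(_ Logic.I) [].
exact: hx.
Qed.

(** Indicators are their own squares, so h has nonnegative integral over every
    measurable set, in particular over subsets of the set where h < 0. *)
Lemma ae_ge0_of_squares h : intg h ->
  (forall f, A f -> 0 <= \int[mu]_x (h x * (f x) ^+ 2)) ->
  {ae mu, forall x, 0 <= h x}.
Proof.
move=> ih hf; pose N := [set x | h x < 0].
have mN : measurable N.
  by apply: measurable_lt_set; [exact: integrable_meas|exact: measurable_cst].
have ge0 S : measurable S -> 0 <= \int[mu]_x (h x * \1_S x).
  move=> mS; have := bc_square_ge0 ih hf (bc_indic mS).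
  congr (_ <= _); apply: eq_Rintegral => x _; rewrite indicE.
  by case: (_ \in _); rewrite ?expr1n ?expr0n.
pose k x := h x * \1_N x.
have ik : intg k by exact: intg_indic.
have [|M [mM M0 sM]] := @integral_ae_eq _ _ _ mu setT measurableT (cst 0%E) (EFin \o k) ik
  (measurable_cst _).
  move=> E _ mE; rewrite integral0 /= Rintegral_indic//; congr EFin.
  have E1 : (fun x => k x * \1_E x) = (fun x => h x * \1_(N `&` E) x).
    by apply/funext => x; rewrite /k indicI /= mulrA.
  apply/eqP; rewrite eq_le; apply/andP; split; last first.
    by rewrite E1; apply: ge0; exact: measurableI.
  rewrite -oppr_ge0 -[leRHS]mulN1r -RintegralZl//; last first.
    exact: intg_indic.
  apply: Rintegral_ge0 => x _; rewrite mulN1r oppr_ge0 mulr_le0_ge0//.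
    rewrite /k indicE; have [xN|xN] := pselect (N x).
      by rewrite mem_set// mulr1 ltW.
    by rewrite memNset// mulr0.
exists M; split=> // x /= hx; apply: sM => /= /(_ Logic.I) [].
have xN : N x by rewrite /N /= ltNge; apply/negP.
rewrite /k indicE mem_set// mulr1 => h0.
by apply: hx; rewrite h0.
Qed.

End against.

(** Markov's inequality on the sets where all the u_ n are at least 1/k. This is
    weaker than convergence along a subsequence, but enough for closedness
    arguments, which need a single good index. *)
Lemma ae_small (u_ : nat -> T -> R) : (forall n, intg (u_ n)) ->
  (forall n, {ae mu, forall x, 0 <= u_ n x}) ->
  (forall e : R, 0 < e -> exists n, \int[mu]_x u_ n x < e) ->
  {ae mu, forall x, forall e, 0 < e -> exists n, u_ n x < e}.
Proof.
move=> iu u0 us.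
pose E k := [set x | forall n, k.+1%:R^-1 <= u_ n x].
have mE k : measurable (E k).
  rewrite (_ : E k = [set x | forall n, [set: nat] n -> k.+1%:R^-1 <= u_ n x]).
    apply: (@measurable_countable_cap _ _ nat (fun n => [set x | k.+1%:R^-1 <= u_ n x])
      setT) => n _.
    by apply: measurable_le_set; [exact: measurable_cst|exact: integrable_meas].
  by apply/seteqP; split=> x /= h n => [_|]; exact: h.
have E0 k : mu (E k) = 0%E.
  have k0 : (0 < (k.+1%:R^-1 : R)%:E)%E by rewrite lte_fin invr_gt0.
  have h : ((k.+1%:R^-1)%:E * mu (E k) <= 0)%E.
    apply/lee_addgt0Pr => e /us[n un]; rewrite add0e.
    rewrite -integral_cst//.
    apply: (@le_trans _ _ (\int[mu]_(x in E k) `|(u_ n x)%:E|)%E).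
      apply: ge0_le_integral => //; first by move=> x _; exact: ltW.
        by apply/measurable_EFinP; apply: measurableT_comp => //;
          apply: measurable_funTS; exact: integrable_meas.
      by move=> x Ex; rewrite lee_fin (le_trans (Ex n))// ler_norm.
    apply: (@le_trans _ _ (\int[mu]_x `|(u_ n x)%:E|)%E).
      apply: ge0_subset_integral => //.
      by apply/measurable_EFinP; apply: measurableT_comp => //; exact: integrable_meas.
    rewrite (@ae_eq_integral _ _ _ mu setT (EFin \o u_ n))//; first last.
    - by apply: filterS (u0 n) => x /= ux _; rewrite ger0_norm.
    - by apply/measurable_EFinP; exact: integrable_meas.
    - by apply/measurable_EFinP; apply: measurableT_comp => //; exact: integrable_meas.
    - rewrite -[leLHS]fineK ?lee_fin ?ltW//.
      exact: integrable_fin_num.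
  by apply/eqP; rewrite eq_le measure_ge0 andbT -(pmule_rle0 _ k0).
have : {ae mu, forall x k, ~ E k x}.
  apply: ae_foralln => k; exists (E k); split=> // x /=.
  exact: contrapT.
apply: filterS => x hx e e0.
have [N /(_ N (leqnn _)) hN] := inv_small e0.
apply: contrapT => /forallNP h; apply: (hx N) => n.
by apply: ltW; apply: lt_le_trans hN _; rewrite leNgt; apply/negP; exact: h.
Qed.

End integration.

(** * Complex integrals and characters *)

Section complex_integrals.
Context {R : realType} {d : measure_display} {T : measurableType d}.
Variable mu : {measure set T -> \bar R}.
Implicit Types (f g : T -> R[i]).

Lemma cintegrable_meas f : cintegrable mu f -> cmeasurable f.
Proof. by move=> [/integrable_meas ? /integrable_meas ?]. Qed.

Lemma cintegrableD f g : cintegrable mu f -> cintegrable mu g ->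
  cintegrable mu (fun x => f x + g x).
Proof.
move=> [f1 f2] [g1 g2]; split.
  by apply: intg_ext (intgD f1 g1) => x; rewrite ReD.
by apply: intg_ext (intgD f2 g2) => x; rewrite ImD.
Qed.

Lemma cintegralD f g : cintegrable mu f -> cintegrable mu g ->
  cintegral mu (fun x => f x + g x) = cintegral mu f + cintegral mu g.
Proof.
move=> [f1 f2] [g1 g2]; apply: complex_ext => /=.
  by under eq_Rintegral do rewrite ReD; exact: RintegralD.
by under eq_Rintegral do rewrite ImD; exact: RintegralD.
Qed.

Lemma cintegrableZ (c : R[i]) f : cintegrable mu f ->
  cintegrable mu (fun x => c * f x).
Proof.
move=> [f1 f2]; split.
  apply: intg_ext (intgB (intgZ (complex.Re c) f1) (intgZ (complex.Im c) f2)) => x.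
  by rewrite ReM.
apply: intg_ext (intgD (intgZ (complex.Re c) f2) (intgZ (complex.Im c) f1)) => x.
by rewrite ImM.
Qed.

Lemma cintegralZ (c : R[i]) f : cintegrable mu f ->
  cintegral mu (fun x => c * f x) = c * cintegral mu f.
Proof.
move=> [f1 f2]; apply: complex_ext; rewrite !cE /=.
  under eq_Rintegral do rewrite ReM.
  by rewrite RintegralB ?RintegralZl//; exact: intgZ.
under eq_Rintegral do rewrite ImM.
by rewrite RintegralD ?RintegralZl//; exact: intgZ.
Qed.

Lemma cintegrable_conj f : cintegrable mu f -> cintegrable mu (fun x => (f x)^*).
Proof.
move=> [f1 f2]; split; first by apply: intg_ext f1 => x; rewrite Re_conj.
by apply: intg_ext (intgN f2) => x; rewrite Im_conj.
Qed.

Lemma cintegral_conj f : cintegrable mu f ->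
  cintegral mu (fun x => (f x)^*) = (cintegral mu f)^*.
Proof.
move=> [f1 f2]; apply: complex_ext; rewrite ?Re_conj ?Im_conj /=.
  by apply: eq_Rintegral => x _; rewrite Re_conj.
under eq_Rintegral do rewrite Im_conj -mulN1r.
by rewrite RintegralZl// mulN1r.
Qed.

Lemma csq_le1 (z : R[i]) : csq z <= 1 -> `|complex.Re z| <= 1 /\ `|complex.Im z| <= 1.
Proof.
have sq (x : R) : x ^+ 2 <= 1 -> `|x| <= 1.
  by rewrite -(real_normK (num_real x)) expr_le1.
move=> z1; split; apply: sq; apply: le_trans z1; rewrite /csq.
  by rewrite lerDl sqr_ge0.
by rewrite lerDr sqr_ge0.
Qed.

Lemma cintegrable_bounded_mul f g : cintegrable mu f -> cmeasurable g ->
  (forall x, csq (g x) <= 1) -> cintegrable mu (fun x => f x * g x).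
Proof.
move=> [f1 f2] [g1 g2] b.
have b1 x : `|complex.Re (g x)| <= 1 by have [] := csq_le1 (b x).
have b2 x : `|complex.Im (g x)| <= 1 by have [] := csq_le1 (b x).
split.
  apply: intg_ext (intgB (intg_bounded_mul f1 g1 b1) (intg_bounded_mul f2 g2 b2)) => x.
  by rewrite ReM.
apply: intg_ext (intgD (intg_bounded_mul f1 g2 b2) (intg_bounded_mul f2 g1 b1)) => x.
by rewrite ImM.
Qed.

Lemma cintegrable0 : cintegrable mu (fun=> 0).
Proof. by split; exact: integrable0. Qed.

Lemma cintegral0 : cintegral mu (fun=> 0) = 0.
Proof. by apply: complex_ext; rewrite /= /Rintegral integral0. Qed.

Lemma cintegrable_sum (S : Type) (s : seq S) (F : S -> T -> R[i]) :
  (forall i, cintegrable mu (F i)) -> cintegrable mu (fun x => \sum_(i <- s) F i x).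
Proof.
move=> iF; elim: s => [|i s IH].
  by under eq_fun do rewrite big_nil; exact: cintegrable0.
by under eq_fun do rewrite big_cons; exact: cintegrableD.
Qed.

Lemma cintegral_sum (S : Type) (s : seq S) (F : S -> T -> R[i]) :
  (forall i, cintegrable mu (F i)) ->
  cintegral mu (fun x => \sum_(i <- s) F i x) = \sum_(i <- s) cintegral mu (F i).
Proof.
move=> iF; elim: s => [|i s IH].
  by under eq_fun do rewrite big_nil; rewrite big_nil cintegral0.
under eq_fun do rewrite big_cons.
by rewrite big_cons cintegralD// ?IH//; exact: cintegrable_sum.
Qed.

Lemma cintegral_ae f g : cmeasurable f -> cmeasurable g ->
  {ae mu, forall x, f x = g x} -> cintegral mu f = cintegral mu g.
Proof.
move=> [f1 f2] [g1 g2] fg; apply: complex_ext; rewrite /= /Rintegral;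
  congr fine; apply: ae_eq_integral => //; try exact/measurable_EFinP;
  by apply: filterS fg => x /= -> _.
Qed.

End complex_integrals.

Section characters.
Context {R : realType} {d : measure_display} {T : measurableType d}.
Variables (mu : {measure set T -> \bar R}) (G : zmodType) (e : G -> T -> R[i]).

Definition character_family : Prop :=
  [/\ forall x y a, e (x + y) a = e x a * e y a,
      forall x a, csq (e x a) = 1
    & forall x, cmeasurable (e x)].

(** The real-valued trigonometric polynomials; complex coefficients make them
    visibly closed under products. *)
Definition trig : set (T -> R) := [set f | exists s : seq (R[i] * G),
  forall a, (f a)%:C%C = \sum_(t <- s) t.1 * e t.2 a].

Hypothesis he : character_family.

Let eD x y a : e (x + y) a = e x a * e y a.
Proof. by have [-> _ _] := he. Qed.

Lemma char_csq x a : csq (e x a) = 1.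
Proof. by have [_ -> _] := he. Qed.

Lemma char_meas x : cmeasurable (e x).
Proof. by have [_ _] := he; apply. Qed.

Lemma char_mul_conj x a : e x a * (e x a)^* = 1.
Proof. by rewrite -csqE char_csq. Qed.

Lemma char0 a : e 0 a = 1.
Proof. by rewrite -[LHS]mulr1 -(char_mul_conj 0 a) mulrA -eD addr0. Qed.

Lemma charN x a : e (- x) a = (e x a)^*.
Proof.
by rewrite -[LHS]mulr1 -(char_mul_conj x a) mulrA -eD addNr char0 mul1r.
Qed.

Lemma char_cintegrable f x : cintegrable mu f ->
  cintegrable mu (fun a => f a * e x a).
Proof.
move=> hf; apply: cintegrable_bounded_mul => //; first exact: char_meas.
by move=> a; rewrite char_csq.
Qed.

Lemma char_conj_cintegrable f x : cintegrable mu f ->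
  cintegrable mu (fun a => f a * (e x a)^*).
Proof.
by move=> /(char_cintegrable (- x)); under eq_fun do rewrite charN.
Qed.

Lemma trig_algebra : bounded_algebra trig.
Proof.
split.
- move=> c; exists [:: (c%:C%C, 0)] => a.
  by rewrite big_seq1 /= char0 mulr1.
- move=> f g [s fs] [t gt]; exists (s ++ t) => a.
  by rewrite big_cat /= -fs -gt rmorphD.
- move=> f g [s fs] [t gt].
  exists [seq (p.1 * q.1, p.2 + q.2) | p <- s, q <- t] => a.
  rewrite big_allpairs_dep rmorphM/= fs gt big_distrl/=; apply: eq_bigr => p _.
  by rewrite big_distrr/=; apply: eq_bigr => q _; rewrite eD mulrACA.
- move=> f [s fs]; exists (\sum_(t <- s) Normc.normc t.1) => a.
  rewrite -lecR [leLHS](_ : _ = `|(f a)%:C%C|); last by rewrite normc_def /= expr0n addr0 sqrtr_sqr.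
  rewrite fs (le_trans (ler_norm_sum _ _ _))// rmorph_sum/=; apply: ler_sum => t _.
  rewrite normrM (_ : `|e t.2 a| = 1) ?mulr1//.
  by apply/eqP; rewrite -sqrp_eq1// -csq_norm char_csq.
Qed.

Lemma trig_measurable : trig `<=` [set f | measurable_fun [set: T] f].
Proof.
move=> f [s fs] /=.
have -> : f = (fun a => complex.Re (\sum_(t <- s) t.1 * e t.2 a)).
  by apply/funext => a; rewrite -fs.
suff [] : cmeasurable (fun a => \sum_(t <- s) t.1 * e t.2 a) by [].
elim: s {fs} => [|t s IH].
  by under eq_fun do rewrite big_nil; exact: cmeasurable_cst.
under eq_fun do rewrite big_cons.
by apply: cmeasurableD => //; apply: cmeasurableM; [exact: cmeasurable_cst|exact: char_meas].
Qed.

Lemma trig_Re x : trig (fun a => complex.Re (e x a)).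
Proof.
exists [:: (2^-1, x); (2^-1, - x)] => a.
rewrite big_cons big_seq1 /= charN -mulrDr mulrC.
by rewrite ReJ_add.
Qed.

Lemma trig_Im x : trig (fun a => complex.Im (e x a)).
Proof.
exists [:: (- 'i%C / 2, x); ('i%C / 2, - x)] => a.
rewrite big_cons big_seq1 /= charN.
have two : (2 : R[i]) != 0 by rewrite pnatr_eq0.
apply: (mulIf two); rewrite mulrDl [- _ / 2 * _]mulrAC divfK// ['i%C / 2 * _]mulrAC divfK//.
apply: complex_ext; rewrite !cE /= ?cE /=; ring.
Qed.

Hypothesis generated : forall S, measurable S -> bounded_closure trig (\1_S).

(** An integrable function with vanishing transform annihilates the algebra of
    trigonometric polynomials, hence its bounded limits, hence indicators. *)
Theorem fourier_uniqueness h : cintegrable mu h ->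
  (forall x, cintegral mu (fun a => h a * (e x a)^*) = 0) ->
  {ae mu, forall a, h a = 0}.
Proof.
move=> ih h0; have [h1 h2] := ih.
have key f : trig f -> cintegral mu (fun a => h a * (f a)%:C%C) = 0.
  move=> [s fs].
  rewrite (_ : (fun a => _) = (fun a => \sum_(t <- s) t.1 * (h a * (e (- t.2) a)^*))).
    rewrite cintegral_sum => [|t].
      rewrite big1_seq// => t _; rewrite cintegralZ ?h0 ?mulr0//.
      exact: char_conj_cintegrable.
    by apply: cintegrableZ; exact: char_conj_cintegrable.
  apply/funext => a; rewrite fs big_distrr/=; apply: eq_bigr => t _.
  by rewrite -charN opprK mulrCA.
have e1 : {ae mu, forall a, complex.Re (h a) = 0}.
  apply: (ae_eq0_of_annihilated trig_measurable generated h1) => f /key.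
  move=> /(congr1 (@complex.Re R)) /= <-; apply: eq_Rintegral => a _.
  by rewrite ReM /= mulr0 subr0.
have e2 : {ae mu, forall a, complex.Im (h a) = 0}.
  apply: (ae_eq0_of_annihilated trig_measurable generated h2) => f /key.
  move=> /(congr1 (@complex.Im R)) /= <-; apply: eq_Rintegral => a _.
  by rewrite ImM /= mulr0 add0r.
by apply: filterS2 e1 e2 => a ? ?; exact: complex_ext.
Qed.

(** The hypothesis is positive definiteness of the transform of h. *)
Theorem fourier_positivity h : cintegrable mu h ->
  (forall s : seq (R[i] * G), 0 <= complex.Re (cintegral mu (fun a => h a *
     ((\sum_(t <- s) t.1 * e t.2 a) * (\sum_(t <- s) t.1 * e t.2 a)^*)))) ->
  {ae mu, forall a, 0 <= complex.Re (h a)}.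
Proof.
move=> ih h0; have [h1 h2] := ih.
apply: (ae_ge0_of_squares trig_measurable generated h1) => f [s fs].
have := h0 s; congr (_ <= _); apply: eq_Rintegral => a _.
by rewrite -fs -csqE csq_real ReM /= mulr0 subr0.
Qed.

End characters.

(** * Borel sets of the dual group *)

(** The point a pads the enumeration when A is finite. *)
Lemma countable_enumeration (T : choiceType) (A : set T) (a : T) :
  countable A -> A a ->
  exists f : nat -> T, (forall n, A (f n)) /\ (forall x, A x -> exists n, f n = x).
Proof.
move=> /countable_injP[g ginj] Aa.
have /choice[f fP] (n : nat) : exists x, A x /\ (forall y, A y -> g y = n -> x = y).
  have [[x [Ax gx]]|h] := pselect (exists x, A x /\ g x = n).
    exists x; split=> // y Ay gy; apply: ginj; rewrite ?inE//.
    by rewrite gx gy.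
  by exists a; split=> // y Ay gy; exfalso; apply: h; exists y.
exists f; split=> [n|x Ax]; first exact: (fP n).1.
by exists (g x); exact: (fP (g x)).2.
Qed.

Section dual_topology.
Variables (R : realType) (G : topologicalZmodType).
Implicit Types (chi psi : dual R G).

Definition eval (x : G) (alpha : borel (dual R G)) : R[i] := (alpha : dual R G) x.

Lemma dual_character chi : is_character (chi : G -> R[i]^o).
Proof. exact/asboolP/dualfunP. Qed.

Lemma eval_csq (x : G) alpha : csq (eval x alpha) = 1.
Proof.
have [_ h _] := dual_character alpha.
have := csq_norm (eval x alpha); rewrite (h x : `|eval x alpha| = 1) expr1n.
by move=> /(congr1 (@complex.Re R)).
Qed.

Lemma dual_continuous_csq chi (x : G) (e : R) : 0 < e ->
  nbhs x [set y | csq (chi x - chi y) < e].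
Proof.
move=> e0; have [_ _ /(_ x)] := dual_character chi.
have s0 : 0 < (Num.sqrt e)%:C%C by rewrite ltcR sqrtr_gt0.
move=> /cvgrPdist_lt /(_ _ s0); apply: filterS => y /= h.
rewrite -ltcR csq_norm -[ltRHS](_ : (Num.sqrt e)%:C%C ^+ 2 = _).
  by rewrite ltr_pXn2r// nnegrE// ltW.
by rewrite -rmorphXn/= sqr_sqrtr// ltW.
Qed.

Lemma dual_nbhs_eval chi (x : G) (e : R) : 0 < e ->
  nbhs chi [set psi : dual R G | csq (chi x - psi x) < e].
Proof.
move=> e0; have [_ _ cchi] := dual_character chi.
have s0 : 0 < (Num.sqrt e)%:C%C by rewrite ltcR sqrtr_gt0.
have h : ((@dualfun R G) : dual R G -> {compact-open, G -> R[i]^o}) @ nbhs chi -->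
    ((@dualfun R G) chi : {compact-open, G -> R[i]^o}).
  exact: (@initial_continuous (dual R G) {compact-open, G -> R[i]^o} (@dualfun R G)).
have hF : Filter (fmap ((@dualfun R G) : dual R G -> G -> R[i]^o) (nbhs chi)).
  exact: (@fmap_filter (dual R G) (G -> R[i]^o) (@dualfun R G) (nbhs chi) (nbhs_filter chi)).
have {}h := (compact_open_fam_compactP cchi hF).1 h.
have := @fam_nbhs G R[i]^o compact [set x] [set p | ball p.1 (Num.sqrt e)%:C%C p.2]
  (dualfun chi) (entourage_ball _ (PosNum s0)) (@compact_set1 _ x).
move=> /h; apply: (@filterS _ _ (nbhs_filter chi)) => psi /= /(_ x erefl); rewrite -ball_normE /= => hx.
rewrite -ltcR csq_norm -[ltRHS](_ : (Num.sqrt e)%:C%C ^+ 2 = _).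
  by rewrite ltr_pXn2r// nnegrE// ltW.
by rewrite -rmorphXn/= sqr_sqrtr// ltW.
Qed.

(** The filter generated by these sets converges to chi in the compact-open
    topology, because it does so uniformly on compact sets. *)
Lemma dual_nbhs_base chi (U : set (dual R G)) : nbhs chi U ->
  exists K (e : R), [/\ compact K, 0 < e &
    [set psi : dual R G | forall x, K x -> csq (chi x - psi x) < e] `<=` U].
Proof.
pose F : set_system (dual R G) := [set V | exists K (e : R), [/\ compact K, 0 < e &
    [set psi : dual R G | forall x, K x -> csq (chi x - psi x) < e] `<=` V]].
have FF : Filter F.
  split.
  - by exists set0, 1; split => //; exact: compact0.
  - move=> P Q [K [e [cK e0 hP]]] [L [f [cL f0 hQ]]].
    exists (K `|` L), (Num.min e f); split; first exact: compactU.
      by rewrite lt_min e0 f0.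
    move=> psi h; split.
      by apply: hP => x Kx; have := h x (or_introl Kx); rewrite lt_min => /andP[].
    by apply: hQ => x Lx; have := h x (or_intror Lx); rewrite lt_min => /andP[].
  - move=> P Q PQ [K [e [cK e0 hP]]]; exists K, e; split=> //.
    exact: subset_trans hP PQ.
suff : F --> chi by move=> h /h.
have [_ _ cchi] := dual_character chi.
suff h : ((@dualfun R G) : dual R G -> {compact-open, G -> R[i]^o}) @ F -->
    ((@dualfun R G) chi : {compact-open, G -> R[i]^o}).
  move=> V; rewrite nbhsE /= => -[W [[B oB BW] Wchi] WV].
  apply: (@filterS _ _ FF) WV _; rewrite -BW; apply: h.
  by rewrite nbhsE /=; exists B => //; split => //; rewrite -BW in Wchi.
have hF : Filter (fmap ((@dualfun R G) : dual R G -> G -> R[i]^o) F).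
  exact: (@fmap_filter (dual R G) (G -> R[i]^o) (@dualfun R G) F FF).
apply/(compact_open_fam_compactP cchi hF).
apply/fam_cvgP => K cK A /uniform_nbhs[E [entE EA]].
move: entE; rewrite -entourage_ballE => -[_ /= /pos_complex[r r0 ->] eE].
exists K, (r ^+ 2); split => //; first by rewrite exprn_gt0.
move=> psi h; apply: EA => /= x Kx; apply: eE; rewrite /= -ball_normE /=.
have := h x Kx; rewrite -ltcR csq_norm rmorphXn/= ltr_pXn2r// nnegrE//.
by rewrite ltW// ltcR.
Qed.

Lemma open_borel (U : set (dual R G)) : open U -> measurable (U : set (borel (dual R G))).
Proof. by move=> oU; exact: sub_sigma_algebra. Qed.

Lemma eval_family : character_family eval.
Proof.
split.
- by move=> x y a; have [h _ _] := dual_character a; exact: h.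
- by move=> x a; exact: eval_csq.
- have csq_lt (p : R[i] -> R) : (forall z w, (p z - p w) ^+ 2 <= csq (z - w)) ->
      forall x, measurable_fun [set: borel (dual R G)] (fun a => p (eval x a)).
    move=> hp x; apply: measurable_gtP => r; apply: open_borel.
    rewrite openE => chi /= hr; have d0 : 0 < p (chi x) - r by rewrite subr_gt0.
    apply: (@filterS _ _ (nbhs_filter chi)) (dual_nbhs_eval chi x (exprn_gt0 2 d0)) => psi /= h.
    have {h} := le_lt_trans (hp (chi x) (psi x)) h.
    rewrite -(real_normK (num_real (_ - p _))) ltr_pXn2r ?nnegrE// ?(ltW d0)//.
    by move=> /(le_lt_trans (ler_norm _)); rewrite /eval; lra.
  move=> x; split; apply: csq_lt => z w; rewrite /csq !cE.
    by rewrite lerDl sqr_ge0.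
  by rewrite lerDr sqr_ge0.
Qed.

End dual_topology.

Lemma compact_zmodule_cover (G : topologicalZmodType) (K : set G) :
  compact K -> cover_compact K.
Proof.
pose pG : ptopologicalType := HB.pack (TopologicalZmodule.sort G)
  (isPointed.Build (TopologicalZmodule.sort G) 0).
by move=> cK; have : @cover_compact pG K by rewrite -(compact_cover pG).
Qed.

Section dual_borel_structure.
Variables (R : realType) (G : topologicalZmodType).
Implicit Types (chi psi : dual R G).

Local Notation trigs := (@trig R _ (borel (dual R G)) G (@eval R G)).

Definition trig_sets : set (set (dual R G)) :=
  [set S : set (dual R G) | bounded_closure trigs (\1_S)].

(** The characters with trig_sets as measurable sets: countable operations on
    trig_sets are then those of a measurable space. *)
Definition trig_borel : Type :=
  @g_sigma_algebraType (GRing.Zmodule.sort (dual R G)) trig_sets.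

(** The open sets of the dual are countable unions of sets of characters
    mapping each of finitely many basic open sets into a small rational square:
    a countable network, though not one made of open sets. *)
Let index := (nat * (rat * rat * nat))%type.

Let square (b : nat -> set G) (t : index) : set (dual R G) :=
  [set psi : dual R G | forall y, b t.1 y ->
    `|complex.Re (psi y) - ratr t.2.1.1| <= t.2.2.+1%:R^-1 /\
    `|complex.Im (psi y) - ratr t.2.1.2| <= t.2.2.+1%:R^-1].

Let square_cover (b : nat -> set G) chi (k : nat) (x : G) :
  (forall n, open (b n)) ->
  (forall U : set G, nbhs x U -> exists n, b n x /\ b n `<=` U) ->
  exists t, [/\ b t.1 x, square b t chi & t.2.2 = k].
Proof.
move=> ob hb; set r : R := k.+1%:R^-1.
have r0 : 0 < r by rewrite invr_gt0.
have [q1 hq1] := @rat_in_itvoo R (complex.Re (chi x) - r / 2)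
  (complex.Re (chi x) + r / 2) ltac:(lra).
have [q2 hq2] := @rat_in_itvoo R (complex.Im (chi x) - r / 2)
  (complex.Im (chi x) + r / 2) ltac:(lra).
move: hq1 hq2; rewrite !in_itv /= => /andP[a1 a2] /andP[c1 c2].
have e0 : 0 < (r / 2) ^+ 2 by rewrite exprn_gt0// divr_gt0.
have [n [bx bU]] := hb _ (dual_continuous_csq chi x e0).
exists (n, (q1, q2, k)); split=> //= y /bU /= hy.
have sq (z : R) : z ^+ 2 < (r / 2) ^+ 2 -> `|z| < r / 2.
  by rewrite -(real_normK (num_real z)) ltr_pXn2r ?nnegrE// ltW// divr_gt0.
have h1 : `|complex.Re (chi x) - complex.Re (chi y)| < r / 2.
  by apply: sq; apply: le_lt_trans hy; rewrite /csq !cE lerDl sqr_ge0.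
have h2 : `|complex.Im (chi x) - complex.Im (chi y)| < r / 2.
  by apply: sq; apply: le_lt_trans hy; rewrite /csq !cE lerDr sqr_ge0.
rewrite -/r; move: h1 h2; rewrite !ltr_norml !ler_norml => /andP[? ?] /andP[? ?].
by split; apply/andP; split; lra.
Qed.

(** Second countability of the group makes the Borel sets of its dual those
    generated by evaluations at points. *)
Lemma bounded_closure_borel : @second_countable G ->
  forall S : set (borel (dual R G)), measurable S -> bounded_closure trigs (\1_S).
Proof.
move=> [B cB [oB bB]].
have nbB (x : G) (U : set G) : nbhs x U -> exists V, [/\ B V, V x & V `<=` U].
  by move=> /bB [V [BV Vx] VU]; exists V.
have [V0 [BV0 _ _]] := nbB 0 setT filterT.
have [b [Bb bsurj]] := countable_enumeration cB BV0.
have ob n : open (b n) by exact: oB.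
have hb (x : G) (U : set G) : nbhs x U -> exists n, b n x /\ b n `<=` U.
  by move=> /nbB[V [/bsurj[n <-] Vx VU]]; exists n.
have /choice[p hp] n : exists x : G, b n !=set0 -> b n x.
  have [[x bx]|h] := pselect (b n !=set0); first by exists x.
  by exists 0.
have sCS : sigma_algebra [set: dual R G] trig_sets := bc_indic_sigma (trig_algebra (eval_family R G)).
have MS (S : set trig_borel) : measurable S -> trig_sets S by apply: smallest_sub.
have SM (S : set trig_borel) : trig_sets S -> measurable S by exact: sub_sigma_algebra.
have Msub (f : dual R G -> R) c : trigs f -> measurable ([set x | f x <= c] : set trig_borel).
  by move=> tf; apply: SM; exact: (bc_sublevel (trig_algebra (eval_family R G)) _ (bc_base tf)).
have Msub2 (f : dual R G -> R) q r : trigs f ->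
    measurable ([set x | `|f x - q| <= r] : set trig_borel).
  move=> tf; rewrite (_ : [set x | _] = [set x | f x <= q + r] `&` [set x | -1 * f x <= r - q]).
    apply: measurableI; first exact: Msub.
    apply: Msub; have [t1 _ t3 _] := trig_algebra (eval_family R G).
    exact: t3 (t1 (-1)) tf.
  apply/seteqP; split => x /=; rewrite ler_norml.
    by move=> /andP[? ?]; split; lra.
  by move=> [? ?]; apply/andP; split; lra.
(* by continuity, a closed condition on a basic open set is tested on the
   countable dense set of the points p n *)
have Msquare t : measurable (square b t : set trig_borel).
  rewrite (_ : square b t = [set psi : trig_borel | forall m, [set m | b t.1 (p m)] m ->
      ([set psi : trig_borel | `|complex.Re (eval (p m) psi) - ratr t.2.1.1| <= t.2.2.+1%:R^-1] `&`
       [set psi : trig_borel | `|complex.Im (eval (p m) psi) - ratr t.2.1.2| <= t.2.2.+1%:R^-1]) psi]).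
    apply: measurable_countable_cap => m _.
    apply: measurableI.
      exact: (Msub2 _ _ _ (trig_Re (eval_family R G) (p m))).
    exact: (Msub2 _ _ _ (trig_Im (eval_family R G) (p m))).
  apply/seteqP; split => psi /=; first by move=> h m /h.
  move=> h y by_; set r := _^-1.
  suff near (e : R) : 0 < e -> exists m, b t.1 (p m) /\ csq (psi y - psi (p m)) < e ^+ 2.
    have sq (z e : R) : 0 < e -> z ^+ 2 < e ^+ 2 -> `|z| < e.
      by move=> e0; rewrite -(real_normK (num_real z)) ltr_pXn2r ?nnegrE// ltW.
    split; apply/ler_addgt0Pr => e e0; have [m [bm hm]] := near e e0;
      have [h1 h2] := h m bm.
      have : `|complex.Re (psi y) - complex.Re (psi (p m))| < e.
        by apply: sq => //; apply: le_lt_trans hm; rewrite /csq !cE lerDl sqr_ge0.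
      move: h1; rewrite !ltr_norml !ler_norml -/r => /andP[? ?] /andP[? ?].
      by apply/andP; split; lra.
    have : `|complex.Im (psi y) - complex.Im (psi (p m))| < e.
      by apply: sq => //; apply: le_lt_trans hm; rewrite /csq !cE lerDr sqr_ge0.
    move: h2; rewrite !ltr_norml !ler_norml -/r => /andP[? ?] /andP[? ?].
    by apply/andP; split; lra.
  move=> e0; have := dual_continuous_csq psi y (exprn_gt0 2 e0).
  have nby : nbhs y (b t.1) by exact: open_nbhs_nbhs.
  move=> /(filterI nby) /hb[m [bmy bmU]].
  have bpm : b m (p m) by apply: hp; exists y.
  by exists m; exact: bmU.
move=> S mS; apply: (@smallest_sub _ _ _ trig_sets sCS _ S mS) => {S mS} U oU.
apply: (MS U).
pose net (s : seq index) : set trig_borel := [set psi | forall t, t \in s -> square b t psi].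
have Mnet s : measurable (net s).
  apply: (measurable_countable_cap (P := fun t => square b t : set trig_borel)
    (D := [set t | t \in s])) => t _; exact: Msquare.
rewrite (_ : U = \bigcup_(s in [set: seq index]) (if `[< net s `<=` U >] then net s else set0)).
  apply: countable_bigcupT_measurable => [|s]; first exact: countableP.
  by case: asboolP.
apply/seteqP; split=> [chi Uchi|chi [s _]]; last by case: asboolP => // h /h.
have [K [e [cK e0 KU]]] := dual_nbhs_base (open_nbhs_nbhs (conj oU Uchi)).
(* two characters in the same square of half-side r differ by at most 2 r in each
   part, hence by at most 8 r ^+ 2 in squared modulus *)
have [k hk] : exists k, 8 * (k.+1%:R^-1 : R) ^+ 2 < e.
  have [N /(_ N (leqnn _)) hN] := inv_small (ltac:(by rewrite divr_gt0// lt_min e0 ltr01) :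
    0 < Num.min e 1 / 8).
  exists N; move: hN; set x := _^-1 => hN.
  have x0 : 0 < x by rewrite invr_gt0.
  have xe : x < e / 8 by apply: lt_le_trans hN _; rewrite ler_pM2r// ge_min lexx.
  have x1 : x < 1 / 8 by apply: lt_le_trans hN _; rewrite ler_pM2r// ge_min lexx orbT.
  have : x ^+ 2 <= x * 1 by rewrite expr2 ler_pM2l//; lra.
  lra.
have [D DD KD] : finite_subset_cover [set t : index | square b t chi /\ t.2.2 = k]
    (fun t => b t.1) K.
  apply: (compact_zmodule_cover cK) => [t _|x Kx]; first exact: ob.
  have [t [bt st tk]] := square_cover chi k ob (hb x).
  by exists t.
exists (finmap.enum_fset D) => //.
have chiD : net (finmap.enum_fset D) chi.
  by move=> t tD; have := DD t tD; rewrite inE => -[].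
rewrite asboolT// => psi hpsi; apply: KU => x Kx.
have [t /= tD bt] := KD x Kx.
have [c1 c2] := chiD t tD x bt; have [p1 p2] := hpsi t tD x bt.
have tk : t.2.2 = k by have := DD t tD; rewrite inE => -[].
rewrite tk in c1 c2 p1 p2.
apply: le_lt_trans hk; move: c1 c2 p1 p2; set r := _^-1.
rewrite !ler_norml => /andP[? ?] /andP[? ?] /andP[? ?] /andP[? ?].
have sq (z : R) : `|z| <= 2 * r -> z ^+ 2 <= 4 * r ^+ 2.
  rewrite -(real_normK (num_real z)) => zr.
  by rewrite (_ : 4 * r ^+ 2 = (2 * r) ^+ 2) ?ler_pXn2r ?nnegrE ?(le_trans _ zr)//; ring.
rewrite /csq !cE (_ : 8 * r ^+ 2 = 4 * r ^+ 2 + 4 * r ^+ 2); last by ring.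
by apply: lerD; apply: sq; rewrite ler_norml; apply/andP; split; lra.
Qed.

End dual_borel_structure.

(** * Brackets *)

Section almost_everywhere.
Context {R : realType} {d : measure_display} {T : measurableType d}.
Variable mu : {measure set T -> \bar R}.

Lemma ae_forall_countable (S : countType) (P : S -> T -> Prop) :
  (forall s, {ae mu, forall x, P s x}) -> {ae mu, forall x, forall s, P s x}.
Proof.
move=> hP.
have : {ae mu, forall x, forall n, if unpickle n is Some s then P s x else True}.
  by apply: ae_foralln => n; case: unpickle => [s|]; [exact: hP|exact: aeW].
by apply: filterS => x h s; have := h (pickle s); rewrite pickleK.
Qed.

(** A quadratic that is nonnegative at rational points has nonpositive
    discriminant: a rational number separates two distinct real roots. *)
Lemma quadratic_rat (a b c : R) : 0 <= a ->
  (forall q : rat, 0 <= ratr q ^+ 2 * a + 2 * ratr q * b + c) -> b ^+ 2 <= a * c.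
Proof.
rewrite le_eqVlt => /predU1P[<-|a0] h.
  have [->|b0] := eqVneq b 0; first by rewrite mul0r expr0n.
  exfalso; pose r := - c / (2 * b).
  have [bp|bn] := ltP 0 b.
    have [q] := @rat_in_itvoo R (r - 1) r ltac:(lra).
    rewrite in_itv /= => /andP[_]; rewrite /r ltr_pdivlMr ?mulr_gt0// => hq.
    have := h q; rewrite mulr0 add0r; lra.
  have {bn}bn : b < 0 by rewrite lt_neqAle b0.
  have [q] := @rat_in_itvoo R r (r + 1) ltac:(lra).
  rewrite in_itv /= => /andP[+ _]; rewrite /r ltr_ndivrMr; last by lra.
  by move=> hq; have := h q; rewrite mulr0 add0r; lra.
rewrite leNgt; apply/negP => hD.
have D0 : 0 < b ^+ 2 - a * c by lra.
set D := b ^+ 2 - a * c in D0; have s0 : 0 < Num.sqrt D by rewrite sqrtr_gt0.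
have [q] := @rat_in_itvoo R ((- b - Num.sqrt D) / a) ((- b + Num.sqrt D) / a)
  ltac:(by rewrite ltr_pM2r ?invr_gt0//; lra).
rewrite in_itv /= ltr_pdivrMr// ltr_pdivlMr// => /andP[h1 h2].
have qD : (ratr q * a + b) ^+ 2 < D.
  rewrite -(sqr_sqrtr (ltW D0)) -(real_normK (num_real (_ + b))).
  rewrite ltr_pXn2r ?nnegrE ?sqrtr_ge0 ?normr_ge0//.
  by rewrite ltr_norml; apply/andP; split; lra.
have := mulr_ge0 (ltW a0) (h q).
have -> : a * (ratr q ^+ 2 * a + 2 * ratr q * b + c) = (ratr q * a + b) ^+ 2 - D.
  by rewrite /D; ring.
by rewrite subr_ge0 leNgt qD.
Qed.

End almost_everywhere.

(** A unitary representation together with a bracket. Of the dual group only its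
    measure space and the characters e x on it matter, so T is abstract. *)
Definition bracket_system {R : realType} {d : measure_display}
    {T : measurableType d} (mu : {measure set T -> \bar R}) (G : zmodType)
    (e : G -> T -> R[i]) (H : hilbertType R) (rep : G -> {linear H -> H})
    (br : H -> H -> T -> R[i]) : Prop :=
  [/\ character_family e,
      forall S, measurable S -> bounded_closure (trig e) (\1_S),
      forall x u v, '[rep x u, rep x v] = '[u, v],
      forall x y u, rep (x + y) u = rep x (rep y u)
    & forall u v, cintegrable mu (br u v) /\
        forall x, '[u, rep x v] = cintegral mu (fun a => br u v a * (e x a)^*)].

Section brackets.
Context {R : realType} {d : measure_display} {T : measurableType d}.
Variables (mu : {measure set T -> \bar R}) (G : zmodType) (e : G -> T -> R[i]).
Variables (H : hilbertType R) (rep : G -> {linear H -> H}) (br : H -> H -> T -> R[i]).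
Hypothesis hs : bracket_system mu e rep br.
Implicit Types (u v w : H).

Let he : character_family e. Proof. by case: hs. Qed.
Let generated S : measurable S -> bounded_closure (trig e) (\1_S).
Proof. by case: hs => _ h _ _ _; exact: h. Qed.

Lemma rep_inner x u v : '[rep x u, rep x v] = '[u, v].
Proof. by case: hs. Qed.

Lemma repD x y u : rep (x + y) u = rep x (rep y u).
Proof. by case: hs. Qed.

Let hbr u v : cintegrable mu (br u v) /\
  forall x, '[u, rep x v] = cintegral mu (fun a => br u v a * (e x a)^*).
Proof. by case: hs => _ _ _ _ h; exact: h. Qed.

Lemma rep0 u : rep 0 u = u.
Proof.
apply/eqP; rewrite -subr_eq0; apply/eqP/nsq_eq0.
by rewrite /nsq -(rep_inner 0) linearB/= -repD addr0 subrr inner0l.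
Qed.

Lemma rep_adj x u v : '[rep x u, v] = '[u, rep (- x) v].
Proof. by rewrite -(rep_inner (- x)) -repD addNr rep0. Qed.

Lemma br_int u v : cintegrable mu (br u v).
Proof. exact: (hbr u v).1. Qed.

Lemma br_fourier u v x :
  '[u, rep x v] = cintegral mu (fun a => br u v a * (e x a)^*).
Proof. exact: (hbr u v).2. Qed.

(** All almost-everywhere identities between brackets come from this: both sides
    have the same Fourier transform. *)
Lemma br_unique u v h : cintegrable mu h ->
  (forall x, '[u, rep x v] = cintegral mu (fun a => h a * (e x a)^*)) ->
  {ae mu, forall a, br u v a = h a}.
Proof.
move=> ih hh.
have ihN : cintegrable mu (fun a => -1 * h a) by exact: cintegrableZ.
have : {ae mu, forall a, br u v a + -1 * h a = 0}.
  apply: (fourier_uniqueness he generated) => [|x].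
    by apply: cintegrableD => //; exact: br_int.
  rewrite (_ : (fun a => _) = (fun a => br u v a * (e x a)^* + -1 * (h a * (e x a)^*))).
    have i1 := char_conj_cintegrable he x (br_int u v).
    have i2 := char_conj_cintegrable he x ih.
    rewrite cintegralD ?cintegralZ//; last exact: cintegrableZ.
    by rewrite -br_fourier hh mulN1r subrr.
  by apply/funext => a; rewrite mulrDl mulrA.
by apply: filterS => a; rewrite mulN1r => /eqP; rewrite subr_eq0 => /eqP.
Qed.

Lemma br_linear_l (k : R[i]) u v w :
  {ae mu, forall a, br (k *: u + v) w a = k * br u w a + br v w a}.
Proof.
have iZ : cintegrable mu (fun a => k * br u w a) by apply: cintegrableZ; exact: br_int.
apply: br_unique => [|x]; first by apply: cintegrableD => //; exact: br_int.
rewrite (_ : (fun a => _) = (fun a => k * (br u w a * (e x a)^*) + br v w a * (e x a)^*)).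
  have i1 := char_conj_cintegrable he x (br_int u w).
  have i2 := char_conj_cintegrable he x (br_int v w).
  rewrite cintegralD ?cintegralZ//; last exact: cintegrableZ.
  by rewrite -!br_fourier innerDl innerZl.
by apply/funext => a; rewrite mulrDl mulrA.
Qed.

Lemma br_conj u v : {ae mu, forall a, br v u a = (br u v a)^*}.
Proof.
apply: br_unique => [|x]; first by apply: cintegrable_conj; exact: br_int.
rewrite (_ : (fun a => _) = (fun a => (br u v a * (e (- x) a)^*)^*)).
  rewrite cintegral_conj; last by apply: char_conj_cintegrable => //; exact: br_int.
  by rewrite -br_fourier -rep_adj -innerC.
by apply/funext => a; rewrite conjM conjCK (charN he).
Qed.

Lemma br_linear_r (k : R[i]) u v w :
  {ae mu, forall a, br w (k *: u + v) a = k^* * br w u a + br w v a}.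
Proof.
apply: filterS3 (br_conj (k *: u + v) w) (br_linear_l k u v w)
  (filterI (br_conj u w) (br_conj v w)) => a -> -> [-> ->].
by rewrite conjD conjM.
Qed.

Lemma br_rep x u v : {ae mu, forall a, br (rep x u) v a = e x a * br u v a}.
Proof.
apply: br_unique => [|y].
  have := char_cintegrable he x (br_int u v); congr cintegrable.
  by apply/funext => a; rewrite mulrC.
rewrite rep_adj -repD.
rewrite br_fourier; congr cintegral; apply/funext => a.
have [eD _ _] := he.
by rewrite eD conjM (charN he) conjCK mulrA (mulrC (e x a)).
Qed.

Lemma br_rep2 x y u v :
  {ae mu, forall a, br (rep x u) (rep y v) a = e x a * (e y a)^* * br u v a}.
Proof.
apply: filterS3 (br_rep x u (rep y v)) (br_conj (rep y v) u)
  (filterI (br_rep y v u) (br_conj u v)) => a -> -> [-> h].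
by rewrite conjM h conjCK mulrA.
Qed.

Lemma br_eq0 u v : (forall x, '[u, rep x v] = 0) -> {ae mu, forall a, br u v a = 0}.
Proof.
move=> h; apply: br_unique => [|x]; first exact: cintegrable0.
by under eq_fun do rewrite mul0r; rewrite cintegral0 h.
Qed.

Definition brn u a : R := complex.Re (br u u a).

Lemma brn_int u : mu.-integrable [set: T] (EFin \o brn u).
Proof. exact: (br_int u u).1. Qed.

Lemma brn_integral u : \int[mu]_a brn u a = nsq u.
Proof.
rewrite (_ : nsq u = complex.Re '[u, rep 0 u]); last by rewrite rep0.
rewrite br_fourier /=; apply: eq_Rintegral => a _.
by rewrite (char0 he) conjC1 mulr1.
Qed.

(** The integral of the bracket against the squared modulus of a trigonometric
    polynomial is the squared norm of a combination of translates of u. *)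
Lemma brn_ge0 u : {ae mu, forall a, 0 <= brn u a}.
Proof.
apply: (fourier_positivity he generated (br_int u u)) => s.
have lin (s' : seq (R[i] * G)) (F : R[i] * G -> H) v :
    '[\sum_(t <- s') F t, v] = \sum_(t <- s') '[F t, v].
  by elim: s' => [|t s' IH]; rewrite ?big_nil ?inner0l// !big_cons innerDl IH.
have linr (s' : seq (R[i] * G)) (F : R[i] * G -> H) v :
    '[v, \sum_(t <- s') F t] = \sum_(t <- s') '[v, F t].
  by elim: s' => [|t s' IH]; rewrite ?big_nil ?inner0r// !big_cons innerDr IH.
suff -> : cintegral mu (fun a => br u u a *
     ((\sum_(t <- s) t.1 * e t.2 a) * (\sum_(t <- s) t.1 * e t.2 a)^*)) =
  '[\sum_(t <- s) t.1 *: rep t.2 u, \sum_(t <- s) t.1 *: rep t.2 u].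
  exact: nsq_ge0.
have [eD _ _] := he.
rewrite (_ : (fun a => _) = (fun a => \sum_(t <- s) \sum_(r <- s)
    t.1 * r.1^* * (br u u a * (e (r.2 - t.2) a)^*))).
  have ii (t r : R[i] * G) : cintegrable mu (fun a =>
      t.1 * r.1^* * (br u u a * (e (r.2 - t.2) a)^*)).
    by apply: cintegrableZ; apply: char_conj_cintegrable => //; exact: br_int.
  rewrite cintegral_sum => [|t]; last by apply: cintegrable_sum => r.
  rewrite lin; apply: eq_bigr => t _; rewrite cintegral_sum => [|r]; last exact: ii.
  rewrite linr; apply: eq_bigr => r _; rewrite cintegralZ; last first.
    by apply: char_conj_cintegrable => //; exact: br_int.
  by rewrite -br_fourier innerZl innerZr rep_adj -repD addrC mulrA.
apply/funext => a; rewrite (rmorph_sum Num.conj)/= big_distrlr/= big_distrr/=.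
apply: eq_bigr => t _; rewrite big_distrr/=; apply: eq_bigr => r _.
rewrite !conjM eD (charN he) conjM conjCK; ring.
Qed.

Lemma brnE u : {ae mu, forall a, br u u a = (brn u a)%:C%C}.
Proof.
apply: filterS (br_conj u u) => a h; apply: complex_ext => //=.
by have := congr1 (@complex.Im R) h; rewrite Im_conj; lra.
Qed.

Lemma brnL (k : R[i]) u v : {ae mu, forall a, brn (k *: u + v) a =
  csq k * brn u a + brn v a + 2 * complex.Re (k * br u v a)}.
Proof.
apply: filterS3 (br_linear_l k u v (k *: u + v)) (br_linear_r k u v u)
  (filterI (br_linear_r k u v v) (filterI (br_conj u v) (brnE u)))
  => a h1 h2 [h3 [h4 h5]].
rewrite /brn h1 h2 h3 h4 mulrDr mulrA -csqE h5 !cE /=; ring.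
Qed.

Lemma brnD u v : {ae mu, forall a, brn (u + v) a =
  brn u a + brn v a + 2 * complex.Re (br u v a)}.
Proof.
by have := brnL 1 u v; rewrite scale1r; apply: filterS => a ->;
  rewrite mul1r (csq_real 1) expr1n mul1r.
Qed.

(** Off one null set the bracket is nonnegative on all rational combinations of u
    and v. *)
Lemma br_cauchy_schwarz u v :
  {ae mu, forall a, complex.Re (br u v a) ^+ 2 <= brn u a * brn v a}.
Proof.
have h : {ae mu, forall a, forall q : rat,
    0 <= ratr q ^+ 2 * brn u a + 2 * ratr q * complex.Re (br u v a) + brn v a}.
  apply: ae_forall_countable => q.
  apply: filterS2 (brnL (ratr q)%:C%C u v) (brn_ge0 ((ratr q)%:C%C *: u + v)) => a -> h.
  apply: le_trans h _; rewrite csq_real !cE /=; lra.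
by apply: filterS2 h (brn_ge0 u) => a h u0; exact: quadratic_rat.
Qed.

Lemma br_scale (k : R[i]) u v : {ae mu, forall a, br (k *: u) v a = k * br u v a}.
Proof.
have h0 : {ae mu, forall a, br 0 v a = 0}.
  by apply: br_eq0 => x; rewrite inner0l.
have := br_linear_l k u 0 v; rewrite addr0 => h.
by apply: filterS2 h h0 => a -> ->; rewrite addr0.
Qed.

Lemma brn_scale (k : R[i]) u : {ae mu, forall a, brn (k *: u) a = csq k * brn u a}.
Proof.
apply: filterS3 (br_scale k u (k *: u)) (br_conj (k *: u) u)
  (filterI (br_scale k u u) (brnE u)) => a h1 h2 [h3 h4].
rewrite /brn h1 h2 h3 h4 conjM mulrA -csqE conj_real !cE /=; ring.
Qed.

Lemma br_csq_le u v :
  {ae mu, forall a, csq (br u v a) <= 2 * (brn u a * brn v a)}.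
Proof.
apply: filterS3 (br_cauchy_schwarz u v) (br_cauchy_schwarz ('i%C *: u) v)
  (filterI (br_scale 'i%C u v) (brn_scale 'i%C u)) => a h1 + [h3 h4].
rewrite h3 h4 !cE /= /csq /=; rewrite expr0n /= add0r expr1n mul1r mul0r mul1r add0r sqrrN => h2.
lra.
Qed.

End brackets.

(** * Fibers and the pointwise Parseval identity *)

Section fibers.
Context {R : realType} {d : measure_display} {T : measurableType d}.
Variables (mu : {measure set T -> \bar R}) (G : zmodType) (e : G -> T -> R[i]).
Variables (H : hilbertType R) (rep : G -> {linear H -> H}) (br : H -> H -> T -> R[i]).
Hypothesis hs : bracket_system mu e rep br.
Variables (I : countType) (theta : I -> H).
Implicit Types (u v w phi : H) (a : T).

Definition generators : set H := [set v | exists x i, v = rep x (theta i)].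

(** The coordinates of T phi, with the weight written so that measurability holds
    everywhere and the value 0 is taken where the generator vanishes. *)
Definition coord phi a : I -> R[i]^o :=
  fun i => br phi (theta i) a * (rsqrt (brn br (theta i) a))%:C%C.

(** The default value 0 is taken on the null set where coord is not in l2. *)
Definition fib phi a : l2 R I := insubd (0 : l2 R I) (coord phi a).

Definition coord_l2 phi a : Prop := coord phi a \in @square_summable R I.

Lemma fibE phi a : coord_l2 phi a -> l2val (fib phi a) = coord phi a.
Proof. by move=> h; rewrite /fib (insubdK (0 : l2 R I) h). Qed.

Lemma coord_l2_linear (k : R[i]) u v a : coord_l2 u a -> coord_l2 v a ->
  (forall i, coord (k *: u + v) a i = k * coord u a i + coord v a i) ->
  coord_l2 (k *: u + v) a /\ fib (k *: u + v) a = k *: fib u a + fib v a.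
Proof.
move=> gu gv h.
have E : l2val (k *: fib u a + fib v a) = coord (k *: u + v) a.
  by apply/funext => i; rewrite h -!fibE.
have gk : coord_l2 (k *: u + v) a by rewrite /coord_l2 -E; exact: l2valP.
by split=> //; apply: val_inj; exact: etrans (fibE gk) (esym E).
Qed.

Lemma coord_linear (k : R[i]) u v : {ae mu, forall a, forall i,
  coord (k *: u + v) a i = k * coord u a i + coord v a i}.
Proof.
apply: ae_forall_countable => i; apply: filterS (br_linear_l hs k u v (theta i)) => a h.
by rewrite /coord h mulrDl mulrA.
Qed.

Lemma rsqrt_sq (w : R) : w * rsqrt w ^+ 2 <= 1.
Proof.
rewrite /rsqrt; have [w0|w0] := ltP 0 w.
  by rewrite exprVn (sqr_sqrtr (ltW w0)) divff ?gt_eqF.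
by rewrite ler0_sqrtr// invr0 expr0n mulr0.
Qed.

Lemma mul_rsqrt (w : R) : 0 <= w -> w * rsqrt w = Num.sqrt w.
Proof.
rewrite le_eqVlt => /predU1P[<-|w0]; first by rewrite mul0r sqrtr0.
rewrite /rsqrt -{1}(sqr_sqrtr (ltW w0)) expr2 mulfK//.
by rewrite gt_eqF// sqrtr_gt0.
Qed.

Lemma coord_measurable phi i : cmeasurable (fun a => coord phi a i).
Proof.
apply: cmeasurableM; first exact: (cintegrable_meas (br_int hs phi (theta i))).
apply/cmeasurable_real/measurable_rsqrt.
exact: (integrable_meas (brn_int hs (theta i))).
Qed.

Lemma coord_l2_measurable phi : measurable [set a | coord_l2 phi a].
Proof.
rewrite (_ : [set a | _] = \bigcup_n
    [set a | forall s, uniq s -> \sum_(i <- s) csq (coord phi a i) <= n%:R]).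
  apply: bigcupT_measurable => n; apply: measurable_sum_le => i.
  exact: coord_measurable.
apply/seteqP; split=> a /=.
  move=> /square_summableP[c hc]; exists (Num.bound `|c|) => // s /hc h.
  apply: le_trans h _; apply: le_trans (ler_norm c) _.
  by apply/ltW; exact: archi_boundP.
by move=> [n _ h]; apply/square_summableP; exists n%:R.
Qed.

Lemma fib_measurable phi i : cmeasurable (fun a => fib phi a i).
Proof.
rewrite (_ : (fun a => _) = (fun a => coord phi a i *
    ((\1_[set a | coord_l2 phi a] a : R))%:C%C)).
  apply: cmeasurableM; first exact: coord_measurable.
  by apply: cmeasurable_real; apply: measurable_indic; exact: coord_l2_measurable.
apply/funext => a; rewrite indicE; have [g|g] := pselect (coord_l2 phi a).
  by rewrite mem_set// mulr1 fibE.
rewrite memNset// mulr0 /fib /insubd insubF//.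
exact/negP.
Qed.

Lemma coord_bound u s : {ae mu, forall a,
  \sum_(i <- s) csq (coord u a i) <= 2 * (size s)%:R * brn br u a}.
Proof.
have h : {ae mu, forall a, forall i, csq (br u (theta i) a) <= 2 * (brn br u a * brn br (theta i) a)}.
  by apply: ae_forall_countable => i; exact: br_csq_le hs _ _.
apply: filterS2 h (brn_ge0 hs u) => a h u0.
elim: s => [|i s IH]; first by rewrite big_nil mulr0 mul0r.
rewrite big_cons /= -[(size s).+1%:R]natr1 mulrDr mulrDl addrC lerD// mulr1.
rewrite /coord csqM csq_real.
apply: (@le_trans _ _ (2 * (brn br u a * brn br (theta i) a) * rsqrt (brn br (theta i) a) ^+ 2)).
  by rewrite ler_wpM2r ?sqr_ge0.
rewrite -!mulrA ler_wpM2l// -[leRHS]mulr1 ler_wpM2l//.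
exact: rsqrt_sq.
Qed.

Hypothesis horth : forall i j, i <> j -> forall x, '[theta i, rep x (theta j)] = 0.
Hypothesis hdense : forall phi, closed_span generators phi.

Lemma fib_generator x i : {ae mu, forall a, coord_l2 (rep x (theta i)) a /\
  fib (rep x (theta i)) a =
    (e x a * (Num.sqrt (brn br (theta i) a))%:C%C) *: l2delta R i}.
Proof.
have h : {ae mu, forall a, forall j, i <> j -> br (theta i) (theta j) a = 0}.
  apply: ae_forall_countable => j; have [->|ij] := eqVneq i j; first exact: aeW.
  by apply: filterS (br_eq0 hs (horth (elimN eqP ij))) => a ->.
have h2 : {ae mu, forall a, forall j, br (rep x (theta i)) (theta j) a = e x a * br (theta i) (theta j) a}.
  by apply: ae_forall_countable => j; exact: br_rep hs _ _ _.
apply: filterS3 h h2 (filterI (brnE hs (theta i)) (brn_ge0 hs (theta i))) => a h1 h2' [h3 h4].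
have E : coord (rep x (theta i)) a =
    l2val ((e x a * (Num.sqrt (brn br (theta i) a))%:C%C) *: l2delta R i).
  apply/funext => j; rewrite /coord h2' l2Z l2deltaE.
  have [->|ji] := eqVneq j i.
    by rewrite mulr1 h3 -mulrA -rmorphM/= mul_rsqrt.
  by rewrite h1 ?mulr0 ?mul0r//; apply/eqP; rewrite eq_sym.
have g : coord_l2 (rep x (theta i)) a by rewrite /coord_l2 E; exact: l2valP.
by split=> //; apply: val_inj; exact: etrans (fibE g) E.
Qed.

Lemma fib_zero : {ae mu, forall a, coord_l2 0 a /\ fib 0 a = 0}.
Proof.
have := coord_linear (-1) 0 0 => /=; apply: filterS => a h.
have E : coord 0 a = l2val (0 : l2 R I).
  by apply/funext => i; have := h i; rewrite scaler0 addr0 mulN1r addNr => ->.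
have g : coord_l2 0 a by rewrite /coord_l2 E; exact: l2valP.
by split=> //; apply: val_inj; exact: etrans (fibE g) E.
Qed.

Lemma fib_linear_l2 (k : R[i]) u v : {ae mu, forall a, coord_l2 u a} ->
  {ae mu, forall a, coord_l2 v a} ->
  {ae mu, forall a, coord_l2 (k *: u + v) a /\
    fib (k *: u + v) a = k *: fib u a + fib v a}.
Proof.
move=> gu gv; apply: filterS3 gu gv (coord_linear k u v) => a ? ?.
exact: coord_l2_linear.
Qed.

Let D : set H := linspan generators.

Let parseval u v := {ae mu, forall a, coord_l2 u a} /\
  {ae mu, forall a, '[fib u a, fib v a] = br u v a}.

Let parseval_linear_l (k : R[i]) u v w : parseval u w -> parseval v w ->
  parseval (k *: u + v) w.
Proof.
move=> [gu pu] [gv pv]; have gl := fib_linear_l2 k gu gv; split.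
  by apply: filterS gl => a [].
apply: filterS3 gl (br_linear_l hs k u v w) (filterI pu pv) => a [_ ->] -> [p1 p2].
by rewrite innerDl innerZl p1 p2.
Qed.

Let parseval_sym u v : {ae mu, forall a, coord_l2 v a} -> parseval u v -> parseval v u.
Proof.
move=> gv [_ p]; split=> //; apply: filterS2 p (br_conj hs u v) => a <- ->.
exact: innerC.
Qed.

Let parseval_zero w : parseval 0 w.
Proof.
split; first by apply: filterS fib_zero => a [].
have h0 : {ae mu, forall a, br 0 w a = 0}.
  by apply: (br_eq0 hs) => x; rewrite inner0l.
by apply: filterS2 fib_zero h0 => a [_ ->] ->; rewrite inner0l.
Qed.

Let parseval_span w : (forall u, generators u -> parseval u w) ->
  forall u, D u -> parseval u w.
Proof.
move=> h u Du; apply: (linspan_min (M := [set u | parseval u w])) Du.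
- exact: h.
- exact: parseval_zero.
- by move=> k u1 v1; exact: parseval_linear_l.
Qed.

Let parseval_generators u v : generators u -> generators v -> parseval u v.
Proof.
move=> [x [i ->]] [y [j ->]]; split.
  by apply: filterS (fib_generator x i) => a [].
have hij : {ae mu, forall a, br (theta i) (theta j) a =
    (Num.sqrt (brn br (theta i) a) * Num.sqrt (brn br (theta j) a))%:C%C * (j == i)%:R}.
  have [<-|ij] := eqVneq i j.
    apply: filterS2 (brnE hs (theta i)) (brn_ge0 hs (theta i)) => a -> w0.
    by rewrite mulr1 -expr2 sqr_sqrtr.
  by apply: filterS (br_eq0 hs (horth (elimN eqP ij))) => a ->; rewrite mulr0.
apply: filterS3 (filterI (fib_generator x i) (fib_generator y j)) hij
  (br_rep2 hs x y (theta i) (theta j)) => a [[_ ->] [_ ->]] h ->.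
rewrite innerZl innerZr inner_delta l2deltaE h conjM conj_real rmorphM/=; ring.
Qed.

Let parseval_D u v : D u -> D v -> parseval u v.
Proof.
move=> Du Dv; apply: parseval_span Du => u' gu'.
have gg : {ae mu, forall a, coord_l2 u' a} by have [] := parseval_generators gu' gu'.
apply: parseval_sym => //; apply: parseval_span Dv => v' gv'.
exact: parseval_generators.
Qed.

(** Convergence in norm makes the integrals of brn br (phi - phi_ n) tend to 0. *)
Lemma closure_ae_approx (A : set H) phi : closure A phi ->
  exists phi_ : nat -> H, (forall n, A (phi_ n)) /\
    {ae mu, forall a, forall eps : R, 0 < eps -> exists n, brn br (phi - phi_ n) a < eps}.
Proof.
move=> /closure_nsqP cA.
have /choice[phi_ hphi] n : exists v, A v /\ nsq (phi - v) < n.+1%:R^-1.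
  by have [|v Av h] := cA n.+1%:R^-1; [rewrite invr_gt0|exists v].
exists phi_; split=> [n|]; first exact: (hphi n).1.
apply: ae_small => [n|n|eps e0].
- exact: brn_int hs _.
- exact: brn_ge0 hs _.
- have [N /(_ N (leqnn _)) hN] := inv_small e0; exists N.
  by rewrite (brn_integral hs) (lt_trans (hphi N).2).
Qed.

Let csqD_eta (eta : R) (z w : R[i]) : 0 < eta ->
  csq (z + w) <= (1 + eta) * csq z + (1 + eta^-1) * csq w.
Proof.
move=> e0; rewrite -subr_ge0.
have -> : (1 + eta) * csq z + (1 + eta^-1) * csq w - csq (z + w) =
    eta * ((complex.Re z - eta^-1 * complex.Re w) ^+ 2 +
           (complex.Im z - eta^-1 * complex.Im w) ^+ 2).
  by rewrite /csq !cE; field; rewrite gt_eqF.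
by rewrite mulr_ge0 ?addr_ge0 ?sqr_ge0// ltW.
Qed.

Let eta_limit (x b : R) : 0 <= b -> (forall eta, 0 < eta -> x <= (1 + eta) * b) -> x <= b.
Proof.
move=> b0 h; apply/ler_addgt0Pr => eps e0.
have d0 : 0 < eps / (b + 1) by rewrite divr_gt0// ltr_wpDl.
apply: le_trans (h _ d0) _; rewrite mulrDl mul1r lerD2l.
by rewrite mulrAC ler_pdivrMr ?ltr_wpDl// ler_pM2l// lerDl.
Qed.

(** Equality holds on the span of the generators by bilinearity. It passes to the
    closure as an inequality: for some n, finitely many coordinates of
    phi - phi_ n and its bracket norm are small, and the cross terms cost a factor
    that tends to 1 as eta tends to 0. *)
Lemma bessel phi : {ae mu, forall a, forall s, uniq s ->
  \sum_(i <- s) csq (coord phi a i) <= brn br phi a}.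
Proof.
have [phi_ [Dphi small]] := closure_ae_approx (@hdense phi).
have hn : {ae mu, forall a, forall n,
    [/\ coord_l2 (phi_ n) a, '[fib (phi_ n) a, fib (phi_ n) a] = br (phi_ n) (phi_ n) a,
        forall i, coord phi a i = coord (phi - phi_ n) a i + coord (phi_ n) a i &
        brn br (phi_ n) a = brn br (phi - phi_ n) a + brn br phi a +
          2 * complex.Re ((-1) * br (phi - phi_ n) phi a)] /\
    [/\ 0 <= brn br (phi - phi_ n) a,
        complex.Re (br (phi - phi_ n) phi a) ^+ 2 <= brn br (phi - phi_ n) a * brn br phi a &
        forall s : seq I, \sum_(i <- s) csq (coord (phi - phi_ n) a i) <=
          2 * (size s)%:R * brn br (phi - phi_ n) a]}.
  apply: ae_foralln => n.
  have [g p] := parseval_D (Dphi n) (Dphi n).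
  have c := coord_linear 1 (phi - phi_ n) (phi_ n).
  have b := brnL hs (-1) (phi - phi_ n) phi.
  rewrite scale1r subrK in c.
  rewrite scaleN1r opprB subrK in b.
  have cb : {ae mu, forall a, forall s : seq I, \sum_(i <- s) csq (coord (phi - phi_ n) a i) <=
      2 * (size s)%:R * brn br (phi - phi_ n) a}.
    by apply: ae_forall_countable => s; exact: coord_bound.
  apply: filterS3 (filterI g p) (filterI c b)
    (filterI (brn_ge0 hs (phi - phi_ n)) (filterI (br_cauchy_schwarz hs (phi - phi_ n) phi) cb))
    => a [? ?] [hc hb] [? [? ?]].
  split; split=> //; first by move=> i; rewrite hc mul1r.
  rewrite hb; congr (_ + _ + _).
  by rewrite (_ : csq (-1 : R[i]) = 1) ?mul1r// /csq /= oppr0 expr0n /= addr0 sqrrN expr1n.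
apply: filterS3 hn small (brn_ge0 hs phi) => a h sm B0 s us.
set S := \sum_(i <- s) _; set B := brn br phi a in B0 *.
have key : forall eta', 0 < eta' -> S <= (1 + eta') * ((1 + eta') * B) .
  move=> t t0; apply/ler_addgt0Pr => ep ep0.
  pose K := (1 + t) * (1 + t^-1) + (1 + t^-1) * (2 * (size s)%:R) + 1.
  have ti : 0 < t^-1 by rewrite invr_gt0.
  have K0 : 0 < K.
    by rewrite /K ltr_wpDl// addr_ge0// mulr_ge0 ?addr_ge0 ?ler0n// ltW.
  have [n en] := sm (ep / K) (divr_gt0 ep0 K0).
  have [[g p cd bn] [e0 cs cb]] := h n.
  set E := brn br (phi - phi_ n) a in en bn e0 cs cb *.
  have S1 : S <= (1 + t) * \sum_(i <- s) csq (coord (phi_ n) a i) +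
      (1 + t^-1) * \sum_(i <- s) csq (coord (phi - phi_ n) a i).
    rewrite !mulr_sumr -big_split /=; apply: ler_sum => i _.
    by rewrite cd [X in csq X]addrC; exact: csqD_eta.
  have S2 : \sum_(i <- s) csq (coord (phi_ n) a i) <= brn br (phi_ n) a.
    rewrite -fibE// /brn -p.
    exact: sum_csq_le.
  have S3 : brn br (phi_ n) a <= (1 + t) * B + (1 + t^-1) * E.
    rewrite bn !cE /=; set x := complex.Re (br _ _ _) in cs *.
    have : - (2 * x) <= t * B + t^-1 * E.
      have y0 : 0 <= t * B + t^-1 * E by rewrite addr_ge0// mulr_ge0// ltW.
      have : (2 * x) ^+ 2 <= (t * B + t^-1 * E) ^+ 2.
        apply: (@le_trans _ _ (4 * (E * B))); first by rewrite exprMn; lra.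
        rewrite -subr_ge0 (_ : _ - _ = (t * B - t^-1 * E) ^+ 2) ?sqr_ge0//.
        by field; rewrite gt_eqF.
      rewrite -(real_normK (num_real (2 * x))) ler_pXn2r ?nnegrE// => hx.
      by apply: le_trans hx; rewrite -normrN ler_norm.
    lra.
  have S4 := cb s.
  have KE : K * E <= ep by rewrite mulrC -ler_pdivlMr// ltW.
  have : (1 + t) * \sum_(i <- s) csq (coord (phi_ n) a i) <= (1 + t) * ((1 + t) * B + (1 + t^-1) * E).
    by apply: ler_wpM2l; [rewrite addr_ge0// ltW|exact: le_trans S2 S3].
  have : (1 + t^-1) * \sum_(i <- s) csq (coord (phi - phi_ n) a i) <=
      (1 + t^-1) * (2 * (size s)%:R * E).
    by apply: ler_wpM2l => //; rewrite addr_ge0// ltW.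
  have : K * E = (1 + t) * ((1 + t^-1) * E) + (1 + t^-1) * (2 * (size s)%:R * E) + E.
    by rewrite /K; ring.
  lra.
apply: eta_limit => // eta eta0; pose t := Num.min (eta / 3) 1.
have t0 : 0 < t by rewrite lt_min ltr01 divr_gt0.
apply: le_trans (key t t0) _; rewrite mulrA ler_wpM2r//.
have t1 : t <= 1 by rewrite ge_min lexx orbT.
have t3 : t <= eta / 3 by rewrite ge_min lexx.
have : t * t <= t * 1 by rewrite ler_wpM2l// ltW.
lra.
Qed.

Lemma coord_l2_ae phi : {ae mu, forall a, coord_l2 phi a}.
Proof.
by apply: filterS (bessel phi) => a h; apply/square_summableP; exists (brn br phi a).
Qed.

Lemma fib_linear (k : R[i]) u v :
  {ae mu, forall a, fib (k *: u + v) a = k *: fib u a + fib v a}.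
Proof. by apply: filterS (fib_linear_l2 k (coord_l2_ae u) (coord_l2_ae v)) => a []. Qed.

Lemma fib_norm_le phi : {ae mu, forall a, nsq (fib phi a) <= brn br phi a}.
Proof.
apply: filterS2 (bessel phi) (coord_l2_ae phi) => a h g.
by apply/nsq_leP => s us; rewrite fibE//; exact: h.
Qed.

(** The defect brn - nsq (fib _) is a nonnegative quadratic form vanishing on a
    dense subspace; the parallelogram law bounds it by twice its value on a
    small vector. *)
Lemma fib_norm phi : {ae mu, forall a, nsq (fib phi a) = brn br phi a}.
Proof.
have [phi_ [Dphi small]] := closure_ae_approx (@hdense phi).
have hn : {ae mu, forall a, forall n, brn br phi a - nsq (fib phi a) <=
    2 * brn br (phi - phi_ n) a}.
  apply: ae_foralln => n.
  have [_ p] := parseval_D (Dphi n) (Dphi n).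
  have E1 : 1 *: (phi - phi_ n) + phi_ n = phi by rewrite scale1r subrK.
  have l1 := fib_linear 1 (phi - phi_ n) (phi_ n).
  have b1 := brnL hs 1 (phi - phi_ n) (phi_ n).
  have l2 := fib_linear (-1) (phi_ n) (phi - phi_ n).
  have b2 := brnL hs (-1) (phi_ n) (phi - phi_ n).
  have nn := fib_norm_le (-1 *: phi_ n + (phi - phi_ n)).
  rewrite E1 in l1 b1.
  apply: filterS3 (filterI l1 b1) (filterI l2 b2) (filterI (filterI nn p) (br_conj hs (phi - phi_ n) (phi_ n))).
  move=> a [h1 h2] [h3 h4] [[h5 h6] h7].
  have := parallelogram (fib (phi - phi_ n) a) (fib (phi_ n) a).
  move: h5; rewrite h4 h3 h1 h2 scale1r scaleN1r h7 !cE /=.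
  have -> : nsq (fib (phi_ n) a) = brn br (phi_ n) a by rewrite /nsq h6.
  have -> : csq (-1 : R[i]) = 1 by rewrite /csq /= oppr0 expr0n /= addr0 sqrrN expr1n.
  have -> : csq (1 : R[i]) = 1 by rewrite /csq /= expr0n /= addr0 expr1n.
  rewrite (addrC (- fib (phi_ n) a)); have := nsq_ge0 (fib (phi - phi_ n) a).
  move: (nsq (fib (phi - phi_ n) a - fib (phi_ n) a)) => x1.
  move: (nsq (fib (phi - phi_ n) a + fib (phi_ n) a)) => x2.
  move: (nsq (fib (phi - phi_ n) a)) (brn br (phi - phi_ n) a) => x3 x4.
  move: (brn br (phi_ n) a) (complex.Re (br (phi - phi_ n) (phi_ n) a)) => x5 x6.
  by move: (complex.Im (br (phi - phi_ n) (phi_ n) a)) => x7; lra.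
apply: filterS3 hn small (fib_norm_le phi) => a h sm le; apply/eqP.
rewrite eq_le le /= -subr_le0; apply/ler_addgt0Pr => eps e0.
have [n hlt] := sm (eps / 2) ltac:(by rewrite divr_gt0).
by have := h n; lra.
Qed.

(** Polarization of fib_norm. *)
Theorem fib_inner u v : {ae mu, forall a, '[fib u a, fib v a] = br u v a}.
Proof.
have Re_eq w : {ae mu, forall a, complex.Re '[fib u a, fib w a] = complex.Re (br u w a)}.
  have l := fib_linear 1 u w; rewrite scale1r in l.
  apply: filterS3 (filterI l (brnD hs u w)) (filterI (fib_norm u) (fib_norm w))
    (fib_norm (u + w)) => a [h1 h2] [h3 h4]; rewrite h1 h2 scale1r nsqD h3 h4.
  by move=> /addrI; apply: mulfI; rewrite pnatr_eq0.
have l0 := fib_linear 'i%C v 0; rewrite addr0 in l0.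
apply: filterS3 (Re_eq v) (filterI (Re_eq ('i%C *: v)) (filterI l0 fib_zero))
  (filterI (br_conj hs ('i%C *: v) u) (filterI (br_scale hs 'i%C v u) (br_conj hs v u))).
move=> a h1 [h2 [h3 [_ h4]]] [h5 [h6 h7]]; apply: complex_ext => //.
move: h2; rewrite h3 h4 addr0 innerZr h5 h6 h7 !cE /=; lra.
Qed.

End fibers.

(** * Range functions and invariant subspaces *)

Section orthogonal_complements.
Variables (R : realType) (V : innerProductType R).
Implicit Types (u v w : V) (M : set V).

Lemma csq_inner_le u v : csq '[u, v] <= nsq u * nsq v.
Proof.
have := @dot_cauchy_schwarz _ V (@inner R V) u v.
by rewrite -csq_norm !innerE -rmorphM/= lecR.
Qed.

Lemma orthogonal_subspace u : closed_subspace [set w | '[u, w] = 0].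
Proof.
split=> /=; last by move=> a v w hv hw; rewrite innerDr innerZr hv hw mulr0 addr0.
  apply: closed_nsq => w hw /=; apply: csq_eq0; apply/eqP.
  rewrite eq_le csq_ge0 andbT; apply/ler_addgt0Pr => e e0; rewrite add0r.
  have u1 : 0 < nsq u + 1 by rewrite ltr_wpDl ?nsq_ge0.
  have [m /= um hm] := hw (e / (nsq u + 1)) (divr_gt0 e0 u1).
  rewrite -[w](subrK m) innerDr um addr0; apply: le_trans (csq_inner_le _ _) _.
  apply: (@le_trans _ _ ((nsq u + 1) * nsq (w - m))).
    by rewrite ler_wpM2r ?nsq_ge0// lerDl.
  by rewrite mulrC -ler_pdivlMr// ltW.
by rewrite /= inner0r.
Qed.

Lemma closed_span_orthogonal u (A : set V) : (forall v, A v -> '[u, v] = 0) ->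
  forall w, closed_span A w -> '[u, w] = 0.
Proof.
by move=> h w; apply: (closed_span_min (orthogonal_subspace u) _ (t := w)); exact: h.
Qed.

End orthogonal_complements.

Section l2_subspaces.
Variables (R : realType) (I : choiceType).
Implicit Types (J K : set (l2 R I)).

Lemma nsq_delta i : nsq (l2delta R i : l2 R I) = 1.
Proof. by rewrite /nsq inner_delta l2deltaE eqxx. Qed.

(** If r is orthogonal to K and P is the projection on J, the hypothesis says
    that P r vanishes on every basis vector. *)
Lemma subspace_of_projections J K : closed_subspace J -> closed_subspace K ->
  (forall i, K (orth_proj J (l2delta R i))) -> J `<=` K.
Proof.
move=> sJ sK hK u Ju; have cV := @l2_nsq_complete R I.
pose r := u - orth_proj K u.
have Kr : forall m, K m -> '[r, m] = 0 by exact: proj_orth.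
have Pr : orth_proj J r = 0.
  by apply: l2_ext => i; rewrite -inner_delta proj_adj// Kr.
have ru : '[r, u] = 0 by rewrite -(proj_id cV sJ Ju) -proj_adj// Pr inner0l.
have r0 : r = 0.
  apply: nsq_eq0; rewrite /nsq {2}/r innerDr innerNr ru Kr ?subr0//.
  exact: proj_in.
by move/eqP: r0; rewrite subr_eq0 => /eqP ->; exact: proj_in.
Qed.

End l2_subspaces.

Section range_functions.
Context {R : realType} {d : measure_display} {T : measurableType d}.
Variables (mu : {measure set T -> \bar R}) (G : zmodType) (e : G -> T -> R[i]).
Variables (H : hilbertType R) (rep : G -> {linear H -> H}) (br : H -> H -> T -> R[i]).
Hypothesis hs : bracket_system mu e rep br.
Variables (I : countType) (theta : I -> H).
Hypothesis horth : forall i j, i <> j -> forall x, '[theta i, rep x (theta j)] = 0.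
Hypothesis hdense : forall phi, closed_span (generators rep theta) phi.
Implicit Types (u v w phi : H) (a : T) (J K : T -> set (l2 R I)).

Local Notation fib := (fib br theta).
Local Notation coord_l2 := (coord_l2 br theta).

(** The transform turns translates into multiplication by characters. *)
Lemma fib_rep x u : {ae mu, forall a, fib (rep x u) a = e x a *: fib u a}.
Proof.
have h : {ae mu, forall a, forall i, br (rep x u) (theta i) a = e x a * br u (theta i) a}.
  by apply: ae_forall_countable => i; exact: br_rep hs _ _ _.
apply: filterS3 h (coord_l2_ae hs horth hdense u) (coord_l2_ae hs horth hdense (rep x u)).
move=> a h g1 g2; apply: l2_ext => i.
by rewrite l2Z !fibE// /coord h mulrA.
Qed.

Definition fibers_in J : set H := [set phi | {ae mu, forall a, J a (fib phi a)}].

Lemma fibers_in_subspace J : (forall a, closed_subspace (J a)) ->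
  closed_subspace (fibers_in J).
Proof.
move=> sJ; split.
- move=> phi /(closure_ae_approx hs)[phi_ [Jphi small]].
  have hn : {ae mu, forall a, forall n, J a (fib (phi_ n) a) /\
      nsq (fib phi a - fib (phi_ n) a) = brn br (phi - phi_ n) a}.
    apply: ae_foralln => n.
    have l := fib_linear hs horth hdense (-1) (phi_ n) phi.
    rewrite scaleN1r addrC in l.
    have nn := fib_norm hs horth hdense (phi - phi_ n).
    apply: filterS3 l nn (Jphi n) => a h <- Ja; split=> //.
    by rewrite h scaleN1r addrC.
  apply: filterS2 hn small => a h sm; have [cJ _ _] := sJ a.
  apply: closed_nsqP => // eps e0; have [n hlt] := sm eps e0.
  by have [Ja hh] := h n; exists (fib (phi_ n) a) => //; rewrite hh.
- by apply: filterS (fib_zero hs theta) => a [_ ->]; have [] := sJ a.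
- move=> k u v Ju Jv; apply: filterS3 (fib_linear hs horth hdense k u v) Ju Jv.
  by move=> a -> ? ?; have [_ _] := sJ a; apply.
Qed.

Lemma fibers_in_rep J x u : (forall a, closed_subspace (J a)) ->
  fibers_in J u -> fibers_in J (rep x u).
Proof.
move=> sJ Ju; apply: filterS2 Ju (fib_rep x u) => a Ja ->.
exact: subspaceZ.
Qed.

Lemma ae_forall_set (A : set H) (P : H -> T -> Prop) : countable A ->
  (forall u, A u -> {ae mu, forall a, P u a}) ->
  {ae mu, forall a, forall u, A u -> P u a}.
Proof.
move=> /countable_injP[f finj] hP.
have : {ae mu, forall a, forall n u, A u -> f u = n -> P u a}.
  apply: ae_foralln => n.
  have [[u [Au fu]]|h] := pselect (exists u, A u /\ f u = n).
    apply: filterS (hP u Au) => a Pu v Av fv.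
    by rewrite (finj v u) ?inE// fu.
  by apply: aeW => a u Au fu; exfalso; apply: h; exists u.
by apply: filterS => a h u Au; exact: h Au erefl.
Qed.

Lemma fib_eq0 u : {ae mu, forall a, fib u a = 0} -> u = 0.
Proof.
move=> h; apply: nsq_eq0; rewrite -(brn_integral hs) /Rintegral.
rewrite (@ae_eq_integral _ _ _ mu setT (cst 0%E))//; first by rewrite integral0.
  by apply/measurable_EFinP; exact: integrable_meas (brn_int hs u).
apply: filterS2 h (fib_norm hs horth hdense u) => a h0 /= <- _.
by rewrite h0 nsq0.
Qed.

Definition orbit (A : set H) : set H := [set v | exists x, exists2 u, A u & v = rep x u].

(** A vector of the left side orthogonal to the right side has fibers in
    J a orthogonal to J a. *)
Lemma fibers_in_span (A : set H) J : countable A ->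
  {ae mu, forall a, J a = closed_span [set fib u a | u in A]} ->
  (forall a, closed_subspace (J a)) ->
  fibers_in J = closed_span (orbit A).
Proof.
move=> cA JE sJ; have sV := fibers_in_subspace sJ.
have cH := @hilbert_nsq_complete R H.
have sub : closed_span (orbit A) `<=` fibers_in J.
  apply: closed_span_min => // _ [x [u Au ->]]; apply: fibers_in_rep => //.
  by apply: filterS JE => a ->; apply: closed_span_sub; exists u.
apply/seteqP; split=> // phi Jphi.
have sS := closed_span_subspace (orbit A).
pose q := phi - orth_proj (closed_span (orbit A)) phi.
have Jq : fibers_in J q.
  by apply: subspaceB => //; apply: sub; exact: proj_in.
have q_orth x u : A u -> '[q, rep x u] = 0.
  move=> Au; apply: proj_orth => //; apply: closed_span_sub.
  by exists x, u.
have hq : {ae mu, forall a, forall u, A u -> '[fib q a, fib u a] = 0}.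
  apply: ae_forall_set => // u Au.
  apply: filterS2 (fib_inner hs horth hdense q u) (br_eq0 hs (q_orth^~ u ^~ Au)) => a -> //.
have q0 : q = 0.
  apply: fib_eq0; apply: filterS3 hq JE Jq => a h JEa.
  rewrite JEa => hJ; apply: nsq_eq0; rewrite /nsq.
  by rewrite (closed_span_orthogonal _ hJ)// => _ [u Au <-]; exact: h.
by move/eqP: q0; rewrite subr_eq0 => /eqP ->; exact: proj_in.
Qed.

Definition supported a : set (l2 R I) :=
  [set w | forall i, brn br (theta i) a = 0 -> w i = 0].

Lemma intg_ae (f g : T -> R) : measurable_fun [set: T] g ->
  mu.-integrable [set: T] (EFin \o f) -> {ae mu, forall a, f a = g a} ->
  mu.-integrable [set: T] (EFin \o g).
Proof.
move=> mg /integrableP[mf fi] fg; apply/integrableP; split; first exact/measurable_EFinP.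
apply: le_lt_trans fi; rewrite le_eqVlt; apply/orP; left; apply/eqP.
apply: ae_eq_integral => //.
- by apply: measurableT_comp => //; exact/measurable_EFinP.
- exact: measurableT_comp.
- by apply: filterS fg => a /= -> _.
Qed.

Lemma sqr_sqrt_le (w : R) : Num.sqrt w ^+ 2 <= `|w|.
Proof.
have [w0|/ltW w0] := leP 0 w; first by rewrite sqr_sqrtr// ler_norm.
by rewrite ler0_sqrtr// expr0n /= normr_ge0.
Qed.

Lemma Re_inner_le (V : innerProductType R) (u v : V) :
  `|complex.Re '[u, v]| <= nsq u + nsq v.
Proof.
have := nsq_ge0 (u + v); have := nsq_ge0 (u - v); rewrite nsqB nsqD => h1 h2.
have := nsq_ge0 u; have := nsq_ge0 v => ? ?.
by rewrite ler_norml; apply/andP; split; lra.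
Qed.

Lemma Im_inner_le (V : innerProductType R) (u v : V) :
  `|complex.Im '[u, v]| <= nsq u + nsq v.
Proof.
have := Re_inner_le u ('i%C *: v); rewrite innerZr nsqZ !cE /= /csq /=.
by rewrite mul0r sub0r mulNr mul1r opprK expr0n /= add0r expr1n mul1r.
Qed.

(** The vector psi represents the functional phi |-> \int '[fib phi a, g a]; on
    translates of the generators uniqueness of the Fourier transform identifies
    the coordinates of its fibers. *)
Lemma fib_surjective (g : T -> l2 R I) (h : T -> R) :
  (forall i, cmeasurable (fun a => g a i)) ->
  mu.-integrable [set: T] (EFin \o h) -> (forall a, nsq (g a) <= h a) ->
  {ae mu, forall a, supported a (g a)} ->
  exists psi, {ae mu, forall a, fib psi a = g a}.
Proof.
move=> mg ih gh sg.
have i_nsq phi : mu.-integrable [set: T] (EFin \o (fun a => nsq (fib phi a))).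
  apply: (@intg_ae (brn br phi)); last first.
  - by apply: filterS (fib_norm hs horth hdense phi) => a ->.
  - exact: (brn_int hs phi).
  - by apply: measurable_nsq => i; exact: (fib_measurable hs theta phi i).
have m_in phi : cmeasurable (fun a => '[fib phi a, g a]).
  by apply: measurable_inner => // i; exact: (fib_measurable hs theta phi i).
have i_in phi : cintegrable mu (fun a => '[fib phi a, g a]).
  have [m1 m2] := m_in phi.
  split; apply: (integrable_bound _ (intgD (i_nsq phi) ih)) => // a.
    by apply: le_trans (Re_inner_le _ _) _; rewrite lerD2l.
  by apply: le_trans (Im_inner_le _ _) _; rewrite lerD2l.
pose L phi := cintegral mu (fun a => '[fib phi a, g a]).
have [psi hpsi] : exists psi, forall phi, L phi = '[phi, psi].
  apply: (@riesz _ _ L (\int[mu]_a h a)); first exact: hilbert_nsq_complete.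
  - move=> k u v; rewrite /L -cintegralZ// -cintegralD//; last exact: cintegrableZ.
    apply: cintegral_ae => //.
      by apply: cmeasurableD => //; apply: cmeasurableM => //; exact: cmeasurable_cst.
    apply: filterS (fib_linear hs horth hdense k u v) => a ->.
    by rewrite innerDl innerZl.
  - move=> phi; rewrite /L /=.
    have [i1 _] := i_in phi; apply: le_trans (le_normr_Rintegral _ i1) _ => //.
    rewrite -(brn_integral hs).
    have E : \int[mu]_a brn br phi a = \int[mu]_a nsq (fib phi a).
      rewrite /Rintegral; congr fine; apply: ae_eq_integral => //.
      + by apply/measurable_EFinP; exact: (integrable_meas (brn_int hs phi)).
      + by apply/measurable_EFinP; exact: (integrable_meas (i_nsq phi)).
      + by apply: filterS (fib_norm hs horth hdense phi) => a /= -> _.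
    rewrite E -RintegralD//; apply: le_Rintegral => //.
    + exact: intg_norm.
    + exact: intgD.
    + by move=> a _; apply: le_trans (Re_inner_le _ _) _; rewrite lerD2l.
exists psi.
pose W j a : R := Num.sqrt (brn br (theta j) a).
have mW j : measurable_fun [set: T] (W j).
  apply: measurableT_comp; last exact: (integrable_meas (brn_int hs (theta j))).
  by apply: continuous_measurable_fun; exact: sqrt_continuous.
have hj j : {ae mu, forall a, br psi (theta j) a = (W j a)%:C%C * g a j}.
  apply: (br_unique hs).
    have [m1 m2] := cmeasurableM (cmeasurable_real (mW j)) (mg j).
    have bd a : W j a ^+ 2 <= `|brn br (theta j) a| by exact: sqr_sqrt_le.
    have amgm (x y p q : R) : x ^+ 2 <= p -> y ^+ 2 <= q -> `|x * y| <= p + q.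
      move=> xp yq; have := sqr_ge0 (x + y); have := sqr_ge0 (x - y).
      rewrite sqrrB sqrrD => h1 h2; have := sqr_ge0 x; have := sqr_ge0 y => ? ?.
      by rewrite ler_norml; apply/andP; split; lra.
    have gj a : csq (g a j) <= h a by exact: le_trans (csq_le_nsq _ _) (gh a).
    split; apply: (integrable_bound _ (intgD (intg_norm (brn_int hs (theta j))) ih)) => // a.
      rewrite ReM /= mul0r subr0; apply: amgm => //.
      by apply: le_trans (gj a); rewrite /csq lerDl sqr_ge0.
    rewrite ImM /= mul0r addr0; apply: amgm => //.
    by apply: le_trans (gj a); rewrite /csq lerDr sqr_ge0.
  move=> x; rewrite innerC -hpsi /L -cintegral_conj//.
  have mE : cmeasurable (e x) by case: hs => he _ _ _ _; exact: (char_meas he x).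
  apply: cintegral_ae.
  - exact: cmeasurable_conj.
  - by apply: cmeasurableM; [apply: cmeasurableM => //; exact: cmeasurable_real|exact: cmeasurable_conj].
  - apply: filterS (fib_generator hs horth x j) => a [_ ->].
    rewrite innerZl innerC inner_delta !conjM !conjCK conj_real /W; ring.
have hall : {ae mu, forall a, forall j, br psi (theta j) a = (W j a)%:C%C * g a j /\
    0 <= brn br (theta j) a}.
  by apply: ae_forall_countable => j; exact: (filterI (hj j) (brn_ge0 hs (theta j))).
apply: filterS3 hall sg (coord_l2_ae hs horth hdense psi) => a h1 h2 g1.
apply: l2_ext => j; have [h3 h4] := h1 j; rewrite fibE// /coord h3 /W.
have [w0|w0] := eqVneq (brn br (theta j) a) 0; first by rewrite h2// mulr0 mul0r.
rewrite mulrAC -rmorphM/= /rsqrt divff ?mul1r// gt_eqF// sqrtr_gt0.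
by rewrite lt_neqAle h4 eq_sym w0.
Qed.

(** The projection on J of a weighted basis vector is a field of fibers of some
    vector, which lies in fibers_in J and therefore in fibers_in K. The weight is
    what makes the field square-integrable. *)
Lemma fibers_in_mono J K : (forall a, closed_subspace (J a)) ->
  (forall a, closed_subspace (K a)) ->
  (forall w z : l2 R I, cmeasurable (fun a => '[orth_proj (J a) w, z])) ->
  {ae mu, forall a, J a `<=` supported a} ->
  fibers_in J `<=` fibers_in K -> {ae mu, forall a, J a `<=` K a}.
Proof.
move=> sJ sK mJ Jsup JK; have cV := @l2_nsq_complete R I.
have hi i : {ae mu, forall a,
    K a ((Num.sqrt (brn br (theta i) a))%:C%C *: orth_proj (J a) (l2delta R i))}.
  pose g a : l2 R I := (Num.sqrt (brn br (theta i) a))%:C%C *: orth_proj (J a) (l2delta R i).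
  have mg j : cmeasurable (fun a => g a j).
    apply: cmeasurableM.
      apply: cmeasurable_real; apply: measurableT_comp; last first.
        exact: (integrable_meas (brn_int hs (theta i))).
      by apply: continuous_measurable_fun; exact: sqrt_continuous.
    have := mJ (l2delta R i) (l2delta R j); congr cmeasurable.
    by apply/funext => a; rewrite inner_delta.
  have bg a : nsq (g a) <= `|brn br (theta i) a|.
    rewrite nsqZ csq_real; apply: (@le_trans _ _ (Num.sqrt (brn br (theta i) a) ^+ 2)).
      rewrite -[leRHS]mulr1 ler_wpM2l ?sqr_ge0// -(nsq_delta R i).
      exact: nsq_proj_le.
    exact: sqr_sqrt_le.
  have sg : {ae mu, forall a, supported a (g a)}.
    apply: filterS Jsup => a Js j w0; rewrite l2Z (Js _ _ j w0) ?mulr0//.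
    exact: proj_in.
  have [psi hpsi] := fib_surjective mg (intg_norm (brn_int hs (theta i))) bg sg.
  have : fibers_in K psi.
    apply: JK; apply: filterS hpsi => a ->.
    by apply: subspaceZ => //; exact: proj_in.
  by move=> Kpsi; apply: filterS2 hpsi Kpsi => a ->.
have hall : {ae mu, forall a, forall i,
    K a ((Num.sqrt (brn br (theta i) a))%:C%C *: orth_proj (J a) (l2delta R i)) /\
    0 <= brn br (theta i) a}.
  by apply: ae_forall_countable => i; exact: (filterI (hi i) (brn_ge0 hs (theta i))).
apply: filterS2 hall Jsup => a h Js; apply: subspace_of_projections => // i.
have [Ki w0] := h i.
have [w1|w1] := eqVneq (brn br (theta i) a) 0.
  have -> : orth_proj (J a) (l2delta R i) = 0.
    apply: nsq_eq0; rewrite /nsq proj_inner//; last exact: proj_in.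
    rewrite innerC inner_delta (Js _ _ i w1) ?conjC0//; exact: proj_in.
  by have [] := sK a.
have s0 : (Num.sqrt (brn br (theta i) a))%:C%C != 0 :> R[i].
  by rewrite eq_complex /= negb_and gt_eqF// sqrtr_gt0 lt_neqAle eq_sym w1.
rewrite -[orth_proj _ _]scale1r -(mulVf s0) -scalerA.
exact: subspaceZ.
Qed.

End range_functions.

(** * Measurability of closed spans *)

Section rational_combinations.
Variables (R : realType) (V : innerProductType R) (S : Type).

Definition cratr (p : rat * rat) : R[i] := (ratr p.1 +i* ratr p.2)%C.

Definition rat_comb (v : S -> V) (s : seq (S * (rat * rat))) : V :=
  \sum_(t <- s) cratr t.2 *: v t.1.

Lemma cratr_dense (z : R[i]) (eps : R) : 0 < eps -> exists p, csq (z - cratr p) < eps.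
Proof.
move=> e0; set r := Num.sqrt (eps / 2).
have r0 : 0 < r by rewrite sqrtr_gt0 divr_gt0.
have key (x : R) : exists q : rat, (x - ratr q) ^+ 2 < eps / 2.
  have [q] := @rat_in_itvoo R (x - r) (x + r) ltac:(lra).
  rewrite in_itv /= => /andP[h1 h2]; exists q.
  rewrite -(sqr_sqrtr (ltW (divr_gt0 e0 (ltr0n R 2) : 0 < eps / 2))) -/r.
  rewrite -(real_normK (num_real (x - _))) ltr_pXn2r ?nnegrE ?normr_ge0 ?sqrtr_ge0//.
  by rewrite ltr_norml; apply/andP; split; lra.
have [p hp] := key (complex.Re z); have [q hq] := key (complex.Im z).
by exists (p, q); rewrite /csq !cE /= (splitr eps) ltrD.
Qed.

Lemma rat_comb_dense (v : S -> V) u (eps : R) : closed_span (range v) u -> 0 < eps ->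
  exists s, nsq (u - rat_comb v s) < eps.
Proof.
pose Q := range (rat_comb v).
have QD x y : Q x -> Q y -> Q (x + y).
  by move=> [s _ <-] [t _ <-]; exists (s ++ t) => //; rewrite /rat_comb big_cat.
have QZ p x : Q x -> Q (cratr p *: x).
  move=> [s _ <-]; exists [seq (t.1, (p.1 * t.2.1 - p.2 * t.2.2, p.1 * t.2.2 + p.2 * t.2.1)) | t <- s] => //.
  rewrite /rat_comb big_map scaler_sumr; apply: eq_bigr => t _ /=.
  rewrite scalerA; congr (_ *: _); apply: complex_ext.
    by rewrite !cE /= rmorphB/= !rmorphM.
  by rewrite !cE /= rmorphD/= !rmorphM.
have sQ : closed_subspace (closure Q).
  apply: subspace_closure; first by exists [::] => //; rewrite /rat_comb big_nil.
  move=> a x y Qx Qy; apply/closure_nsqP => e e0.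
  have n1 : 0 < nsq x + 1 by rewrite ltr_wpDl ?nsq_ge0.
  have [p hp] := cratr_dense a (divr_gt0 e0 n1).
  exists (cratr p *: x + y); first by apply: QD => //; exact: QZ.
  rewrite opprD addrACA subrr addr0 -scalerBl nsqZ.
  apply: (@le_lt_trans _ _ (csq (a - cratr p) * (nsq x + 1))).
    by rewrite ler_wpM2l ?csq_ge0// lerDl.
  by rewrite -ltr_pdivlMr.
move=> hu e0.
have /closure_nsqP/(_ _ e0)[_ [s _ <-] hs] : closure Q u; last by exists s.
apply: (closed_span_min sQ _ (t := u)) hu => _ [i _ <-]; apply: (@subset_closure _ Q).
exists [:: (i, (1, 0))] => //; rewrite /rat_comb big_seq1 /=.
by rewrite (_ : cratr _ = 1) ?scale1r// /cratr /= rmorph1 rmorph0.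
Qed.

End rational_combinations.

Section measurable_spans.
Context {R : realType} {d : measure_display} {T : measurableType d}.
Variables (I S : countType) (F : S -> T -> l2 R I).
Hypothesis mF : forall s i, cmeasurable (fun a => F s a i).

Let J a := closed_span (range (F^~ a)).

(** The distance to the span is an infimum over the countably many rational
    combinations, and determines the projection by polarization. *)
Lemma measurable_span_projection (u v : l2 R I) :
  cmeasurable (fun a => '[orth_proj (J a) u, v]).
Proof.
have cV := @l2_nsq_complete R I.
have sJ a : closed_subspace (J a) by exact: closed_span_subspace.
have mcomb s i : cmeasurable (fun a => rat_comb (F^~ a) s i).
  elim: s => [|t s IH].
    rewrite (_ : (fun a => _) = (fun=> 0)); first exact: cmeasurable_cst.
    by apply/funext => a; rewrite /rat_comb big_nil.
  rewrite (_ : (fun a => _) = (fun a => cratr R t.2 * F t.1 a i + rat_comb (F^~ a) s i)).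
    by apply: cmeasurableD => //; apply: cmeasurableM => //; exact: cmeasurable_cst.
  by apply/funext => a; rewrite /rat_comb big_cons.
have mdist w : measurable_fun [set: T] (fun a => - nsq (w - orth_proj (J a) w)).
  apply: measurable_leP => r.
  rewrite (_ : [set a | _] = [set a | forall s, [set: seq (S * (rat * rat))] s ->
      [set a | - r <= nsq (w - rat_comb (F^~ a) s)] a]).
    apply: measurable_countable_cap => s _; apply: measurable_le_set.
      exact: measurable_cst.
    apply: measurable_nsq => i.
    have := cmeasurableD (cmeasurable_cst (w i)) (cmeasurableM (cmeasurable_cst (-1)) (mcomb s i)).
    by congr cmeasurable; apply/funext => a; rewrite mulN1r.
  apply/seteqP; split=> a /=.
    move=> h s _; rewrite lerNl; apply: le_trans h; rewrite lerN2.
    apply: nsq_dist_le => //; rewrite /rat_comb.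
    elim/big_ind: _ => [|x y|t _]; [by have [] := sJ a|exact: (subspaceD (sJ a))|].
    by apply: (subspaceZ _ (sJ a)); apply: closed_span_sub; exists t.1.
  move=> h; rewrite lerNl; apply/ler_addgt0Pr => e e0.
  have [s hs] := rat_comb_dense (proj_in cV (sJ a) w) e0.
  apply: le_trans (h s Logic.I) _.
  have -> : w - rat_comb (F^~ a) s = (w - orth_proj (J a) w) +
    (orth_proj (J a) w - rat_comb (F^~ a) s) by rewrite addrA subrK.
  rewrite nsqD (proj_orth cV (sJ a)); last first.
    apply: (subspaceB (sJ a)); first exact: (proj_in cV (sJ a)).
    rewrite /rat_comb; elim/big_ind: _ => [|x y|t _]; [by have [] := sJ a|exact: (subspaceD (sJ a))|].
    by apply: (subspaceZ _ (sJ a)); apply: closed_span_sub; exists t.1.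
  by rewrite mulr0 addr0 lerD2l ltW.
have mP w : measurable_fun [set: T] (fun a => nsq (orth_proj (J a) w)).
  rewrite (_ : (fun a => _) = (fun a => nsq w + - nsq (w - orth_proj (J a) w))).
    by apply: measurable_funD => //; exact: measurable_cst.
  by apply/funext => a; rewrite (nsq_proj cV (sJ a) w) addrK.
have mRe w z : measurable_fun [set: T] (fun a => complex.Re '[orth_proj (J a) w, z]).
  rewrite (_ : (fun a => _) = (fun a => 2^-1 * (nsq (orth_proj (J a) (w + z)) -
      nsq (orth_proj (J a) w) - nsq (orth_proj (J a) z)))).
    apply: measurable_funM; first exact: measurable_cst.
    by apply: measurable_funB => //; apply: measurable_funB.
  apply/funext => a; have := proj_linear cV (sJ a) 1 w z; rewrite !scale1r => ->.
  have PE : '[orth_proj (J a) w, orth_proj (J a) z] = '[orth_proj (J a) w, z].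
    rewrite -[LHS](proj_adj cV (sJ a) (orth_proj (J a) w) z).
    by rewrite (proj_id cV (sJ a) (proj_in cV (sJ a) w)).
  rewrite (nsqD (orth_proj (J a) w) (orth_proj (J a) z)) PE.
  have cancel (p q r : R) : p + q + r - p - q = r by ring.
  by rewrite cancel mulKf// pnatr_eq0.
split; first exact: mRe.
rewrite (_ : (fun a => _) = (fun a => complex.Re '[orth_proj (J a) u, 'i%C *: v])).
  exact: mRe.
by apply/funext => a; rewrite innerZr !cE /=; ring.
Qed.

End measurable_spans.

(** * The fiberization of a dual integrable representation *)

(* A bracket is a function on the group of characters, while its integrals live on
   the Borel space with the same carrier. *)
Local Notation on_borel br := (br : _ -> _ -> borel (dual _ _) -> _).

Section separability.
Variables (R : realType) (V : innerProductType R).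
Implicit Types (M A : set V).

(** Near each point of a countable dense set, and at each scale, pick a point of M
    if there is one. *)
Lemma separable_subset M (m0 : V) : separable V -> M m0 ->
  exists f : nat * nat -> V, (forall p, M (f p)) /\ M `<=` closure (range f).
Proof.
move=> [D cD dD] Mm0.
have [d0 [_ Dd0]] : [set: V] `&` D !=set0.
  by apply: dD; [exists m0|exact: openT].
have [dn [_ dsurj]] := countable_enumeration cD Dd0.
have /choice[f hf] (p : nat * nat) : exists m, M m /\
    ((exists m', M m' /\ nsq (m' - dn p.1) < p.2.+1%:R^-1) -> nsq (m - dn p.1) < p.2.+1%:R^-1).
  have [[m' [Mm' hm']]|h] := pselect (exists m', M m' /\ nsq (m' - dn p.1) < p.2.+1%:R^-1).
    by exists m'.
  by exists m0.
exists f; split=> [p|m Mm]; first exact: (hf p).1.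
apply/closure_nsqP => e e0.
have [k /(_ k (leqnn _)) hk] := inv_small (ltac:(by rewrite divr_gt0) : 0 < e / 4).
have k0 : 0 < (k.+1%:R^-1 : R) by rewrite invr_gt0.
have [x [mx /dsurj[n dx]]] : [set x | nsq (m - x) < k.+1%:R^-1]° `&` D !=set0.
  apply: dD; last exact: open_interior.
  exists m; rewrite /interior /=; apply/nbhs_nsqP.
  by exists k.+1%:R^-1.
have {}mx : nsq (m - dn n) < k.+1%:R^-1 by rewrite dx; exact: (interior_subset mx).
exists (f (n, k)); first by exists (n, k).
have h := (hf (n, k)).2 ltac:(by exists m).
rewrite /= in h; rewrite (_ : m - f (n, k) = (m - dn n) + (dn n - f (n, k))); last first.
  by rewrite addrA subrK.
apply: le_lt_trans (nsqD_le _ _) _; rewrite (nsq_subC (dn n)).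
move: h mx hk; move: (k.+1%:R^-1) => z; lra.
Qed.

End separability.

Lemma sqrtC_real (R : realType) (w : R) : 0 <= w ->
  sqrtC (w%:C%C : R[i]) = (Num.sqrt w)%:C%C.
Proof.
move=> w0; rewrite -{1}(sqr_sqrtr w0) rmorphXn/= sqrCK//.
by rewrite lecR sqrtr_ge0.
Qed.

Section fiberization_facts.
Variables (R : realType) (G : topologicalZmodType) (H : hilbertType R).
Variables (nu : {measure set (borel (dual R G)) -> \bar R}).
Variables (rep : G -> {linear H -> H}) (br : H -> H -> dual R G -> R[i]).
Hypotheses (hG : @second_countable G) (hrep : unitary_rep rep).
Hypothesis hbr : is_bracket rep nu br.
Variables (I : countType) (theta : I -> H).
Hypothesis htheta : orthogonal_generators rep theta.
Implicit Types (J : dual R G -> set (l2 R I)) (phi u v : H).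

Local Notation T := (borel (dual R G)).
Local Notation br' := (on_borel br).

Lemma bracket_system_dual : bracket_system nu (@eval R G) rep br'.
Proof.
have [hU hD _] := hrep.
split.
- exact: eval_family.
- exact: bounded_closure_borel.
- by move=> x u v; have [_] := hU x; apply.
- exact: hD.
- exact: hbr.
Qed.

Let hs := bracket_system_dual.

Lemma generators_orthogonal i j : i <> j -> forall x, '[theta i, rep x (theta j)] = 0.
Proof.
move=> ij x; have [h _] := htheta; apply: (h i j ij); apply: closed_span_sub.
  by exists 0, (theta i) => //; rewrite (rep0 hs).
by exists x, (theta j).
Qed.

Lemma generators_dense phi : closed_span (generators rep theta) phi.
Proof.
have [_ h] := htheta; have : [set: H] phi by [].
rewrite -h; apply: closed_span_min; first exact: closed_span_subspace.
move=> u [i _]; apply: closed_span_min; first exact: closed_span_subspace.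
by move=> _ [x [_ -> ->]]; apply: closed_span_sub; exists x, i.
Qed.

Let ho := generators_orthogonal.
Let hd := generators_dense.

Lemma fiber_coord phi : {ae nu, forall a : T, fiber br theta phi a = coord br' theta phi a}.
Proof.
have h : {ae nu, forall a : T, forall i, br (theta i) (theta i) a = (brn br' (theta i) a)%:C%C /\
    0 <= brn br' (theta i) a}.
  apply: ae_forall_countable => i.
  by apply: filterS2 (brnE hs (theta i)) (brn_ge0 hs (theta i)) => a.
apply: filterS h => a h; apply/funext => i; have [h1 h2] := h i.
rewrite /fiber /coord h1 sqrtC_real// indicE.
have [w0|w0] := eqVneq (brn br' (theta i) a) 0.
  rewrite memNset ?mul0r; last by rewrite /Omega /= h1 w0 eqxx.
  by rewrite w0 /rsqrt sqrtr0 invr0 mulr0.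
rewrite mem_set ?mul1r; last first.
  by rewrite /Omega /= h1 eq_complex /= negb_and w0.
by rewrite /rsqrt -fmorphV.
Qed.

Lemma fiber_fib phi : {ae nu, forall a : T, l2val (fib br' theta phi a) = fiber br theta phi a}.
Proof.
apply: filterS2 (fiber_coord phi) (coord_l2_ae hs ho hd phi) => a -> g.
exact: fibE.
Qed.

Lemma V_fibers_in J : V_ nu br theta J = fibers_in nu br' theta J.
Proof.
apply/seteqP; split=> phi h.
  (* the same statement over the Borel space, where almost-everywhere statements
     are known to form a filter *)
  have {}h : {ae nu, forall a : T, exists2 w, J a w & l2val w = fiber br theta phi a} := h.
  suff : {ae nu, forall a : T, J a (fib br' theta phi a)} by [].
  apply: filterS2 h (fiber_fib phi) => a [w Jw wE] fE.
  by rewrite (_ : fib _ _ _ _ = w)//; apply: val_inj; rewrite /= fE.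
have {}h : {ae nu, forall a : T, J a (fib br' theta phi a)} := h.
suff : {ae nu, forall a : T, exists2 w, J a w & l2val w = fiber br theta phi a} by [].
by apply: filterS2 h (fiber_fib phi) => a Ja fE; exists (fib br' theta phi a).
Qed.

(** The component of a supported vector orthogonal to J0 is again supported, and
    orthogonal to the basis vectors spanning J0, so its coordinates vanish. *)
Lemma J0_supported : {ae nu, forall a : T, J0 br theta a = supported br' theta a}.
Proof.
have h : {ae nu, forall a : T, forall i, br (theta i) (theta i) a = (brn br' (theta i) a)%:C%C}.
  by apply: ae_forall_countable => i; exact: (brnE hs (theta i)).
apply: filterS h => a h.
have om i : ~ Omega br theta i a <-> brn br' (theta i) a = 0.
  rewrite /Omega /= h eq_complex /= eqxx andbT; split.
    by move=> /negP; rewrite negbK => /eqP.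
  by move=> ->; rewrite eqxx.
have sS : closed_subspace (supported br' theta a).
  split=> /=.
  - apply: closed_nsq => w hw i wi; apply: csq_eq0; apply/eqP.
    rewrite eq_le csq_ge0 andbT; apply/ler_addgt0Pr => eps e0; rewrite add0r.
    have [m Sm wm] := hw eps e0; apply: ltW; apply: le_lt_trans wm.
    by have := csq_le_nsq (w - m) i; rewrite l2B (Sm i wi) subr0.
  - by move=> i _.
  - by move=> k u v hu hv i wi; rewrite l2L hu// hv// mulr0 addr0.
have cV := @l2_nsq_complete R I.
apply/seteqP; split.
  apply: closed_span_min => // _ [i _ <-] j wj; rewrite l2Z l2deltaE.
  have [ji|_] := eqVneq j i; last by rewrite mulr0.
  by rewrite indicE memNset ?mul0r//; apply/om; rewrite -ji.
move=> w Sw; have sJ : closed_subspace (J0 br theta a) by exact: closed_span_subspace.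
have r0 : w - orth_proj (J0 br theta a) w = 0.
  have Sp : supported br' theta a (orth_proj (J0 br theta a) w).
    apply: (closed_span_min sS _ (t := orth_proj (J0 br theta a) w)) (proj_in cV sJ w).
    move=> _ [i _ <-] j wj; rewrite l2Z l2deltaE.
    have [ji|_] := eqVneq j i; last by rewrite mulr0.
    by rewrite indicE memNset ?mul0r//; apply/om; rewrite -ji.
  apply: l2_ext => i; have [wi|wi] := eqVneq (brn br' (theta i) a) 0.
    by rewrite l2B Sw// Sp// subr0.
  have oi : Omega br theta i a by apply: contrapT => /om wi0; rewrite wi0 eqxx in wi.
  have := proj_orth cV sJ w (m := \1_(Omega br theta i) a *: l2delta R i)
    (closed_span_sub (ex_intro2 _ _ i Logic.I erefl)).
  by rewrite indicE mem_set// scale1r inner_delta.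
by move/eqP: r0; rewrite subr_eq0 => /eqP ->; exact: proj_in.
Qed.

Lemma fiber_span_fib (A : set H) : countable A ->
  {ae nu, forall a : T, fiber_span br theta A a = closed_span [set fib br' theta u a | u in A]}.
Proof.
move=> cA.
have h : {ae nu, forall a : T, forall u, A u -> l2val (fib br' theta u a) = fiber br theta u a}.
  by apply: ae_forall_set => // u _; exact: fiber_fib.
apply: filterS h => a h; rewrite /fiber_span; congr closed_span.
apply/seteqP; split=> w.
  by move=> [u Au wE]; exists u => //; apply: val_inj; rewrite /= h.
by move=> [u Au <-]; exists u => //; exact: h.
Qed.

Lemma orbit_span_dense (A A0 : set H) : A0 `<=` A -> A `<=` closure A0 ->
  orbit_span rep A0 = orbit_span rep A.
Proof.
move=> A0A AA0; apply/seteqP; split.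
  by apply: closed_span_mono => _ [x [u Au ->]]; exists x, u => //; exact: A0A.
have [cS _ _] : closed_subspace (orbit_span rep A0) by exact: closed_span_subspace.
apply: closed_span_min; first exact: closed_span_subspace.
move=> _ [x [u /AA0/closure_nsqP cu ->]]; apply: closed_nsqP => // eps e0.
have [v Av uv] := cu eps e0; exists (rep x v).
  by apply: closed_span_sub; exists x, v.
by rewrite -linearB/= /nsq (rep_inner hs).
Qed.

Lemma orbit_span_invariant (M : set H) : invariant_subspace rep M -> orbit_span rep M = M.
Proof.
move=> [sM iM]; apply/seteqP; split.
  by apply: closed_span_min => // _ [x [u Mu ->]]; exact: iM.
by move=> u Mu; apply: closed_span_sub; exists 0, u => //; rewrite (rep0 hs).
Qed.

End fiberization_facts.

Theorem theorem6p5 (R : realType) (G : topologicalZmodType) (hG : lca_group G)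
    (mu : {measure set (borel G) -> \bar R}) (hmu : haar_measure mu)
    (nu : {measure set (borel (dual R G)) -> \bar R})
    (hnu : dual_haar_measure mu nu)
    (H : hilbertType R) (hH : separable H)
    (rep : G -> {linear H -> H}) (hrep : unitary_rep rep)
    (br : H -> H -> dual R G -> R[i]) (hbr : is_bracket rep nu br)
    (I : countType) (theta : I -> H)
    (htheta : orthogonal_generators rep theta) :
  ((forall J : dual R G -> set (l2 R I), admissible nu br theta J ->
      invariant_subspace rep (V_ nu br theta J)) /\
   (forall J K : dual R G -> set (l2 R I),
      admissible nu br theta J -> admissible nu br theta K ->
      (V_ nu br theta J = V_ nu br theta K <->
       {ae nu, forall alpha, J alpha = K alpha})) /\
   (forall M : set H, invariant_subspace rep M ->
      exists2 J : dual R G -> set (l2 R I),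
        admissible nu br theta J & V_ nu br theta J = M)) /\
  (forall A A0 : set H, countable A0 -> A0 `<=` A -> A `<=` closure A0 ->
     V_ nu br theta (fiber_span br theta A0) = orbit_span rep A0 /\
     orbit_span rep A0 = orbit_span rep A).
Proof.
have [_ _ sG] := hG.
have hs := bracket_system_dual sG hrep hbr.
have ho := generators_orthogonal sG hrep hbr htheta.
have hd := generators_dense htheta.
pose VE J := V_fibers_in sG hrep hbr htheta J.
have span_eq (A0 : set H) (J : dual R G -> set (l2 R I)) : countable A0 ->
    (forall a, closed_subspace (J a)) ->
    {ae nu, forall a : borel (dual R G), J a = closed_span [set fib (on_borel br) theta u a | u in A0]} ->
    V_ nu br theta J = orbit_span rep A0.
  by move=> cA sJ JE; rewrite VE; exact: (fibers_in_span hs ho hd cA JE sJ).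
have mono (J K : dual R G -> set (l2 R I)) : admissible nu br theta J ->
    admissible nu br theta K -> V_ nu br theta J `<=` V_ nu br theta K ->
    {ae nu, forall alpha : borel (dual R G), J alpha `<=` K alpha}.
  rewrite !VE => -[sJ mJ J0J] [sK _ _] JK.
  apply: (fibers_in_mono hs ho hd sJ sK mJ _ JK).
  (* the same statement over the Borel space, where almost-everywhere statements
     are known to form a filter *)
  have {}J0J : {ae nu, forall a : borel (dual R G), J a `<=` J0 br theta a} := J0J.
  by apply: filterS2 J0J (J0_supported sG hrep hbr theta) => a h <-.
split; last first.
  move=> A A0 cA0 A0A AA0; split; last exact: (orbit_span_dense sG hrep hbr A0A AA0).
  apply: span_eq => // [a|]; first exact: closed_span_subspace.
  exact: (fiber_span_fib sG hrep hbr htheta cA0).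
split; [|split].
- move=> J [sJ _ _]; rewrite VE; split; first exact: (fibers_in_subspace hs ho hd sJ).
  by move=> x u; exact: (fibers_in_rep hs ho hd).
- move=> J K aJ aK; split=> [JK|JK].
    have JK1 : V_ nu br theta J `<=` V_ nu br theta K by rewrite JK.
    have KJ1 : V_ nu br theta K `<=` V_ nu br theta J by rewrite JK.
    suff : {ae nu, forall a : borel (dual R G), J a = K a} by [].
    apply: filterS2 (mono _ _ aJ aK JK1) (mono _ _ aK aJ KJ1) => a h1 h2.
    by apply/seteqP; split.
  have {}JK : {ae nu, forall a : borel (dual R G), J a = K a} := JK.
  rewrite !VE; apply/seteqP; split=> phi h.
    have {}h : {ae nu, forall a : borel (dual R G), J a (fib (on_borel br) theta phi a)} := h.
    suff : {ae nu, forall a : borel (dual R G), K a (fib (on_borel br) theta phi a)} by [].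
    by apply: filterS2 h JK => a + <-.
  have {}h : {ae nu, forall a : borel (dual R G), K a (fib (on_borel br) theta phi a)} := h.
  suff : {ae nu, forall a : borel (dual R G), J a (fib (on_borel br) theta phi a)} by [].
  by apply: filterS2 h JK => a + ->.
- move=> M iM; have [[cM M0 _] _] := iM.
  have [f [fM Mf]] := separable_subset hH M0.
  have cf : countable (range f) by apply: sub_countable (card_image_le _ _) _; exact: countableP.
  (* built from fib, whose coordinates are measurable everywhere and which agrees
     with the transform off a null set *)
  pose J (a : dual R G) := closed_span (range (fun p => fib (on_borel br) theta (f p) a)).
  have sJ a : closed_subspace (J a) by exact: closed_span_subspace.
  have fE a : range (fun p => fib (on_borel br) theta (f p) a) = [set fib (on_borel br) theta u a | u in range f].
    by rewrite image_comp.
  exists J.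
    split=> //.
      move=> u v; apply: measurable_span_projection => p i.
      exact: (fib_measurable hs).
    have h : {ae nu, forall a : borel (dual R G), forall p, coord_l2 (on_borel br) theta (f p) a}.
      by apply: ae_forall_countable => p; exact: (coord_l2_ae hs ho hd).
    suff : {ae nu, forall a : borel (dual R G), J a `<=` J0 br theta a} by [].
    apply: filterS2 h (J0_supported sG hrep hbr theta) => a h JE.
    apply: closed_span_min; first exact: closed_span_subspace.
    move=> _ [p _ <-]; rewrite JE => i wi; rewrite fibE// /coord wi.
    by rewrite /rsqrt sqrtr0 invr0 mulr0.
  rewrite (span_eq (range f)) => // [|]; last by apply: aeW => a; rewrite /J fE.
  rewrite (orbit_span_dense sG hrep hbr _ Mf); last by move=> _ [p _ <-].
  exact: (orbit_span_invariant sG hrep hbr iM).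
Qed.
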